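(* Let $\Omega\subset\mathbb C^n$ be a bounded hyperconvex domain and let $\{S_k\}$ be an interior convergent sequence in $\Omega^N$ with limit $S$. Assume that $S_k=(S'_k,S''_k)$, where $\{S'_k\}_{k\ge1}$ and $\{S''_k\}_{k\ge1}$ are interior convergent sequences in $\Omega^{N'}$ and $\Omega^{N''}$ respectively, with $N'+N''=N$. Suppose that $S'_k\to S'\in\Omega^{N'}$ and $S''_k\to S''\in\Omega^{N''}$, and that $\pi(S')\cap\pi(S'')=\emptyset$. Then the following statements are equivalent: (a) $G_{\Omega,S_k}$ converges in $L^1_{loc}$ on $\Omega\setminus\pi(S)$. (b) $G_{\Omega,S_k}$ converges locally uniformly on $\Omega\setminus\pi(S)$. (c) The two sequences $G_{\Omega,S'_k}$ and $G_{\Omega,S''_k}$ converge in $L^1_{loc}$ on $\Omega\setminus\pi(S')$ and $\Omega\setminus\pi(S'')$ respectively. (d) The two sequences $G_{\Omega,S'_k}$ and $G_{\Omega,S''_k}$ converge locally uniformly on $\Omega\setminus\pi(S')$ and $\Omega\setminus\pi(S'')$ respectively. Furthermore, when convergence occurs, writing $g:=\lim_kG_{\Omega,S_k}$, $g':=\lim_kG_{\Omega,S'_k}$, $g'':=\lim_kG_{\Omega,S''_k}$, we have $$g=\sup\{u\in PSH^-(\Omega):u\le g'+O(1),\ u\le g''+O(1)\}.$$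
   Context: A bounded domain $\Omega\subset\mathbb C^n$ is hyperconvex if it admits a negative continuous plurisubharmonic exhaustion function. $PSH^-(\Omega)$ is the set of nonpositive plurisubharmonic functions on $\Omega$. Pole tuples: for $S=(a_1,\dots,a_M)$, $\pi(S):=\{a_1,\dots,a_M\}$ is the set of its coordinates. A sequence $S_k=(a_{1,k},\dots,a_{M,k})\in\Omega^M$ is interior convergent if $a_{i,k}\ne a_{j,k}$ for all $1\le i<j\le M$ and all $k$, and $S_k$ converges to some $S\in\Omega^M$ (the coordinates of $S$ need not be distinct). For a tuple $S=(a_1,\dots,a_M)\in\Omega^M$ with distinct coordinates, the multipole Green function is $G_{\Omega,S}(z):=\sup\{u(z):u\in PSH^-(\Omega),\ u(z)\le\log|z-a_j|+O(1)\text{ as }z\to a_j,\ j=1,\dots,M\}$. The limits $g,g',g''$ are regarded as plurisubharmonic functions on $\Omega$. The notation $u\le h+O(1)$ means that there is a constant $C$ (depending on $u$) such that $u\le h+C$ on $\Omega$. *)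

(* Defs.v *)
From HB Require Import structures.
From mathcomp Require Import all_boot all_order all_algebra.
From mathcomp Require Import complex.
From mathcomp Require Import all_classical all_reals all_analysis.

Set Implicit Arguments.
Unset Strict Implicit.
Unset Printing Implicit Defensive.

Import Order.TTheory GRing.Theory Num.Theory.
Import numFieldNormedType.Exports.

Local Open Scope classical_set_scope.
Local Open Scope ring_scope.

(* The topology of R[i] is the one it has as a numFieldType.  Only the
   topological structures are copied: R[i] already carries the R-module
   structure of complex.v. *)
HB.instance Definition _ (R : rcfType) := PseudoMetric.copy R[i] R[i]^o.
HB.instance Definition _ (R : rcfType) := Pointed.copy R[i] R[i]^o.

Section ConsMeasure.
Local Open Scope ereal_scope.
Context d (T : measurableType d) (R : realType) (n : nat).
Variables (m1 : {sigma_finite_measure set T -> \bar R})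
  (m2 : {sigma_finite_measure set (n.-tuple T) -> \bar R}).

Definition tuple_cons (p : T * n.-tuple T) : n.+1.-tuple T :=
  [tuple of p.1 :: p.2].

Definition tuple_uncons (t : n.+1.-tuple T) : T * n.-tuple T :=
  (thead t, [tuple of behead t]).

Lemma tuple_consK : cancel tuple_cons tuple_uncons.
Proof.
by move=> [x t]; congr pair; apply: val_inj.
Qed.

Lemma measurable_tuple_cons : measurable_fun [set: T * n.-tuple T] tuple_cons.
Proof. exact: measurable_cons. Qed.

Lemma measurable_tuple_uncons :
  measurable_fun [set: n.+1.-tuple T] tuple_uncons.
Proof.
apply/measurable_fun_pairP; split; first exact: measurable_tnth.
exact: measurable_behead.
Qed.

Definition cons_measure : set (n.+1.-tuple T) -> \bar R :=
  pushforward (m1 \x m2) tuple_cons.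

HB.instance Definition _ := Measure.copy cons_measure
  (measure_function_pushforward__canonical__measure_function_Measure
    (m1 \x m2) measurable_tuple_cons).

Lemma cons_measure_sigma_finite : sigma_finite [set: n.+1.-tuple T] cons_measure.
Proof.
have /sigma_finiteP[F [TF ndF Foo]] := sigma_finiteT m1.
have /sigma_finiteP[G [TG ndG Goo]] := sigma_finiteT m2.
exists (fun i => tuple_uncons @^-1` (F i `*` G i)).
  rewrite -preimage_bigcup (_ : \bigcup_i _ = setT) ?preimage_setT//.
  apply/seteqP; split=> // -[x y] _.
  have [i _ Fix] : (\bigcup_i F i) x by rewrite -TF.
  have [j _ Gjy] : (\bigcup_i G i) y by rewrite -TG.
  exists (maxn i j) => //; split.
    by move: x Fix; exact/subsetPset/ndF/leq_maxl.
  by move: y Gjy; exact/subsetPset/ndG/leq_maxr.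
move=> i; have [mF Fi] := Foo i; have [mG Gi] := Goo i; split.
  rewrite -[X in measurable X]setTI; apply: measurable_tuple_uncons => //.
  exact: measurableX.
rewrite /cons_measure /pushforward -comp_preimage.
rewrite (_ : tuple_uncons \o tuple_cons = id); last exact/funext/tuple_consK.
by rewrite product_measure1E// lte_mul_pinfty// ge0_fin_numE.
Qed.

HB.instance Definition _ :=
  Measure_isSigmaFinite.Build _ _ _ cons_measure cons_measure_sigma_finite.

End ConsMeasure.

Fixpoint tuple_measure d (T : measurableType d) (R : realType)
    (mu : {sigma_finite_measure set T -> \bar R}) (n : nat) :
    {sigma_finite_measure set (n.-tuple T) -> \bar R} :=
  match n with
  | 0 => \d_([tuple] : 0.-tuple T)
  | k.+1 => cons_measure mu (tuple_measure mu k)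
  end.

Section PluripotentialTheory.
Context {R : realType}.
Local Notation C := R[i].

Section OneVariable.
Implicit Types (U : set C) (u : C -> \bar R).

Definition circle_mean u (a : C) (r : R) : \bar R :=
  (((2 * pi)^-1)%R%:E *
    \int[lebesgue_measure]_(t in `[0%R, (2 * pi)%R]%classic)
      u (a + ((r * cos t)%R +i* (r * sin t)%R)%C)%R)%E.

End OneVariable.

(* [u] takes values in [-oo, +oo[ on [D]. *)
Definition usc_on (T : topologicalType) (D : set T) (u : T -> \bar R) :=
  forall z, D z -> (u z < +oo)%E /\
    forall c : R, (u z < c%:E)%E -> \forall w \near within D (nbhs z), (u w < c%:E)%E.

(* The function identically -oo is allowed. *)
Definition subharmonic (U : set C) (u : C -> \bar R) :=
  usc_on U u /\
  forall (a : C) (r : R), 0 < r -> [set z : C | `|z - a| <= (r%:C)%C] `<=` U ->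
    (u a <= circle_mean u a r)%E.

Section SeveralVariables.
Variable n : nat.
Local Notation Cn := 'rV[C]_n.
Implicit Types (Om D K P : set Cn) (u v g : Cn -> \bar R) (S : seq Cn).

Definition enorm (z : Cn) : R :=
  Num.sqrt (\sum_(j < n) ((complex.Re (z 0 j)) ^+ 2 + (complex.Im (z 0 j)) ^+ 2)).

Definition psh Om u :=
  usc_on Om u /\
  forall a b : Cn,
    subharmonic [set t : C | Om (a + t *: b)] (fun t => u (a + t *: b)).

Definition psh_neg Om u := psh Om u /\ forall z, Om z -> (u z <= 0)%E.

Definition bounded_domain Om :=
  [/\ open Om, connected Om, Om !=set0 &
      exists M : R, forall z, Om z -> enorm z <= M].

Definition hyperconvex Om :=
  exists rho : Cn -> R,
    [/\ {within Om, continuous rho},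
        psh Om (EFin \o rho),
        forall z, Om z -> rho z < 0 &
        forall c : R, c < 0 ->
          compact (closure [set z | Om z /\ rho z < c]) /\
          closure [set z | Om z /\ rho z < c] `<=` Om].

(* [z] tends to [a] with [z != a], because [ln 0 = 0] in the library; a
   plurisubharmonic [u] satisfying the bound has [u a = -oo] when [n > 0]. *)
Definition log_pole u (a : Cn) :=
  exists c : R, \forall z \near a^', (u z <= (ln (enorm (z - a)) + c)%:E)%E.

(* The value is meaningful on [Om] only: functions of [psh_neg Om] are
   unconstrained outside [Om]. *)
Definition green Om S (z : Cn) : \bar R :=
  ereal_sup [set u z | u in
    [set u | psh_neg Om u /\ forall a, a \in S -> log_pole u a]].

Definition poles S : set Cn := [set a | a \in S].

Definition interior_cvg Om (M : nat) (S : nat -> M.-tuple Cn) (L : M.-tuple Cn) :=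
  [/\ forall k, uniq (S k),
      forall k, poles (S k) `<=` Om,
      poles L `<=` Om &
      forall j : 'I_M, tnth (S k) j @[k --> \oo] --> tnth L j].

(* Lebesgue measure on R^(2n), and R^(2n) seen as C^n through
   (x, y) |-> x + iy. *)
Definition leb2n := tuple_measure (@lebesgue_measure R) (n + n).

Definition of_coords (t : (n + n).-tuple (measurableTypeR R)) : Cn :=
  \row_(j < n) ((tnth t (lshift n j)) +i* (tnth t (rshift n j)))%C.

Definition L1loc D u :=
  forall K, compact K -> K `<=` D ->
    leb2n.-integrable (of_coords @^-1` K) (u \o of_coords).

Definition cvg_L1loc D (u : nat -> Cn -> \bar R) v :=
  [/\ forall k, L1loc D (u k), L1loc D v &
      forall K, compact K -> K `<=` D ->
        (\int[leb2n]_(t in of_coords @^-1` K)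
          `|u k (of_coords t) - v (of_coords t)|)%E @[k --> \oo] --> 0%E].

(* The difference is infinite wherever one of the two values is, so the limit is
   finite on [D]. *)
Definition cvg_locunif D (u : nat -> Cn -> \bar R) v :=
  forall z, D z -> exists2 V, nbhs z V & forall e : R, 0 < e ->
    \forall k \near \oo, forall w, D w -> V w -> (`|u k w - v w| < e%:E)%E.

Definition le_O1 Om u v :=
  exists c : R, forall z, Om z -> (u z <= v z + c%:E)%E.

End SeveralVariables.
End PluripotentialTheory.

(* Main.v *)
Require Import Defs.
From mathcomp Require Import all_boot all_order all_algebra.
From mathcomp Require Import complex.
From mathcomp Require Import all_classical all_reals all_analysis.
From mathcomp Require Import measurable_realfun ring lra.

(* Write G_k, G'_k, G''_k for the Green functions of S_k, S'_k, S''_k. Composing a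
   competitor for G_k with a polynomial map close to the identity that fixes the
   poles, and gluing it near the boundary with a barrier built from the
   exhaustion, shows that the G_k are equicontinuous away from pi(S). Hence
   locally uniform convergence, L^1_loc convergence and pointwise convergence are
   equivalent, and the upper limit of the G_k, set to -oo on pi(S), is
   plurisubharmonic.
   If u is a competitor for the sup formula, then (1 + d) max(u, b_k), with b_k a
   barrier with poles S_k, lies below G'_k - B close to pi(S') and above it a
   little further away, and likewise for G''_k; gluing gives a competitor for
   G_k, hence u <= lim inf G_k. Applied to the upper limit of the G_k, which is
   at most g' and g'', this gives convergence of G_k. Conversely
   G'_k + G''_k <= G_k <= G'_k, so that G_k and G'_k differ by a bounded amount
   near pi(S') and the same gluing, with the roles exchanged, bounds lim inf G'_k
   from below by the upper limit of the G'_k. *)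

Set Implicit Arguments.
Unset Strict Implicit.
Unset Printing Implicit Defensive.
Import Order.TTheory GRing.Theory Num.Theory.
Import numFieldNormedType.Exports.
Local Open Scope classical_set_scope.
Local Open Scope ring_scope.

(** * Norms and compactness in C^n *)

Section ComplexSpace.
Context {R : realType}.
Local Notation C := R[i].

(** [psh] only tests circles in complex lines, while equicontinuity composes competitors with a
    nonlinear map, so the obstacle is the submean inequality along polynomial discs ([lpsh_curve]).
    It comes from sup-convolving truncations: at a point where the supremum is attained, the
    inequality on the tangent line passes to the curve with quadratic error, and a finite average
    over rotations leads from small circles to the unit circle. The same infinitesimal form makes
    plurisubharmonicity local, as gluing requires. The displacement of the polynomial map vanishes
    to first order at the poles: logarithmic poles survive up to a constant, while one point can be
    sent to any nearby one. The factor 1 + d is used because, close to a logarithmic pole, d times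
    the function outweighs every additive constant. The slopes and radii do not depend on k, so
    poles may collide in the limit. For the final formula an L1 limit must be known at every point,
    not almost everywhere: rotations preserve Lebesgue measure, so almost every small circle meets a
    null set in a null set of angles, and circle means do not see the exceptional set. *)

Definition cabs (t : C) : R := Num.sqrt (complex.Re t ^+ 2 + complex.Im t ^+ 2).

Lemma normcE_cabs (t : C) : `|t| = ((cabs t)%:C)%C.
Proof. exact: normc_def. Qed.

Lemma cabs_ge0 t : 0 <= cabs t.
Proof. exact: sqrtr_ge0. Qed.

Lemma cabs_inj (x y : R) : (x%:C)%C = (y%:C)%C :> C -> x = y.
Proof. by case. Qed.

Lemma cabsM t s : cabs (t * s) = cabs t * cabs s.
Proof. by apply: cabs_inj; rewrite rmorphM/= -!normcE_cabs normrM. Qed.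

Lemma cabsD t s : cabs (t + s) <= cabs t + cabs s.
Proof. by rewrite -lecR rmorphD/= -!normcE_cabs ler_normD. Qed.

Lemma cabs_eq0 t : (cabs t == 0) = (t == 0).
Proof.
rewrite -(normr_eq0 t) normcE_cabs; apply/eqP/eqP => [->//|]; exact: cabs_inj.
Qed.

Lemma cabs0 : cabs 0 = 0.
Proof. by apply/eqP; rewrite cabs_eq0. Qed.

Lemma cabs1 : cabs 1 = 1.
Proof. by apply: cabs_inj; rewrite -normcE_cabs normr1. Qed.

Lemma cabsN t : cabs (- t) = cabs t.
Proof. by apply: cabs_inj; rewrite -!normcE_cabs normrN. Qed.

Lemma cabs_distC t s : cabs (t - s) = cabs (s - t).
Proof. by rewrite -cabsN opprB. Qed.

Lemma cabsX t k : cabs (t ^+ k) = cabs t ^+ k.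
Proof. by elim: k => [|k IH]; rewrite ?expr0 ?cabs1// !exprS cabsM IH. Qed.

Lemma cabsR (x : R) : cabs (x%:C)%C = `|x|.
Proof. by rewrite /cabs/= expr0n/= addr0 sqrtr_sqr. Qed.

Lemma cabs_sqr t : cabs t ^+ 2 = complex.Re t ^+ 2 + complex.Im t ^+ 2.
Proof. by rewrite /cabs sqr_sqrtr// addr_ge0// sqr_ge0. Qed.

Lemma Re_le_cabs t : `|complex.Re t| <= cabs t.
Proof. by rewrite -sqrtr_sqr /cabs ler_wsqrtr// lerDl sqr_ge0. Qed.

Lemma Im_le_cabs t : `|complex.Im t| <= cabs t.
Proof. by rewrite -sqrtr_sqr /cabs ler_wsqrtr// lerDr sqr_ge0. Qed.

Lemma cabs_le_ReIm t : cabs t <= `|complex.Re t| + `|complex.Im t|.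
Proof.
rewrite -(ler_pXn2r (n := 2))// ?nnegrE ?cabs_ge0 ?addr_ge0//.
rewrite cabs_sqr sqrrD !real_normK ?num_real// addrAC lerDl.
by rewrite mulrn_wge0// mulr_ge0.
Qed.

Lemma complex_posP (e : C) : 0 < e -> exists2 r : R, 0 < r & e = (r%:C)%C.
Proof.
by case: e => a b; rewrite ltcE/= => /andP[/eqP -> a0]; exists a.
Qed.

Lemma nbhs_cabsP (t : C) (V : set C) :
  nbhs t V <-> exists2 r : R, 0 < r & forall s, cabs (s - t) < r -> V s.
Proof.
split=> [/nbhs_ballP[e /= /complex_posP[r r0 ->] tV]|[r r0 tV]].
  exists r => // s sr; apply: tV; rewrite /ball/= /ball_/= normcE_cabs cabs_distC.
  by rewrite ltcR.
apply/nbhs_ballP; exists (r%:C)%C => /=; first by rewrite ltcR.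
move=> s; rewrite /ball/= /ball_/= normcE_cabs ltcR cabs_distC; exact: tV.
Qed.

Section Vectors.
Variable n : nat.
Local Notation Cn := 'rV[C]_n.
Implicit Types z w : Cn.

(** The real part of the Hermitian product. Its imaginary part is, up to sign, [hdot ('i%C *: z) w],
    so complex statements reduce to real Euclidean algebra. *)
Definition hdot z w : R := \sum_(j < n)
  (complex.Re (z 0 j) * complex.Re (w 0 j) + complex.Im (z 0 j) * complex.Im (w 0 j)).

Lemma hdotC z w : hdot z w = hdot w z.
Proof. by apply: eq_bigr => j _; rewrite mulrC [X in _ + X]mulrC. Qed.

Lemma hdotDl z1 z2 w : hdot (z1 + z2) w = hdot z1 w + hdot z2 w.
Proof.
rewrite /hdot -big_split/=; apply: eq_bigr => j _; rewrite mxE.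
by case: (z1 0 j) (z2 0 j) => a b [c d] /=; ring.
Qed.

Lemma hdotDr z w1 w2 : hdot z (w1 + w2) = hdot z w1 + hdot z w2.
Proof. by rewrite hdotC hdotDl !(hdotC z). Qed.

Lemma hdotZl (x : R) z w : hdot ((x%:C)%C *: z) w = x * hdot z w.
Proof.
rewrite /hdot mulr_sumr; apply: eq_bigr => j _; rewrite mxE.
by case: (z 0 j) => a b /=; ring.
Qed.

Lemma hdotZr (x : R) z w : hdot z ((x%:C)%C *: w) = x * hdot z w.
Proof. by rewrite hdotC hdotZl hdotC. Qed.

Lemma hdotNl z w : hdot (- z) w = - hdot z w.
Proof.
have -> : - z = ((-1 : R)%:C)%C *: z by rewrite rmorphN rmorph1 scaleN1r.
by rewrite hdotZl mulN1r.
Qed.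

Lemma hdotNr z w : hdot z (- w) = - hdot z w.
Proof. by rewrite hdotC hdotNl hdotC. Qed.

Lemma enorm_hdot z : enorm z ^+ 2 = hdot z z.
Proof.
rewrite /enorm sqr_sqrtr; last by apply: sumr_ge0 => j _; rewrite addr_ge0// sqr_ge0.
by apply: eq_bigr => j _; rewrite !expr2.
Qed.

Lemma hdot_ge0 z : 0 <= hdot z z.
Proof. by rewrite -enorm_hdot sqr_ge0. Qed.

Lemma enorm_ge0 z : 0 <= enorm z.
Proof. exact: sqrtr_ge0. Qed.

Lemma enorm_eq0 z : (enorm z == 0) = (z == 0).
Proof.
apply/eqP/eqP => [z0|->]; last first.
  by rewrite /enorm big1 ?sqrtr0// => j _; rewrite mxE/= expr0n addr0.
have : hdot z z == 0 by rewrite -enorm_hdot z0 expr0n.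
rewrite psumr_eq0; last by move=> j _; rewrite -!expr2 addr_ge0// sqr_ge0.
move=> /allP z00; apply/rowP => j; rewrite mxE.
have := z00 j (mem_index_enum j); rewrite /= -!expr2 paddr_eq0 ?sqr_ge0// !sqrf_eq0.
by case: (z 0 j) => a b /= /andP[/eqP-> /eqP->].
Qed.

Lemma enorm0 : enorm (0 : Cn) = 0.
Proof. by apply/eqP; rewrite enorm_eq0. Qed.

Lemma hdot_enorm z w : hdot z w <= enorm z * enorm w.
Proof.
have [->|z0] := eqVneq z 0.
  rewrite enorm0 mul0r /hdot big1// => j _; rewrite mxE/=; ring.
have nz : 0 < enorm z by rewrite lt_neqAle eq_sym enorm_eq0 z0 enorm_ge0.
have := hdot_ge0 (((hdot z w)%:C)%C *: z - ((enorm z ^+ 2)%:C)%C *: w).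
rewrite !(hdotDl, hdotDr, hdotNl, hdotNr, hdotZl, hdotZr) -!enorm_hdot (hdotC w z).
set a := enorm z in nz *; set b := enorm w; set d := hdot z w.
have b0 : 0 <= b by exact: enorm_ge0.
rewrite (_ : _ + _ = a ^+ 2 * (a ^+ 2 * b ^+ 2 - d ^+ 2)); last by ring.
rewrite pmulr_rge0 ?exprn_gt0// subr_ge0 -exprMn => h.
have ab0 : 0 <= a * b by rewrite mulr_ge0// ltW.
rewrite leNgt; apply/negP => dab.
have : (a * b) ^+ 2 < d ^+ 2 by rewrite ltr_pXn2r// nnegrE// ltW// (le_lt_trans ab0).
by rewrite ltNge h.
Qed.

Lemma enorm_pos z : (0 < enorm z) = (z != 0).
Proof. by rewrite lt_neqAle eq_sym enorm_eq0 enorm_ge0 andbT. Qed.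

Lemma enormZ (t : C) z : enorm (t *: z) = cabs t * enorm z.
Proof.
apply/eqP; rewrite -(eqrXn2 (n := 2))// ?mulr_ge0 ?enorm_ge0 ?cabs_ge0//.
rewrite exprMn !enorm_hdot cabs_sqr /hdot mulr_sumr; apply/eqP.
apply: eq_bigr => j _; rewrite mxE.
by case: (z 0 j) t => a b [c d] /=; ring.
Qed.

Lemma enormN z : enorm (- z) = enorm z.
Proof. by rewrite -scaleN1r enormZ cabsN cabs1 mul1r. Qed.

Lemma enorm_distC z w : enorm (z - w) = enorm (w - z).
Proof. by rewrite -enormN opprB. Qed.

Lemma enormD z w : enorm (z + w) <= enorm z + enorm w.
Proof.
rewrite -(ler_pXn2r (n := 2))// ?nnegrE ?addr_ge0 ?enorm_ge0//.
rewrite sqrrD !enorm_hdot hdotDl !hdotDr (hdotC w z) -!enorm_hdot.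
have := hdot_enorm z w; rewrite mulr2n; lra.
Qed.

Lemma enormB z w : enorm z - enorm w <= enorm (z - w).
Proof. by rewrite lerBlDr (le_trans _ (enormD _ _))// subrK. Qed.

Lemma enorm_triangle y z w : enorm (z - w) <= enorm (z - y) + enorm (y - w).
Proof. by rewrite (le_trans _ (enormD _ _))// addrA subrK. Qed.

Lemma cabs_le_enorm z j : cabs (z 0 j) <= enorm z.
Proof.
rewrite /cabs /enorm ler_wsqrtr// (bigD1 j)//= lerDl.
by apply: sumr_ge0 => k _; rewrite addr_ge0// sqr_ge0.
Qed.

Lemma enorm_le_cabs z (r : R) : 0 <= r -> (forall j, cabs (z 0 j) <= r) ->
  enorm z <= n%:R * r.
Proof.
move=> r0 zr.
rewrite -(ler_pXn2r (n := 2))// ?nnegrE ?mulr_ge0 ?enorm_ge0//.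
rewrite enorm_hdot exprMn.
have [n0|n0] := posnP n.
  rewrite /hdot; move: z zr; rewrite n0 => z _; rewrite big_ord0.
  by rewrite mulr_ge0// exprn_ge0.
apply: (@le_trans _ _ (\sum_(j < n) r ^+ 2)).
  by apply: ler_sum => j _; rewrite -!expr2 -cabs_sqr ler_pXn2r// nnegrE cabs_ge0.
rewrite sumr_const card_ord -[leLHS]mulr_natl ler_wpM2r ?sqr_ge0//.
by rewrite -natrX ler_nat expnS expn1 leq_pmulr.
Qed.

(** The Hermitian Cauchy-Schwarz inequality: the real one applied to A z + B i z, whose product with
    [w] is A^2 + B^2 and whose norm is sqrt(A^2 + B^2) times that of [z]. *)
Lemma hdot_bessel z w : hdot z w ^+ 2 + hdot ('i%C *: z) w ^+ 2 <=
  enorm z ^+ 2 * enorm w ^+ 2.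
Proof.
set A := hdot z w; set B := hdot ('i%C *: z) w.
have := hdot_enorm ((A%:C)%C *: z + (B%:C)%C *: ('i%C *: z)) w.
rewrite hdotDl !hdotZl -/A -/B -!expr2.
have -> : enorm ((A%:C)%C *: z + (B%:C)%C *: ('i%C *: z)) =
    Num.sqrt (A ^+ 2 + B ^+ 2) * enorm z.
  rewrite scalerA -scalerDl enormZ; congr (_ * _).
  rewrite /cabs; congr (Num.sqrt _); rewrite /=; ring.
set S := A ^+ 2 + B ^+ 2.
have S0 : 0 <= S by rewrite addr_ge0// sqr_ge0.
have := sqr_sqrtr S0; set s := Num.sqrt S => sS.
have s0 : 0 <= s by exact: sqrtr_ge0.
have := enorm_ge0 z; have := enorm_ge0 w; rewrite -sS.
set a := enorm z; set b := enorm w => b0 a0 h.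
rewrite -exprMn ler_pXn2r// ?nnegrE ?mulr_ge0//.
have [->|sn0] := eqVneq s 0; first exact: mulr_ge0.
have sp : 0 < s by rewrite lt_neqAle eq_sym sn0.
by rewrite -(ler_pM2l sp) mulrA -expr2.
Qed.

Lemma nbhs_enormP z (V : set Cn) :
  nbhs z V <-> exists2 r : R, 0 < r & forall w, enorm (w - z) < r -> V w.
Proof.
split=> [/nbhs_ballP[e /= /complex_posP[r r0 ->] zV]|[r r0 zV]].
  exists r => // w wr; apply: zV; split; first by rewrite ltcR.
  move=> i j; rewrite (ord1 i) /ball/= /ball_/= normcE_cabs cabs_distC ltcR.
  apply: le_lt_trans wr; apply: le_trans (cabs_le_enorm _ j).
  by rewrite !mxE.
have n1 : 0 < n.+1%:R :> R by [].
apply/nbhs_ballP; exists ((r / n.+1%:R)%:C)%C => /=; first by rewrite ltcR divr_gt0.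
move=> w [_ wz]; apply: zV.
apply: (@le_lt_trans _ _ (n%:R * (r / n.+1%:R))); last first.
  by rewrite mulrCA gtr_pMr// ltr_pdivrMr// mul1r ltr_nat.
apply: enorm_le_cabs; first by rewrite divr_ge0// ltW.
move=> j; rewrite !mxE; have := wz 0 j.
by rewrite /ball/= /ball_/= normcE_cabs cabs_distC ltcR => /ltW.
Qed.

End Vectors.

Lemma closed_box_compact (r : R) :
  compact [set t : C | `|complex.Re t| <= r /\ `|complex.Im t| <= r].
Proof.
have cK : compact (`[-r, r]%classic `*` `[-r, r]%classic : set (R * R)).
  by apply: compact_setX; exact: segment_compact.
pose f (p : R * R) : C := (p.1 +i* p.2)%C.
have cf : continuous f.
  move=> [x y] V /nbhs_cabsP[e e0 eV].
  have e2 : 0 < e / 2 by rewrite divr_gt0.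
  exists ([set x' | `|x - x'| < e / 2], [set x' | `|y - x'| < e / 2]) => /=.
    split; first by apply/nbhs_normP; exists (e / 2).
    by apply/nbhs_normP; exists (e / 2).
  move=> [a b] [/= xa yb]; apply: eV; apply: le_lt_trans (cabs_le_ReIm _) _ => /=.
  by rewrite (splitr e) ltrD// distrC.
rewrite (_ : [set _ | _] = f @` (`[-r, r]%classic `*` `[-r, r]%classic)).
  by apply: continuous_compact => //; apply: continuous_subspaceT.
apply/seteqP; split => [[a b] /= [ar br]|_ [[a b] /= [ar br]] <-] /=.
  by exists (a, b) => //=; rewrite !in_itv/= -!ler_norml.
by move: ar br; rewrite !in_itv/= -!ler_norml.
Qed.

Lemma closed_bounded_compactC (K : set C) (M : R) :
  closed K -> (forall t, K t -> cabs t <= M) -> compact K.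
Proof.
move=> cK KM; apply: (subclosed_compact cK (@closed_box_compact M)) => t /KM tM.
by split; [apply: le_trans tM; exact: Re_le_cabs|apply: le_trans tM; exact: Im_le_cabs].
Qed.

Lemma closed_bounded_compact n (K : set 'rV[C]_n) (M : R) :
  closed K -> (forall z, K z -> enorm z <= M) -> compact K.
Proof.
move=> cK KM.
apply: (subclosed_compact cK (@rV_compact _ _ (fun=> _) (fun=> @closed_box_compact M))).
move=> z /KM zM i; have := le_trans (cabs_le_enorm z i) zM => iM.
by split; [apply: le_trans iM; exact: Re_le_cabs|apply: le_trans iM; exact: Im_le_cabs].
Qed.

Lemma closed_enormP n (K : set 'rV[C]_n) :
  (forall z, ~ K z -> exists2 r : R, 0 < r & forall w, enorm (w - z) < r -> ~ K w) ->
  closed K.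
Proof.
move=> h; rewrite -[K]setCK; apply: open_closedC; rewrite openE => z /h[r r0 zr].
by apply/nbhs_enormP; exists r.
Qed.

End ComplexSpace.

Lemma lee_realP {R : realType} (x y : \bar R) :
  (forall r : R, (y < r%:E)%E -> (x <= r%:E)%E) -> (x <= y)%E.
Proof.
case: y => [y||] xy; last 2 first.
- by rewrite leey.
- case: x xy => [x|/(_ 0 (ltNyr _))|//] //.
  by move=> /(_ (x - 1) (ltNyr _)); rewrite lee_fin lerBrDr gerDl ler10.
- by apply/lee_addgt0Pr => e e0; rewrite -EFinD; apply: xy; rewrite lte_fin ltrDl.
Qed.

(** * Means over circles *)

Section CircleMeans.
Context {R : realType}.
Local Notation C := R[i].
Local Notation mu := (@lebesgue_measure R).
Local Notation TR := (measurableTypeR R).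
Local Notation I2 := (`[0, 2 * pi]%classic : set TR).

Definition cis (t : R) : C := (cos t +i* sin t)%C.

Lemma cabs_cis t : cabs (cis t) = 1.
Proof. by rewrite /cabs/= cos2Dsin2 sqrtr1. Qed.

Lemma cisD s t : cis (s + t) = cis s * cis t.
Proof. by rewrite /cis cosD sinD; apply/eqP; rewrite eq_complex/= addrC eqxx addrC mulrC/=; apply/eqP; ring. Qed.

Lemma cis0 : cis 0 = 1.
Proof. by rewrite /cis cos0 sin0. Qed.

Lemma cisX t k : cis t ^+ k = cis (k%:R * t).
Proof.
elim: k => [|k IH]; first by rewrite expr0 mul0r cis0.
by rewrite exprS IH -cisD -nat1r mulrDl mul1r.
Qed.

Lemma pi2_gt0 : 0 < 2 * pi :> R.
Proof. by rewrite mulr_gt0// pi_gt0. Qed.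

Lemma cis2pi : cis (2 * pi) = 1.
Proof. by rewrite mulr_natl /cis cos2pi sin2pi. Qed.

Lemma mu_I2 : mu I2 = (2 * pi)%:E.
Proof. by rewrite lebesgue_measure_itv/= lte_fin pi2_gt0 oppr0 addr0. Qed.

Lemma measurable_I2 : measurable I2.
Proof. exact: measurable_itv. Qed.
Hint Resolve measurable_I2 : core.

Definition cmean (f : TR -> \bar R) : \bar R :=
  (((2 * pi)^-1)%:E * \int[mu]_(t in I2) f t)%E.

(** Because of [fine] the value is faithful only when the mean is finite; [bmeas] is the class on
    which this is guaranteed and on which [rmean] is linear. *)
Definition rmean (f : TR -> R) : R := fine (cmean (EFin \o f)).

Definition bmeas (f : TR -> R) :=
  measurable_fun I2 f /\ exists M, forall t, I2 t -> `|f t| <= M.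

Lemma bmeas_integrable f : bmeas f -> mu.-integrable I2 (EFin \o f).
Proof.
move=> [mf [M fM]]; apply: measurable_bounded_integrable => //.
  by have := mu_I2; rewrite /= => ->; rewrite ltry.
by exists M; split; [exact: num_real|] => x Mx y /fM yM /=; exact: le_trans yM (ltW Mx).
Qed.

Lemma cmean_fin f : bmeas f -> cmean (EFin \o f) = (rmean f)%:E.
Proof.
move=> /bmeas_integrable fi; rewrite /rmean fineK// /cmean fin_numM//.
exact: integrable_fin_num.
Qed.

Lemma rmeanE f : bmeas f -> rmean f = (2 * pi)^-1 * \int[mu]_(t in I2) f t.
Proof.
move=> /bmeas_integrable fi; rewrite /rmean /cmean fineM//.
exact: integrable_fin_num.
Qed.

Lemma bmeas_cst c : bmeas (fun=> c).
Proof. by split; [exact: measurable_cst|exists `|c|]. Qed.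

Lemma bmeasD f g : bmeas f -> bmeas g -> bmeas (fun t => f t + g t).
Proof.
move=> [mf [M fM]] [mg [N gN]]; split; first exact: measurable_funD.
by exists (M + N) => t It; rewrite (le_trans (ler_normD _ _))// lerD ?fM ?gN.
Qed.

Lemma bmeasM f g : bmeas f -> bmeas g -> bmeas (fun t => f t * g t).
Proof.
move=> [mf [M fM]] [mg [N gN]]; split; first exact: measurable_funM.
by exists (M * N) => t It; rewrite normrM ler_pM ?fM ?gN.
Qed.

Lemma bmeasZ c f : bmeas f -> bmeas (fun t => c * f t).
Proof. by apply: bmeasM; exact: bmeas_cst. Qed.

Lemma bmeasN f : bmeas f -> bmeas (fun t => - f t).
Proof. by move=> /(bmeasZ (-1)); under eq_fun do rewrite mulN1r. Qed.

Lemma bmeasB f g : bmeas f -> bmeas g -> bmeas (fun t => f t - g t).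
Proof. by move=> bf bg; apply: bmeasD => //; exact: bmeasN. Qed.

Lemma bmeas_sum (J : Type) (r : seq J) (f : J -> TR -> R) :
  (forall j, bmeas (f j)) -> bmeas (fun t => \sum_(j <- r) f j t).
Proof.
move=> bf; elim: r => [|j r IH].
  by under eq_fun do rewrite big_nil; exact: bmeas_cst.
by under eq_fun do rewrite big_cons; exact: bmeasD.
Qed.

Lemma bmeas_continuous (f : R -> R) : continuous f -> bmeas f.
Proof.
move=> cf; split.
  apply: measurable_funS (measurableT) _ _ => //.
  exact: continuous_measurable_fun.
have : compact (f @` I2).
  apply: continuous_compact; last exact: segment_compact.
  exact: continuous_subspaceT.
move=> /compact_bounded[M [_ Mf]]; exists (M + 1) => t It.
by apply: (Mf (M + 1)); [rewrite ltrDl|exists t].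
Qed.

Lemma rmean_cst c : rmean (fun=> c) = c.
Proof.
rewrite rmeanE; last exact: bmeas_cst.
rewrite Rintegral_cst//.
have := mu_I2; rewrite /= => ->/=.
by rewrite mulrCA mulVf ?mulr1// gt_eqF// pi2_gt0.
Qed.

Lemma rmeanD f g : bmeas f -> bmeas g ->
  rmean (fun t => f t + g t) = rmean f + rmean g.
Proof.
move=> bf bg; rewrite !rmeanE//; last exact: bmeasD.
by rewrite (RintegralD measurable_I2 (bmeas_integrable bf) (bmeas_integrable bg)) mulrDr.
Qed.

Lemma rmeanZ c f : bmeas f -> rmean (fun t => c * f t) = c * rmean f.
Proof.
move=> bf; rewrite !rmeanE//; last exact: bmeasZ.
by rewrite (RintegralZl _ measurable_I2 (bmeas_integrable bf)) mulrCA.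
Qed.

Lemma rmeanN f : bmeas f -> rmean (fun t => - f t) = - rmean f.
Proof.
by move=> bf; under eq_fun do rewrite -mulN1r; rewrite rmeanZ// mulN1r.
Qed.

Lemma rmeanB f g : bmeas f -> bmeas g ->
  rmean (fun t => f t - g t) = rmean f - rmean g.
Proof. by move=> bf bg; rewrite rmeanD ?rmeanN//; exact: bmeasN. Qed.

Lemma rmean_sum (J : Type) (r : seq J) (f : J -> TR -> R) :
  (forall j, bmeas (f j)) ->
  rmean (fun t => \sum_(j <- r) f j t) = \sum_(j <- r) rmean (f j).
Proof.
move=> bf; elim: r => [|j r IH].
  by under eq_fun do rewrite big_nil; rewrite rmean_cst big_nil.
under eq_fun do rewrite big_cons.
by rewrite rmeanD ?IH ?big_cons//; exact: bmeas_sum.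
Qed.

Lemma rmean_le f g : bmeas f -> bmeas g -> (forall t, I2 t -> f t <= g t) ->
  rmean f <= rmean g.
Proof.
move=> bf bg fg; rewrite !rmeanE// ler_pM2l ?invr_gt0 ?pi2_gt0//.
by apply: le_Rintegral => //; exact: bmeas_integrable.
Qed.

Lemma eq_cmean f g : (forall t, I2 t -> f t = g t) -> cmean f = cmean g.
Proof.
by move=> fg; congr (_ * _)%E; apply: eq_integral => t /set_mem; exact: fg.
Qed.

(** Positive and negative parts are compared separately, so the means may be infinite. *)
Lemma cmean_le f g : measurable_fun I2 f -> measurable_fun I2 g ->
  (forall t, I2 t -> (f t <= g t)%E) -> (cmean f <= cmean g)%E.
Proof.
move=> mf mg fg; apply: lee_wpmul2l; first by rewrite lee_fin invr_ge0 ltW// pi2_gt0.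
rewrite integralE [leRHS]integralE; apply: leeB.
  apply: ge0_le_integral => //; [exact: measurable_funepos|exact: measurable_funepos|].
  by move=> t It; rewrite !funeposE ge_max !le_max (fg t It) lexx orbT.
apply: ge0_le_integral => //; [exact: measurable_funeneg|exact: measurable_funeneg|].
by move=> t It; rewrite !funenegE ge_max !le_max leeN2 (fg t It) lexx orbT.
Qed.

Lemma cmean_cst (c : \bar R) : cmean (fun=> c) = c.
Proof.
rewrite /cmean (integral_cst mu measurable_I2).
have := mu_I2; rewrite /= => ->.
rewrite muleCA -EFinM mulVf ?gt_eqF ?pi2_gt0//.
by rewrite mule1.
Qed.

Lemma integral_le0 (f : TR -> \bar R) : (forall t, I2 t -> (f t <= 0)%E) ->
  (\int[mu]_(t in I2) f t = - \int[mu]_(t in I2) (- f t))%E.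
Proof.
move=> f0; rewrite -integral_ge0N; last by move=> t /f0; rewrite oppe_ge0.
by apply: eq_integral => t _; rewrite oppeK.
Qed.

Lemma integral_npos (f : TR -> \bar R) : (forall t, I2 t -> (f t <= 0)%E) ->
  (\int[mu]_(t in I2) f t <= 0)%E.
Proof.
move=> f0; rewrite integral_le0// oppe_le0; apply: integral_ge0 => t /f0.
by rewrite oppe_ge0.
Qed.

(** The common sign excludes oo - oo, both pointwise and between the integrals; this is why sums of
    plurisubharmonic functions are always taken among nonpositive ones. *)
Lemma cmeanD f g : measurable_fun I2 f -> measurable_fun I2 g ->
  (forall t, I2 t -> (f t <= 0)%E) -> (forall t, I2 t -> (g t <= 0)%E) ->
  cmean (fun t => f t + g t)%E = (cmean f + cmean g)%E.
Proof.
move=> mf mg f0 g0.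
rewrite /cmean -le0_muleDr ?integral_npos//; congr (_ * _)%E.
rewrite integral_le0; last by move=> t It; rewrite adde_le0 ?f0 ?g0.
rewrite (eq_integral (fun t => - f t + - g t)%E); last first.
  move=> t /set_mem It; rewrite oppeD// ltpinfty_adde_def// inE.
    by rewrite (le_lt_trans (f0 t It))// ltry.
  by rewrite (le_lt_trans (g0 t It))// ltry.
rewrite ge0_integralD//.
- rewrite oppeD; first by rewrite -!integral_le0.
  rewrite ge0_adde_def// inE.
    by apply: integral_ge0 => t /f0; rewrite oppe_ge0.
  by apply: integral_ge0 => t /g0; rewrite oppe_ge0.
- by move=> t /f0; rewrite oppe_ge0.
- exact: measurableT_comp.
- by move=> t /g0; rewrite oppe_ge0.
- exact: measurableT_comp.
Qed.

Lemma cmeanZ (c : R) f : 0 <= c -> measurable_fun I2 f ->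
  (forall t, I2 t -> (f t <= 0)%E) ->
  cmean (fun t => c%:E * f t)%E = (c%:E * cmean f)%E.
Proof.
move=> c0 mf f0; rewrite /cmean muleCA; congr (_ * _)%E.
rewrite integral_le0; last by move=> t It; rewrite mule_ge0_le0 ?lee_fin ?f0.
rewrite (eq_integral (fun t => c%:E * (- f t))%E); last by move=> t _; rewrite muleN.
rewrite ge0_integralZl//.
- by rewrite -muleN -integral_le0.
- exact: measurableT_comp.
- by move=> t /f0; rewrite oppe_ge0.
Qed.

(** Monotone convergence for [- f_ j]. The hypothesis on real levels says that the decreasing limit
    lies below [f], which is the direction in which sup-convolutions are controlled. *)
Lemma cmean_lim (f_ : nat -> TR -> \bar R) f (c : \bar R) :
  measurable_fun I2 f -> (forall t, I2 t -> (f t <= 0)%E) ->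
  (forall j, measurable_fun I2 (f_ j)) ->
  (forall j t, I2 t -> (f_ j t <= 0)%E) ->
  (forall j k t, I2 t -> (j <= k)%N -> (f_ k t <= f_ j t)%E) ->
  (forall t (r : R), I2 t -> (f t < r%:E)%E -> exists j, (f_ j t <= r%:E)%E) ->
  (forall j, c <= cmean (f_ j))%E -> (c <= cmean f)%E.
Proof.
move=> mf' f0' mf f0 fd ff cf.
pose g j t := (- f_ j t)%E.
have mg j : measurable_fun I2 (g j) by exact: measurableT_comp.
have g0 j t : I2 t -> (0 <= g j t)%E by move=> /(f0 j); rewrite oppe_ge0.
have gd t : I2 t -> {homo g^~ t : n m / (n <= m)%N >-> (n <= m)%E}.
  by move=> It j k jk; rewrite leeN2 fd.
have cg := cvg_monotone_convergence measurable_I2 mg g0 gd.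
have lg t : I2 t -> limn (g^~ t) = ereal_sup (range (g^~ t)).
  by move=> It; apply/cvg_lim => //; apply: ereal_nondecreasing_cvgn; exact: gd.
have gl t : I2 t -> (- f t <= limn (g^~ t))%E.
  move=> It; rewrite leeNl; apply: lee_realP => r /(ff _ _ It)[j fjr].
  rewrite leeNl lg//; apply: le_trans (ereal_sup_ubound _); last by exists j.
  by rewrite leeN2.
have Gc j : (((2 * pi)^-1)%:E * \int[mu]_(t in I2) g j t <= - c)%E.
  rewrite leeNr; apply: le_trans (cf j) _.
  by rewrite /cmean integral_le0 ?muleN//; move=> t; exact: f0.
have p0 : 0 < (2 * pi)^-1 :> R by rewrite invr_gt0 pi2_gt0.
have intl : (((2 * pi)^-1)%:E * \int[mu]_(t in I2) limn (g^~ t) <= - c)%E.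
  have cvg' : (((2 * pi)^-1)%:E * \int[mu]_(t in I2) g j t)%E @[j --> \oo] -->
      (((2 * pi)^-1)%:E * \int[mu]_(t in I2) limn (g^~ t))%E.
    by apply: cvgeZl => //.
  rewrite -(cvg_lim _ cvg')//; apply: lime_le; first by apply/cvg_ex; eexists; exact: cvg'.
  exact: nearW.
rewrite leeNr in intl; apply: le_trans intl _.
rewrite /cmean (integral_le0 f0') muleN leeN2.
apply: lee_wpmul2l; first by rewrite lee_fin ltW.
apply: ge0_le_integral => //.
- by move=> t /f0'; rewrite oppe_ge0.
- exact: measurableT_comp.
- apply: (emeasurable_fun_cvg g) => // t It; rewrite lg//.
  by apply: ereal_nondecreasing_cvgn; exact: gd.
Qed.

Lemma measurable_usc (f : TR -> \bar R) :
  (forall (t : R) (r : R), (f t < r%:E)%E -> \forall s \near t, (f s < r%:E)%E) ->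
  measurable_fun I2 f.
Proof.
move=> uf; apply: measurable_funS (measurableT) (@subsetT _ _) _.
have -> : f = (fun t => - (- f t))%E by apply/funext => t; rewrite oppeK.
apply: measurableT_comp => //.
apply: lower_semicontinuous_measurable; apply/lower_semicontinuousP => r.
rewrite openE => t /=; rewrite lteNr -EFinN => /uf; apply: filterS => s.
by rewrite /= EFinN lteNr.
Qed.

End CircleMeans.

Lemma cvg_continuous_withinl {R : realType} (F : R -> R) x : continuous F ->
  F y @[y --> x^'+] --> F x /\ F y @[y --> x^'-] --> F x.
Proof. by move=> cF; split; [exact: cvg_at_right_filter (cF x)|exact: cvg_at_left_filter (cF x)]. Qed.

(** * Circle means of real parts of polynomials *)

Section TrigMeans.
Context {R : realType}.
Local Notation C := R[i].

Lemma integral_periodic_primitive (f F : R -> R) : continuous f ->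
  (forall x : R, is_derive x (1 : R) F (f x)) -> F (2 * pi) = F 0 -> rmean f = 0.
Proof.
move=> cf dF F0.
have cF : continuous F.
  by move=> x; apply/differentiable_continuous/derivable1_diffP; have [] := dF x.
rewrite /rmean /cmean (@continuous_FTC2 _ f F 0 (2 * pi)).
- by rewrite F0 subee// mule0.
- exact: pi2_gt0.
- exact: continuous_subspaceT.
- split; first by move=> x _; have [] := dF x.
    exact: (cvg_continuous_withinl 0 cF).1.
  exact: (cvg_continuous_withinl (2 * pi) cF).2.
- by move=> x _; rewrite derive1E; have [] := dF x.
Qed.

Lemma continuous_cosM (k : R) : continuous (fun t => cos (k * t) : R).
Proof.
move=> x; apply: (@continuous_comp _ _ _ (fun t => k * t)) => //; last exact: continuous_cos.
exact: mulrl_continuous.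
Qed.

Lemma continuous_sinM (k : R) : continuous (fun t => sin (k * t) : R).
Proof.
move=> x; apply: (@continuous_comp _ _ _ (fun t => k * t)) => //; last exact: continuous_sin.
exact: mulrl_continuous.
Qed.

Lemma cis_nat2pi k : cis (k%:R * (2 * pi)) = 1 :> C.
Proof. by rewrite -cisX cis2pi expr1n. Qed.

Lemma rmean_cosM k : rmean (fun t => cos (k.+1%:R * t)) = 0 :> R.
Proof.
apply: (@integral_periodic_primitive _ (fun t => k.+1%:R^-1 * sin (k.+1%:R * t))).
- exact: continuous_cosM.
- move=> x; apply: is_derive_eq; rewrite /GRing.scale/= mulr1.
  have k0 : k.+1%:R != 0 :> R by [].
  by field.
- have /(congr1 (@complex.Im _))/= -> := cis_nat2pi k.+1.
  by rewrite !mulr0 sin0 mulr0.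
Qed.

Lemma rmean_sinM k : rmean (fun t => sin (k.+1%:R * t)) = 0 :> R.
Proof.
apply: (@integral_periodic_primitive _ (fun t => - (k.+1%:R^-1 * cos (k.+1%:R * t)))).
- exact: continuous_sinM.
- move=> x; apply: is_derive_eq; rewrite /GRing.scale/= mulr1.
  have k0 : k.+1%:R != 0 :> R by [].
  by field.
- have /(congr1 (@complex.Re _))/= -> := cis_nat2pi k.+1.
  by rewrite !mulr0 cos0.
Qed.

Lemma Re_monomial_cis (c : C) k t : complex.Re (c * cis t ^+ k) =
  complex.Re c * cos (k%:R * t) - complex.Im c * sin (k%:R * t).
Proof. by rewrite cisX; case: c => a b. Qed.

Lemma bmeas_Re_monomial (c : C) k : bmeas (fun t => complex.Re (c * cis t ^+ k)).
Proof.
under eq_fun do rewrite Re_monomial_cis.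
by apply: bmeasB; apply: bmeasZ; apply: bmeas_continuous;
  [exact: continuous_cosM|exact: continuous_sinM].
Qed.

Lemma rmean_Re_monomial (c : C) k :
  rmean (fun t => complex.Re (c * cis t ^+ k)) = if k == 0 then complex.Re c else 0.
Proof.
case: k => [|k] /=; first by under eq_fun do rewrite expr0 mulr1; rewrite rmean_cst.
under eq_fun do rewrite Re_monomial_cis.
have bc := bmeas_continuous (@continuous_cosM k.+1%:R).
have bs := bmeas_continuous (@continuous_sinM k.+1%:R).
rewrite rmeanB; [|exact: bmeasZ|exact: bmeasZ].
by rewrite !rmeanZ// rmean_cosM rmean_sinM !mulr0 subr0.
Qed.

Lemma Re_sum (J : Type) (r : seq J) (f : J -> C) :
  complex.Re (\sum_(j <- r) f j) = \sum_(j <- r) complex.Re (f j).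
Proof. by apply: (big_morph (@complex.Re R)) => // - [a b] [c d]. Qed.

Lemma Re_horner_cis (q : {poly C}) (s : C) t : complex.Re q.[cis t * s] =
  \sum_(k < size q) complex.Re ((q`_k * s ^+ k) * cis t ^+ k).
Proof.
rewrite horner_coef Re_sum; apply: eq_bigr => k _.
by rewrite exprMn mulrA mulrAC.
Qed.

Lemma bmeas_Re_poly (q : {poly C}) (s : C) : bmeas (fun t => complex.Re q.[cis t * s]).
Proof.
under eq_fun do rewrite Re_horner_cis.
apply: bmeas_sum => k; exact: bmeas_Re_monomial.
Qed.

(** The mean value property: on the circle only the constant monomial has a nonzero mean. *)
Lemma rmean_Re_poly (q : {poly C}) (s : C) :
  rmean (fun t => complex.Re q.[cis t * s]) = complex.Re q.[0].
Proof.
under eq_fun do rewrite Re_horner_cis.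
rewrite rmean_sum; last by move=> k; exact: bmeas_Re_monomial.
under eq_bigr do rewrite rmean_Re_monomial.
rewrite horner_coef0; have [n0|] := posnP (size q).
  by rewrite n0 big_ord0; move/eqP: n0; rewrite size_poly_eq0 => /eqP ->; rewrite coef0.
case E: (size q) => [//|m] _.
by rewrite big_ord_recl/= mulr1 big1 ?addr0.
Qed.

Lemma continuous_cis_nbhs (t : R) (e : R) : 0 < e ->
  \forall s \near t, cabs (cis s - cis t) < e.
Proof.
move=> e0; have e2 : 0 < e / 2 by rewrite divr_gt0.
have /cvgrPdist_lt/(_ _ e2) c := @continuous_cos R t.
have /cvgrPdist_lt/(_ _ e2) s := @continuous_sin R t.
near=> x; apply: le_lt_trans (cabs_le_ReIm _) _ => /=.
rewrite (splitr e) ltrD// distrC; [near: x; exact: c|near: x; exact: s].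
Unshelve. all: by end_near. Qed.

End TrigMeans.

(** Compactness is used twice with the level as a parameter: levels tending to +oo bound [f], and
    levels tending to the supremum from below yield a smaller upper bound if the supremum is not
    attained. *)
Lemma usc_max {R : realType} (T : topologicalType) (K : set T) (f : T -> R) :
  compact K -> K !=set0 ->
  (forall x c, K x -> f x < c -> \forall y \near x, K y -> f y < c) ->
  exists2 x, K x & forall y, K y -> f y <= f x.
Proof.
move=> /compact_near_coveringP cK [x0 Kx0] uf.
have [M fM] : exists M, forall y, K y -> f y <= M.
  have := cK R (@pinfty_nbhs R) (fun c y => K y -> f y < c) _ _.
  case=> [x Kx|M [Mr KM]].
    have fx : f x < f x + 1 by rewrite ltrDl.
    near=> y c.
    have cx : f x + 1 < c by near: c; apply: nbhs_pinfty_gt; exact: num_real.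
    have yx : K y -> f y < f x + 1 by near: y; exact: uf.
    by move=> /yx /lt_trans; apply.
  by exists (M + 1) => y Ky; apply/ltW/(KM (M + 1) _ y Ky Ky); rewrite ltrDl.
pose S := f @` K.
have hS : has_sup S by split; [exists (f x0), x0|exists M => _ [y Ky <-]; exact: fM].
apply: contrapT => nex.
have lts x : K x -> f x < sup S.
  move=> Kx; rewrite lt_neqAle (ub_le_sup hS.2) ?andbT; last by exists x.
  apply/eqP => fx; apply: nex; exists x => // y Ky; rewrite fx.
  by apply: ub_le_sup hS.2 _ _; exists y.
have := cK R (sup S)^'- (fun c y => K y -> f y < c) _ _.
case=> [x Kx|r /= r0 Kr].
  have /midf_lt[h1 h2] := lts _ Kx.
  near=> y c.
  have cx : (f x + sup S) / 2 < c by near: c; exact: nbhs_left_gt.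
  have yx : K y -> f y < (f x + sup S) / 2 by near: y; exact: uf.
  by move=> /yx /lt_trans; apply.
have cs : sup S - r / 2 < sup S by rewrite ltrBlDr ltrDl divr_gt0.
have [_ [y Ky <-] /ltW] := sup_adherent (divr_gt0 r0 (ltr0Sn _ 1)) hS.
apply/negP; rewrite -ltNge; apply: (Kr (sup S - r / 2)) => //=.
by rewrite opprB addrC subrK gtr0_norm ?divr_gt0// ltr_pdivrMr// ltr_pMr// ltr1n.
Unshelve. all: by end_near. Qed.

(** * From the infinitesimal submean inequality to the unit circle *)

Section DiscSubmean.
Context {R : realType}.
Local Notation C := R[i].
Local Notation mu := (@lebesgue_measure R).

Lemma cis_surj (t : C) : cabs t = 1 -> exists2 a : R, 0 <= a & t = cis a.
Proof.
case: t => x y /(congr1 (fun u => u ^+ 2)); rewrite cabs_sqr/= expr1n => xy.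
have x1 : -1 <= x <= 1.
  by rewrite -ler_norml -(expr_le1 (n := 2))// -normrX ger0_norm ?sqr_ge0// -xy lerDl sqr_ge0.
have sx : Num.sqrt (1 - x ^+ 2) = `|y| by rewrite -xy addrAC subrr add0r sqrtr_sqr.
have [y0|y0] := leP 0 y.
  exists (acos x); first exact: acos_ge0.
  by rewrite /cis acosK ?in_itv// sin_acos// sx ger0_norm.
exists (2 * pi - acos x).
  by rewrite subr_ge0 (le_trans (acos_lepi x1))// ler_peMl ?ler1n// pi_ge0.
rewrite cisD cis2pi mul1r /cis cosN sinN acosK ?in_itv// sin_acos// sx.
by rewrite ltr0_norm// opprK.
Qed.

Lemma unif_continuous_itv (g : R -> R) (a b e : R) : continuous g -> 0 < e ->
  exists2 d : R, 0 < d & forall x y, x \in `[a, b] -> `|x - y| < d -> `|g x - g y| < e.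
Proof.
move=> cg e0; have e2 : 0 < e / 2 by rewrite divr_gt0.
have /compact_near_coveringP cK := @segment_compact _ a b.
have := cK R (0^'+) (fun d x => forall y, `|x - y| < d -> `|g x - g y| < e) _ _.
case=> [x _|d /= d0 dK].
  have /cvgrPdist_lt/(_ _ e2)/nbhs_normP[r /= r0 rx] := cg x.
  have r2 : 0 < r / 2 by rewrite divr_gt0.
  near=> z d => y zy.
  have xz : `|x - z| < r / 2 by near: z; apply/nbhs_normP; exists (r / 2).
  have dr : d < r / 2 by near: d; exact: nbhs_right_lt.
  rewrite -(subrK (g x) (g z)) -addrA (le_lt_trans (ler_normD _ _))// (splitr e) ltrD//.
    rewrite distrC; apply: rx; rewrite /ball_/= (lt_trans xz)//.
    by rewrite ltr_pdivrMr// ltr_pMr// ltr1n.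
  apply: rx; rewrite /ball_/= -(subrK z x) -addrA (le_lt_trans (ler_normD _ _))//.
  by rewrite (splitr r) ltrD// (lt_trans zy).
exists (d / 2); first by rewrite divr_gt0.
move=> x y xab; apply: (dK (d / 2)) => //=; last by rewrite divr_gt0.
rewrite sub0r normrN gtr0_norm ?divr_gt0//.
by rewrite ltr_pdivrMr// ltr_pMr// ltr1n.
Unshelve. all: by end_near. Qed.

(** The bound is uniform in the offset [a] of the grid, because the maximum point on the circle in
    [disc_submean] has an argument that cannot be prescribed. *)
Lemma riemann_sum_le (g : R -> R) (e : R) : continuous g -> 0 < e ->
  exists m0 : nat, forall m a, (m0 <= m)%N -> 0 <= a < 2 * pi / m.+1%:R ->
    \sum_(j < m.+1) g (a + j%:R * (2 * pi / m.+1%:R)) <= m.+1%:R * (rmean g + e).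
Proof.
move=> cg e0; have [d d0 gd] := unif_continuous_itv 0 (2 * pi) cg e0.
have p0 := @pi2_gt0 R.
exists (Num.trunc (2 * pi / d)) => m a dm.
set h := 2 * pi / m.+1%:R => /andP[a0 ah].
have h0 : 0 < h by rewrite divr_gt0.
have hd : h < d.
  rewrite ltr_pdivrMr// (mulrC d) -ltr_pdivrMr//.
  have /andP[_] := truncn_itv (ltW (divr_gt0 p0 d0)); move=> /lt_le_trans; apply.
  by rewrite ler_nat.
have mh : m.+1%:R * h = 2 * pi by rewrite /h; field.
have ig (x y : R) : mu.-integrable (`[x, y]%classic : set (measurableTypeR R)) (EFin \o g).
  apply: continuous_compact_integrable; first exact: segment_compact.
  exact: continuous_subspaceT.
have igo (f : R -> R) (x y : R) : continuous f ->
    mu.-integrable (`]x, y]%classic : set (measurableTypeR R)) (EFin \o f).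
  move=> cf; apply: (@integrableS _ _ _ _ (`[x, y]%classic : set (measurableTypeR R))).
  - exact: measurable_itv.
  - exact: measurable_itv.
  - exact: subset_itv_oc_cc.
  - apply: continuous_compact_integrable; first exact: segment_compact.
    exact: continuous_subspaceT.
(* Cell by cell: the sample point [a + k h] lies in the same closed cell of length [h < d] as the
   integration variable, so the integrand is at least the sample minus [e]. *)
have key k : (k <= m.+1)%N ->
    h * (\sum_(j < k) g (a + j%:R * h)) <=
    \int[mu]_(t in `[0, k%:R * h]) g t + k%:R * h * e.
  elim: k => [_|k IH km].
    by rewrite big_ord0 mulr0 mul0r set_itv1 Rintegral_set1 mul0r addr0.
  rewrite big_ord_recr/= mulrDr.
  have kh0 : 0 <= k%:R * h by rewrite mulr_ge0// ltW.
  have k1 : k.+1%:R * h = k%:R * h + h by rewrite -natr1 mulrDl mul1r.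
  have := @Rintegral_itvB _ g (BLeft 0) (BRight (k.+1%:R * h)) (k%:R * h) (ig _ _).
  rewrite !bnd_simp k1 lerDl (ltW h0) => /(_ kh0 isT).
  have : h * (g (a + k%:R * h) - e) <= \int[mu]_(t in `]k%:R * h, k%:R * h + h]) g t.
    have -> : h * (g (a + k%:R * h) - e) =
        \int[mu]_(t in `]k%:R * h, k%:R * h + h]) (fun=> g (a + k%:R * h) - e) t.
      rewrite Rintegral_cst//.
      have := @lebesgue_measure_itv R `]k%:R * h, k%:R * h + h]; rewrite /= => ->.
      by rewrite lte_fin ltrDl h0 -EFinB/= mulrC; congr (_ * _); rewrite addrAC subrr add0r.
    apply: le_Rintegral => //.
    - by apply: igo; exact: cst_continuous.
    - exact: igo.
    - move=> t /=; rewrite in_itv/= => /andP[kt tk].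
      have kt0 : k%:R * h + h <= 2 * pi by rewrite -k1 -mh ler_pM2r// ler_nat.
      have gg : `|g (a + k%:R * h) - g t| < e.
        apply: gd; first by rewrite in_itv/=; apply/andP; split; lra.
        by rewrite (le_lt_trans _ hd)// ler_norml; apply/andP; split; lra.
      by move: gg; rewrite ltr_norml => /andP[_ gg]; lra.
  have := IH (ltnW km); nra.
have := key _ (leqnn _); rewrite mh rmeanE; last exact: bmeas_continuous.
set I := (\int[mu]_(t in _) g t)%R; set S := \sum_(j < _) _.
move=> H; rewrite -(ler_pM2l h0); apply: le_trans H _.
have pn0 : pi != 0 :> R by rewrite gt_eqF// pi_gt0.
rewrite [leRHS]mulrA (mulrC h) mh (_ : 2 * pi * (_ + _) = I + 2 * pi * e)//.
have F (p x : R) : p != 0 -> 2 * p * ((2 * p)^-1 * x + e) = x + 2 * p * e by move=> pp0; field.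
exact: F.
Qed.

Lemma cabs_dist (t s : C) : `|cabs t - cabs s| <= cabs (t - s).
Proof.
have := cabsD (s - t) t; have := cabsD (t - s) s.
rewrite !subrK (cabs_distC s) ler_norml => h1 h2; apply/andP; split; lra.
Qed.

Lemma continuous_cabs : continuous (cabs : C -> R).
Proof.
move=> t B /(nbhs_ballP (cabs t))[r r0 rB]; apply/nbhs_cabsP; exists r => // s st.
by apply: rB; rewrite /ball/= (le_lt_trans (cabs_dist _ _))// cabs_distC.
Qed.

Lemma continuous_cabs2 : continuous (fun t : C => cabs t ^+ 2).
Proof.
move=> x0; have FF : Filter (nbhs x0) := nbhs_filter x0.
by apply: (@cvgM _ _ _ _ cabs cabs); exact: continuous_cabs.
Qed.

Lemma continuous_ord_sum (T : topologicalType) m (f : nat -> T -> R) :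
  (forall j, continuous (f j)) -> continuous (fun t => \sum_(j < m) f j t).
Proof.
move=> cf; elim: m => [|m IH].
  by under eq_fun do rewrite big_ord0; exact: cst_continuous.
under eq_fun do rewrite big_ord_recr/=.
by move=> x; apply: cvgD; [exact: IH|exact: cf].
Qed.

Lemma continuous_circle (t s : C) : continuous (fun x : R => t + cis x * s).
Proof.
move=> x B /nbhs_cabsP[q q0 qB].
have s1 : 0 < cabs s + 1 by rewrite ltr_wpDl ?cabs_ge0.
suff : \forall y \near x, B (t + cis y * s) by [].
near=> y; apply: qB; rewrite opprD addrACA subrr add0r -mulrBl cabsM.
apply: (@le_lt_trans _ _ (cabs (cis y - cis x) * (cabs s + 1))).
  by rewrite ler_wpM2l ?cabs_ge0// lerDl.
rewrite -ltr_pdivlMr//; near: y; apply: continuous_cis_nbhs.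
exact: divr_gt0.
Unshelve. all: by end_near. Qed.

Lemma bmeas_cabs_sqr (t s : C) : bmeas (fun x => cabs (t + cis x * s) ^+ 2).
Proof.
apply: bmeas_continuous => x.
apply: (@continuous_comp _ _ _ (fun x => t + cis x * s) (fun t => cabs t ^+ 2)).
  exact: continuous_circle.
exact: continuous_cabs2.
Qed.

Lemma rmean_cabs_sqr (t s : C) :
  rmean (fun x => cabs (t + cis x * s) ^+ 2) = cabs t ^+ 2 + cabs s ^+ 2.
Proof.
have E x : cabs (t + cis x * s) ^+ 2 =
    (cabs t ^+ 2 + cabs s ^+ 2) + complex.Re ((2 * t^*)%C%:P * 'X).[cis x * s].
  rewrite hornerM hornerC hornerX !cabs_sqr; case: t s => a b [u v] /=.
  have := cos2Dsin2 x; set c := cos x; set d := sin x => cd.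
  have -> : u ^+ 2 + v ^+ 2 = (u ^+ 2 + v ^+ 2) * (c ^+ 2 + d ^+ 2) by rewrite cd mulr1.
  ring.
under eq_fun do rewrite E.
rewrite rmeanD ?rmean_cst ?rmean_Re_poly ?hornerM ?hornerX ?mulr0 ?addr0//.
  exact: bmeas_cst.
exact: bmeas_Re_poly.
Qed.

(* The sum of [V] over the rotations of order [m], with the quadratic errors
   absorbed by a multiple of the squared modulus, has its maximum on the circle,
   where it is [m] times a Riemann sum: no Dirichlet problem has to be solved. *)
Lemma disc_submean (V : C -> R) : continuous V ->
  (forall t, cabs t < 1 -> forall e : R, 0 < e -> exists2 r : R, 0 < r &
     forall s, cabs s < r -> V t <= rmean (fun x => V (t + cis x * s)) + e * cabs s ^+ 2) ->
  V 0 <= rmean (fun x => V (cis x)).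
Proof.
move=> cV hV.
pose g x := V (cis x).
have cg : continuous g.
  move=> x; apply/cvgrPdist_lt => e e0.
  have /cvgrPdist_lt/(_ _ e0)/nbhs_cabsP[r r0 rV] := cV (cis x).
  by near=> y; apply: rV; near: y; exact: continuous_cis_nbhs.
apply/ler_addgt0Pr => e e0; have e2 : 0 < e / 2 by rewrite divr_gt0.
have [m0 hm] := riemann_sum_le cg e2.
pose h : R := 2 * pi / m0.+1%:R.
have h0 : 0 < h by rewrite divr_gt0// pi2_gt0.
have mh : m0.+1%:R * h = 2 * pi by rewrite /h; field.
pose z (j : nat) : C := cis (j%:R * h).
have cabsz j : cabs (z j) = 1 by exact: cabs_cis.
pose m : R := m0.+1%:R.
pose U t := \sum_(j < m0.+1) V (z j * t) + m * (e / 2) * cabs t ^+ 2.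
have cVz j : continuous (fun t => V (z j * t)).
  move=> t; apply: (@continuous_comp _ _ _ (fun t => z j * t)); last exact: cV.
  move=> B /nbhs_cabsP[r r0 rB]; apply/nbhs_cabsP; exists r => // s st /=.
  by apply: rB; rewrite -mulrBr cabsM cabsz mul1r.
have cU : continuous U.
  move=> x0; have FF : Filter (nbhs x0) := nbhs_filter x0.
  have h1 : (fun t => \sum_(j < m0.+1) V (z j * t)) t @[t --> x0] -->
      \sum_(j < m0.+1) V (z j * x0).
    exact: (continuous_ord_sum cVz).
  have h2 : (m * (e / 2) * cabs t ^+ 2) @[t --> x0] --> m * (e / 2) * cabs x0 ^+ 2.
    apply: (@cvgM _ _ _ _ (fun=> m * (e / 2)) (fun t => cabs t ^+ 2)).
      exact: cvg_cst.
    exact: continuous_cabs2.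
  exact: (cvgD h1 h2).
have [t t1 tmax] : exists2 t, cabs t <= 1 & forall s, cabs s <= 1 -> U s <= U t.
  apply: (@usc_max _ _ [set t | cabs t <= 1] U).
  - apply: (@closed_bounded_compactC _ _ 1) => //.
    rewrite (_ : [set t | _] = cabs @^-1` [set x | x <= 1])//.
    apply: closed_comp => [t _|]; [exact: continuous_cabs|exact: closed_le].
  - by exists 0; rewrite /= cabs0.
  - move=> x c _ xc.
    have /cvgrPdist_lt := cU x.
    move=> /(_ (c - U x)); rewrite subr_gt0 => /(_ xc); apply: filterS => y.
    by rewrite ltr_norml => /andP[]; lra.
(* At an interior maximum, the mean of the quadratic term over a circle of radius [rho] exceeds its
   value at [t] by m (e/2) rho^2, whereas the m errors allowed by [hV] add up to m (e/4) rho^2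
   only. *)
have tt : cabs t = 1.
  apply/eqP; rewrite eq_le t1 leNgt; apply/negP => tlt.
  have e4 : 0 < e / 4 by rewrite divr_gt0.
  have zt j : cabs (z j * t) < 1 by rewrite cabsM cabsz mul1r.
  have [r r0 hr] : exists2 r : R, 0 < r & forall s, cabs s < r -> forall j : 'I_m0.+1,
      V (z j * t) <= rmean (fun x => V (z j * t + cis x * (z j * s))) + e / 4 * cabs s ^+ 2.
    have H (j : 'I_m0.+1) := hV _ (zt j) _ e4.
    pose rr (j : 'I_m0.+1) := sval (cid2 (H j)).
    exists (\big[Order.min/1]_j rr j).
      by apply/bigmin_gtP; split => // j _; rewrite /rr; case: (cid2 (H j)).
    move=> s sr j.
    have sj : cabs s < rr j by apply: (lt_le_trans sr); exact: bigmin_le.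
    move: sj; rewrite /rr; case: (cid2 (H j)) => /= r _ hr sj.
    by rewrite -[cabs s]mul1r -{2}(cabsz j) -cabsM; apply: hr; rewrite cabsM cabsz mul1r.
  pose rho := Num.min r (1 - cabs t) / 2.
  have rho0 : 0 < rho by rewrite divr_gt0// lt_min r0 subr_gt0.
  have rhor : rho < r /\ rho <= 1 - cabs t.
    have : 0 < Num.min r (1 - cabs t) by rewrite lt_min r0 subr_gt0.
    have : Num.min r (1 - cabs t) <= r by rewrite ge_min lexx.
    have : Num.min r (1 - cabs t) <= 1 - cabs t by rewrite ge_min lexx orbT.
    by rewrite /rho; lra.
  pose s : C := (rho%:C)%C.
  have sa : cabs s = rho by rewrite cabsR gtr0_norm.
  have cs x : cabs (t + cis x * s) <= 1.
    rewrite (le_trans (cabsD _ _))// cabsM cabs_cis mul1r sa.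
    by have := rhor.2; lra.
  have bV j : bmeas (fun x => V (z j * (t + cis x * s))).
    apply: bmeas_continuous => x; apply: (@continuous_comp _ _ _ (fun x => t + cis x * s) (fun t => V (z j * t))); last exact: cVz.
    exact: continuous_circle.
  have ba := bmeas_cabs_sqr t s.
  have mean2 : rmean (fun x => cabs (t + cis x * s) ^+ 2) = cabs t ^+ 2 + rho ^+ 2.
    by rewrite rmean_cabs_sqr sa.
  have sumle : \sum_(j < m0.+1) V (z j * t) <=
      rmean (fun x => \sum_(j < m0.+1) V (z j * (t + cis x * s))) + m * (e / 4) * rho ^+ 2.
    rewrite rmean_sum// -mulrA.
    have -> : m * (e / 4 * rho ^+ 2) = \sum_(j < m0.+1) (e / 4 * rho ^+ 2).
      by rewrite sumr_const card_ord -[RHS]mulr_natl.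
    rewrite -big_split/=; apply: ler_sum => j _.
    have := hr s _ j; rewrite sa => /(_ rhor.1) h1; apply: le_trans h1 _.
    rewrite lerD2r le_eqVlt; apply/orP; left; apply/eqP; congr rmean.
    by apply/funext => x; rewrite mulrDr mulrCA.
  have mle : rmean (fun x => \sum_(j < m0.+1) V (z j * (t + cis x * s))) <=
     U t - m * (e / 2) * (cabs t ^+ 2 + rho ^+ 2).
    rewrite -mean2 -rmeanZ// -[X in X - _](rmean_cst (U t)) -rmeanB; last 2 first.
      exact: bmeas_cst.
      exact: bmeasZ.
    apply: rmean_le; first exact: bmeas_sum.
      by apply: bmeasB; [exact: bmeas_cst|exact: bmeasZ].
    by move=> x _; rewrite lerBrDr; exact: (tmax _ (cs x)).
  have m1 : 0 < m by [].
  have : 0 < m * e * rho ^+ 2 by apply: mulr_gt0; [exact: mulr_gt0|exact: exprn_gt0].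
  move: sumle mle; rewrite /U; set A := \sum_(j < _) _; set B := rmean _.
  nra.
have [a a0 ta] := cis_surj tt.
(* [Phi] has period [h], so the argument [a] of the maximum point may be reduced to [0, h), where
   the Riemann sum estimate applies. *)
pose Phi (x : R) := \sum_(j < m0.+1) V (cis (x + j%:R * h)).
have Phih x : Phi (x + h) = Phi x.
  rewrite /Phi big_ord_recr/= [RHS]big_ord_recl/= mul0r addr0 addrC; congr (_ + _).
    congr V; rewrite -[in RHS](mulr1 (cis x)) -cis2pi -cisD -mh -natr1.
    by congr cis; ring.
  apply: eq_bigr => j _; congr (V (cis _)).
  by rewrite /= /bump/= natrD; ring.
have Phik x k : Phi (x + k%:R * h) = Phi x.
  by elim: k => [|k IH]; rewrite ?mul0r ?addr0// -natr1 mulrDl mul1r addrA Phih.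
pose k := Num.trunc (a / h).
have /andP[k1 k2] := truncn_itv (divr_ge0 a0 (ltW h0)).
have ak : 0 <= a - k%:R * h < h.
  rewrite subr_ge0 -ler_pdivlMr// k1/= ltrBlDr.
  have -> : h + k%:R * h = k.+1%:R * h by rewrite -natr1; ring.
  by rewrite -ltr_pdivrMr.
have := hm m0 _ (leqnn _) ak; rewrite -/h -/(Phi _) -(Phik _ k) subrK => H.
have U0 : U 0 <= U t by apply: tmax; rewrite cabs0.
have Ut : U t = Phi a + m * (e / 2).
  rewrite /U tt expr1n mulr1; congr (_ + _); apply: eq_bigr => j _.
  by rewrite ta -cisD addrC.
have UV : U 0 = m * V 0.
  rewrite /U cabs0 expr0n mulr0 addr0.
  under eq_bigr do rewrite mulr0.
  by rewrite sumr_const card_ord mulr_natl.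
have m1 : 0 < m by [].
rewrite -(ler_pM2l m1) -UV (le_trans U0)// Ut.
apply: le_trans (lerD H (lexx _)) _.
rewrite le_eqVlt; apply/orP; left; apply/eqP; rewrite /m /g; field.
Unshelve. all: by end_near. Qed.

End DiscSubmean.

(** * Sup-convolution and holomorphic curves *)

Section SupConvolution.
Context {R : realType} {n : nat}.
Local Notation C := R[i].
Local Notation Cn := 'rV[C]_n.
Implicit Types (z y w : Cn) (g : Cn -> R).

Lemma hdot_complex y w (c : C) : hdot y (c *: w) =
  complex.Re (c * (hdot y w +i* (- hdot y ('i%C *: w)))%C).
Proof.
have -> : c *: w = ((complex.Re c)%:C)%C *: w + ((complex.Im c)%:C)%C *: ('i%C *: w).
  rewrite scalerA -scalerDl; congr (_ *: _); case: c => a b /=.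
  by apply/eqP; rewrite eq_complex/=; apply/andP; split; apply/eqP; ring.
by rewrite hdotDr !hdotZr; case: c => a b /=; ring.
Qed.

Lemma enormB_sqr y w : enorm (y - w) ^+ 2 = enorm y ^+ 2 - 2 * hdot y w + enorm w ^+ 2.
Proof.
by rewrite !enorm_hdot !(hdotDl, hdotDr, hdotNl, hdotNr) (hdotC w y); ring.
Qed.

(** A regularisation from above: it is continuous as soon as [g] is bounded, tightens as [l] grows,
    and commutes with translations, so that submean inequalities can be carried over from the
    maximiser. *)
Definition supconv (l : R) g z : R := sup [set g y - l * enorm (y - z) ^+ 2 | y in setT].

Section Fixed.
Variables (l M : R) (g : Cn -> R).
Hypotheses (l0 : 0 < l) (gM : forall y, - M <= g y) (g0 : forall y, g y <= 0).

Let S := supconv l g.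

Lemma supconv_has_sup z : has_sup [set g y - l * enorm (y - z) ^+ 2 | y in setT].
Proof.
split; first by exists (g 0 - l * enorm (0 - z) ^+ 2); exists 0.
exists 0 => _ [y _ <-]; rewrite lerBlDr add0r (le_trans (g0 y))//.
by rewrite mulr_ge0 ?sqr_ge0// ltW.
Qed.

Lemma supconv_ub z y : g y - l * enorm (y - z) ^+ 2 <= S z.
Proof. by apply: ub_le_sup; [exact: (supconv_has_sup z).2|exists y]. Qed.

Lemma supconv_ge z : g z <= S z.
Proof. by have := supconv_ub z z; rewrite subrr enorm0 expr0n mulr0 subr0. Qed.

Lemma supconv_lub z c : (forall y, g y - l * enorm (y - z) ^+ 2 <= c) -> S z <= c.
Proof.
by move=> h; apply: ge_sup => [|_ [y _ <-]//]; exact: (supconv_has_sup z).1.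
Qed.

Lemma supconv_le0 z : S z <= 0.
Proof.
apply: supconv_lub => y; rewrite lerBlDr add0r (le_trans (g0 y))//.
by rewrite mulr_ge0 ?sqr_ge0// ltW.
Qed.

(** A maximiser up to an error at most 1 lies within sqrt((M + 1) / l) of [z], since a farther one
    loses more than the oscillation [M] of [g]; moving [z] to [w] then changes the penalty by the
    stated amount. *)
Lemma supconv_modulus z w :
  S z - S w <= l * (2 * Num.sqrt ((M + 1) / l) * enorm (z - w) + enorm (z - w) ^+ 2).
Proof.
have M0 : 0 <= M by have := gM 0; have := g0 0; lra.
set B := Num.sqrt _; set d := enorm (z - w).
have B0 : 0 <= B by exact: sqrtr_ge0.
have B2 : l * B ^+ 2 = M + 1.
  by rewrite sqr_sqrtr ?divr_ge0 ?addr_ge0// ?ltW// mulrC divfK// gt_eqF.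
have d0 : 0 <= d by exact: enorm_ge0.
rewrite lerBlDr -lerBlDl; apply/ler_addgt0Pr => e0 e00.
pose e := Num.min e0 1.
have e1 : 0 < e by rewrite lt_min e00 ltr01.
have [_ [y _ <-]] := sup_adherent e1 (supconv_has_sup z); rewrite -[sup _]/(S z) => Sy.
have ee0 : e <= e0 by rewrite ge_min lexx.
have e11 : e <= 1 by rewrite ge_min lexx orbT.
set a := enorm (y - z) in Sy *; have a0 : 0 <= a by exact: enorm_ge0.
have aB : a <= B.
  rewrite -(ler_pXn2r (n := 2))// ?nnegrE// -(ler_pM2l l0) B2.
  by have := supconv_ge z; have := gM z; have := g0 y; lra.
have yw : enorm (y - w) ^+ 2 <= (a + d) ^+ 2.
  by rewrite ler_pXn2r// ?nnegrE ?enorm_ge0 ?addr_ge0//; exact: enorm_triangle.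
have := supconv_ub w y.
have : l * enorm (y - w) ^+ 2 <= l * (a + d) ^+ 2 by rewrite ler_pM2l.
have : l * (2 * a * d) <= l * (2 * B * d).
  by rewrite ler_pM2l// ler_wpM2r// ler_pM2l.
rewrite sqrrD -mulr_natl mulrDr.
lra.
Qed.

Lemma supconv_continuous z (e : R) : 0 < e ->
  exists2 r : R, 0 < r & forall w, enorm (w - z) < r -> `|S w - S z| < e.
Proof.
move=> e0; set B := Num.sqrt ((M + 1) / l).
have B0 : 0 <= B by exact: sqrtr_ge0.
pose r := Num.min 1 (e / (l * (2 * B + 1))).
have k0 : 0 < l * (2 * B + 1) by rewrite mulr_gt0// ltr_wpDl// mulr_ge0.
exists r; first by rewrite lt_min ltr01 divr_gt0.
move=> w; rewrite lt_min ltr_pdivlMr// => /andP[w1 w2].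
have := supconv_modulus z w; have := supconv_modulus w z.
rewrite (enorm_distC z w) -/B; set d := enorm (w - z) in w1 w2 *.
have d0 : 0 <= d by exact: enorm_ge0.
have : l * d ^+ 2 <= l * d by rewrite ler_pM2l// expr2 ler_piMr// ltW.
by rewrite !mulrDr ltr_norml => *; apply/andP; split; lra.
Qed.

(** Beyond distance [d] the penalty exceeds [M], so every such competitor is beaten by [y = z];
    semicontinuity is therefore required on the ball only. *)
Lemma supconv_attained z (d : R) : 0 <= d -> M < l * d ^+ 2 ->
  (forall y c, enorm (y - z) <= d -> g y < c -> \forall y' \near y, g y' < c) ->
  exists2 y, enorm (y - z) <= d & S z = g y - l * enorm (y - z) ^+ 2.
Proof.
move=> d0 Md ug.
have cB : compact [set y | enorm (y - z) <= d].
  apply: (@closed_bounded_compact _ _ _ (d + enorm z)).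
    apply: closed_enormP => y /negP; rewrite -ltNge => yd.
    exists (enorm (y - z) - d); rewrite ?subr_gt0// => w wy /=; apply/negP; rewrite -ltNge.
    by have := enorm_triangle w y z; rewrite (enorm_distC y w); lra.
  by move=> y /= yd; have := enormD (y - z) z; rewrite subrK; lra.
have [|x c xd xc|y yd ymax] := @usc_max _ _ _ (fun y => g y - l * enorm (y - z) ^+ 2) cB.
- by exists z; rewrite /= subrr enorm0.
- set G := g x in xc; set A := enorm (x - z) in xc.
  have A0 : 0 <= A by exact: enorm_ge0.
  pose e := (c - (G - l * A ^+ 2)) / 2.
  have e0 : 0 < e by rewrite divr_gt0// subr_gt0.
  have := ug x (G + e) xd; rewrite ltrDl => /(_ e0) uG.
  have k0 : 0 < l * (2 * A + 1) by rewrite mulr_gt0// ltr_wpDl// mulr_ge0.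
  pose r := Num.min 1 (e / (l * (2 * A + 1))).
  have r0 : 0 < r by rewrite lt_min ltr01 divr_gt0.
  have nr : \forall y \near x, enorm (y - x) < r by apply/nbhs_enormP; exists r.
  near=> y => _.
  have gy : g y < G + e by near: y.
  have : enorm (y - x) < r by near: y.
  rewrite lt_min ltr_pdivlMr//; set h := enorm (y - x) => /andP[h1 h2].
  have h0 : 0 <= h by exact: enorm_ge0.
  have AyA : A - h <= enorm (y - z).
    by have := enorm_triangle y x z; rewrite (enorm_distC x y) -/h -/A; lra.
  have q0 : 0 <= enorm (y - z) by exact: enorm_ge0.
  have : A ^+ 2 - 2 * A * h <= enorm (y - z) ^+ 2.
    have [Ah|Ah] := leP A h.
      by apply: le_trans (sqr_ge0 _); nra.
    by nra.
  rewrite -(ler_pM2l l0) => H.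
  have -> : c = G - l * A ^+ 2 + 2 * e by rewrite /e; field.
  have lh0 : 0 <= l * h by rewrite mulr_ge0// ltW.
  move: H h2; rewrite !mulrDr; lra.
exists y => //; apply/eqP; rewrite eq_le supconv_ub andbT.
apply: supconv_lub => w; have [wd|wd] := leP (enorm (w - z)) d; first exact: ymax.
have := ymax z; rewrite /= subrr enorm0 expr0n mulr0 subr0 => /(_ d0).
apply: le_trans; apply: le_trans (gM z).
have : l * d ^+ 2 <= l * enorm (w - z) ^+ 2.
  by rewrite ler_pM2l// ler_pXn2r// ?nnegrE ?enorm_ge0// ltW.
by have := g0 w; lra.
Unshelve. all: by end_near. Qed.

End Fixed.

Definition near_submean g z := forall e : R, 0 < e -> exists2 r : R, 0 < r &
  forall b, enorm b < r -> bmeas (fun x => g (z + cis x *: b)) /\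
    g z <= rmean (fun x => g (z + cis x *: b)) + e * enorm b ^+ 2.

(** The images of complex lines under the maps [deform] have exactly this form: a line plus a
    polynomial multiple of one fixed vector. *)
Definition curve (a b w : Cn) (p : {poly C}) (t : C) : Cn := a + t *: b + p.[t] *: w.

Lemma poly_taylor2 (p : {poly C}) (t : C) : exists b (Q : {poly C}), forall s,
  p.[t + s] = p.[t] + b * s + s ^+ 2 * Q.[s].
Proof.
pose P := p \Po ('X + t%:P).
have PE s : p.[t + s] = P.[s] by rewrite horner_comp !hornerE addrC.
exists P`_1, (drop_poly 2 P) => s.
have Pt : p.[t] = P`_0 by rewrite -horner_coef0 -PE addr0.
rewrite PE -{1}(poly_take_drop 2 P) hornerD hornerM hornerXn mulrC; congr (_ + _).
rewrite Pt (@horner_coef_wide _ 2); last exact: size_take_poly.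
by rewrite big_ord_recl big_ord1 !coef_take_poly/= expr0 mulr1 expr1.
Qed.

Lemma cabs_poly_le (Q : {poly C}) (s : C) : cabs s <= 1 ->
  cabs Q.[s] <= \sum_(i < size Q) cabs Q`_i.
Proof.
move=> s1; rewrite horner_coef.
apply: (@le_trans _ _ (\sum_(i < size Q) cabs (Q`_i * s ^+ i))).
  elim/big_ind2 : _ => [|x1 x2 y1 y2 h1 h2|i _]; rewrite ?cabs0//.
  exact: le_trans (cabsD _ _) (lerD h1 h2).
apply: ler_sum => i _; rewrite cabsM cabsX ler_piMr ?cabs_ge0// exprn_ile1 ?cabs_ge0//.
Qed.

(** The remainder is a polynomial divisible by s^2 times a fixed vector, so its product with any
    constant vector is the real part of a polynomial vanishing at 0 and has mean zero on circles. *)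
Lemma curve_taylor a b w p t : exists d (Q : {poly C}), forall s,
  curve a b w p (t + s) = curve a b w p t + s *: d + (s ^+ 2 * Q.[s]) *: w.
Proof.
have [c [Q pE]] := poly_taylor2 p t.
exists (b + c *: w), Q => s; rewrite /curve pE !scalerDl scalerDr !scalerA.
rewrite (mulrC s c); set E := (s ^+ 2 * _) *: w.
by rewrite !addrA; congr (_ + E); rewrite -!addrA; congr (_ + (_ + _)); rewrite addrCA.
Qed.

Lemma curve_continuous a b w p (t : C) (e : R) : 0 < e ->
  exists2 r : R, 0 < r & forall s, cabs (s - t) < r ->
    enorm (curve a b w p s - curve a b w p t) < e.
Proof.
move=> e0; have [d [Q fE]] := curve_taylor a b w p t.
set K := \sum_(i < size Q) cabs Q`_i.
have K0 : 0 <= K by apply: sumr_ge0 => i _; exact: cabs_ge0.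
have L0 : 0 < enorm d + K * enorm w + 1.
  by rewrite ltr_wpDl// addr_ge0 ?mulr_ge0 ?enorm_ge0.
exists (Num.min 1 (e / (enorm d + K * enorm w + 1))); first by rewrite lt_min ltr01 divr_gt0.
move=> s; rewrite lt_min ltr_pdivlMr// => /andP[s1 s2].
have -> : s = t + (s - t) by rewrite addrCA subrr addr0.
rewrite fE -(addrA (curve a b w p t)) (addrC (curve a b w p t)) addrK.
apply: le_lt_trans s2; rewrite (le_trans (enormD _ _))// !enormZ cabsM cabsX.
set r := cabs (s - t) in s1 *; have r0 : 0 <= r by exact: cabs_ge0.
have QK : cabs Q.[s - t] <= K by apply: cabs_poly_le; exact: ltW.
have w0 := enorm_ge0 w.
have : r ^+ 2 * cabs Q.[s - t] * enorm w <= r * K * enorm w.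
  rewrite ler_wpM2r// ler_pM ?sqr_ge0 ?cabs_ge0// expr2 ler_piMr// ltW//.
by rewrite !mulrDr mulr1 mulrA; lra.
Qed.

Section SubmeanCurve.
Variables (l M : R) (g : Cn -> R).
Hypotheses (l0 : 0 < l) (gM : forall y, - M <= g y) (g0 : forall y, g y <= 0).
Variables (a b w : Cn) (p : {poly C}).
Let f := curve a b w p.
Let V t := supconv l g (f t).

Lemma supconv_curve_continuous : continuous V.
Proof.
move=> t B /(nbhs_ballP (V t))[e e0 eB]; apply/nbhs_cabsP.
have [r r0 rS] := supconv_continuous l0 gM g0 (f t) e0.
have [r' r0' rf] := curve_continuous a b w p t r0.
by exists r' => // s /rf /rS h; apply: eB; rewrite /ball/= distrC.
Qed.

(* If [y] attains the supremum at [f t], the translate of the complex tangent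
   line of [f] through [y] competes along the curve, and the quadratic
   remainder of [f] is orthogonal to constants on circles. *)
Lemma supconv_curve_submean (t : C) (d : R) : 0 <= d -> M < l * d ^+ 2 ->
  (forall y c, enorm (y - f t) <= d -> g y < c -> \forall y' \near y, g y' < c) ->
  (forall y, enorm (y - f t) <= d -> near_submean g y) ->
  forall e : R, 0 < e -> exists2 r : R, 0 < r &
    forall s, cabs s < r -> V t <= rmean (fun x => V (t + cis x * s)) + e * cabs s ^+ 2.
Proof.
move=> d0 Md ug sg e e0.
have [y yd Vt] := supconv_attained l0 gM g0 d0 Md ug.
have [k [Q fE]] := curve_taylor a b w p t.
set h := y - f t in yd Vt.
set K := \sum_(i < size Q) cabs Q`_i.
have K0 : 0 <= K by apply: sumr_ge0 => i _; exact: cabs_ge0.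
(* Half of the error [e] is spent on the submean inequality of [g] in the tangent direction [k], the
   other half on the square of the remainder, bounded by [L * S ^+ 4]. *)
pose e1 := e / (2 * (enorm k ^+ 2 + 1)).
have k1 : 0 < enorm k ^+ 2 + 1 by rewrite ltr_wpDl// sqr_ge0.
have e10 : 0 < e1 by rewrite divr_gt0// mulr_gt0.
have [r r0 hr] := sg y yd _ e10.
pose L := l * (K * enorm w) ^+ 2.
have L0 : 0 <= L by rewrite mulr_ge0 ?sqr_ge0// ltW.
have L1 : 0 < 2 * (L + 1) by rewrite mulr_gt0// ltr_wpDl.
exists (Num.min (Num.min 1 (e / (2 * (L + 1)))) (r / (enorm k + 1))).
  by rewrite !lt_min ltr01 !divr_gt0// ltr_wpDl// enorm_ge0.
move=> s; rewrite !lt_min !ltr_pdivlMr//; last by rewrite ltr_wpDl// enorm_ge0.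
move=> /andP[/andP[s1 s2] s3].
set S := cabs s in s1 s2 s3 *; have S0 : 0 <= S by exact: cabs_ge0.
have sk : enorm (s *: k) < r.
  by rewrite enormZ -/S; move: s3; rewrite mulrDr mulr1; lra.
have [bg gy] := hr _ sk.
pose G x := g (y + cis x *: (s *: k)).
pose c : C := (hdot h w +i* (- hdot h ('i%C *: w)))%C.
pose q : {poly C} := c%:P * 'X^2 * Q.
(* Expansion of the penalty - l |h - remainder|^2: the cross term is 2 l Re q with q(0) = 0, which
   disappears in the mean, and [const] holds the rest. *)
pose T x := G x + 2 * l * complex.Re q.[cis x * s].
pose const := l * enorm h ^+ 2 + L * S ^+ 4.
have cS x : cabs (cis x * s) = S by rewrite cabsM cabs_cis mul1r.
have VT x : T x - const <= V (t + cis x * s).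
  apply: le_trans (supconv_ub l0 g0 _ (y + cis x *: (s *: k))).
  set sg' := cis x * s; rewrite -/(G x) /f fE -/f -/sg'.
  have -> : y + cis x *: (s *: k) - (f t + sg' *: k + (sg' ^+ 2 * Q.[sg']) *: w) =
      h - (sg' ^+ 2 * Q.[sg']) *: w.
    have E (y1 s1' f1 e1' : Cn) : y1 + s1' - (f1 + s1' + e1') = y1 - f1 - e1'.
      by rewrite (addrC f1) -(addrA s1') opprD addrA addrK opprD addrA.
    by rewrite scalerA E.
  rewrite enormB_sqr hdot_complex -/c.
  have -> : complex.Re (sg' ^+ 2 * Q.[sg'] * c) = complex.Re q.[sg'].
    by rewrite /q 2!hornerM hornerC hornerXn; congr complex.Re; ring.
  rewrite enormZ cabsM cabsX cS.
  have QK : cabs Q.[sg'] <= K by apply: cabs_poly_le; rewrite cS ltW.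
  have : (S ^+ 2 * cabs Q.[sg'] * enorm w) ^+ 2 <= (S ^+ 2 * K * enorm w) ^+ 2.
    rewrite ler_pXn2r// ?nnegrE ?mulr_ge0 ?sqr_ge0 ?enorm_ge0 ?cabs_ge0//.
    by rewrite ler_wpM2r ?enorm_ge0// ler_wpM2l ?sqr_ge0.
  rewrite -(ler_pM2l l0) => HL.
  have LE : L * S ^+ 4 = l * (S ^+ 2 * K * enorm w) ^+ 2 by rewrite /L; ring.
  rewrite /T /const LE; move: HL; set A := (_ ^+ 2 * _ * _ ) ^+ 2; lra.
have bq : bmeas (fun x => complex.Re q.[cis x * s]) by exact: bmeas_Re_poly.
have bT : bmeas T by apply: bmeasD => //; exact: bmeasZ.
have mT : rmean (fun x => T x - const) = rmean G - const.
  rewrite rmeanB ?rmean_cst//; last exact: bmeas_cst.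
  rewrite rmeanD//; last exact: bmeasZ.
  rewrite rmeanZ// rmean_Re_poly /q 2!hornerM hornerXn expr0n mulr0 mul0r.
  by rewrite mulr0 addr0.
have bV : bmeas (fun x => V (t + cis x * s)).
  apply: bmeas_continuous => x.
  apply: (@continuous_comp _ _ _ (fun x => t + cis x * s) V); first exact: continuous_circle.
  exact: supconv_curve_continuous.
have : rmean (fun x => T x - const) <= rmean (fun x => V (t + cis x * s)).
  by apply: rmean_le => //; apply: bmeasB => //; exact: bmeas_cst.
rewrite mT => mV.
move: gy; rewrite enormZ -/S -/(G _) => gy.
have VE : V t = g y - l * enorm h ^+ 2 by exact: Vt.
have ek : e1 * (S * enorm k) ^+ 2 <= e / 2 * S ^+ 2.
  have -> : e1 * (S * enorm k) ^+ 2 = e / 2 * S ^+ 2 * (enorm k ^+ 2 / (enorm k ^+ 2 + 1)).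
    by rewrite /e1; field; rewrite gt_eqF.
  rewrite ler_piMr//; last by rewrite ler_pdivrMr// mul1r lerDl.
  by rewrite mulr_ge0 ?sqr_ge0// ltW// divr_gt0.
have eL : L * S ^+ 4 <= e / 2 * S ^+ 2.
  have -> : L * S ^+ 4 = (L * S ^+ 2) * S ^+ 2 by ring.
  rewrite ler_wpM2r ?sqr_ge0//.
  have : L * S ^+ 2 <= L * S by rewrite ler_wpM2l// expr2 ler_piMr// ltW.
  by move: s2; rewrite !mulrDr mulr1; lra.
by move: mV gy; rewrite VE /const -/(G _); set A := rmean G; set B := rmean _; lra.
Qed.

End SubmeanCurve.
End SupConvolution.

(** * Plurisubharmonic functions *)

Section Psh.
Context {R : realType} {n : nat}.
Local Notation C := R[i].
Local Notation Cn := 'rV[C]_n.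
Local Notation TR := (measurableTypeR R).
Local Notation I2 := (`[0, 2 * pi]%classic : set TR).
Implicit Types (Om U : set Cn) (u v : Cn -> \bar R) (z a b w : Cn).

Definition lmean u z b : \bar R := cmean (fun x : TR => u (z + cis x *: b)).

(* A local form of the submean inequality, stable under sup-convolution up to
   the quadratic error; [lpsh_psh] recovers plurisubharmonicity from it. *)
Definition lpsh Om u := usc_on Om u /\
  forall z, Om z -> forall e : R, 0 < e -> exists2 r : R, 0 < r &
    forall b, enorm b < r -> (u z <= lmean u z b + (e * enorm b ^+ 2)%:E)%E.

Lemma circle_mean_line u a b (t : C) (r : R) :
  circle_mean (fun t => u (a + t *: b)) t r = lmean u (a + t *: b) ((r%:C)%C *: b).
Proof.
congr (_ * _)%E; apply: eq_integral => x _; congr u.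
rewrite scalerDl addrA scalerA; congr (_ + _ *: _).
by apply/eqP; rewrite eq_complex/=; apply/andP; split; apply/eqP; ring.
Qed.

Lemma usc_on_near Om u z (c : R) : usc_on Om u -> Om z -> (u z < c%:E)%E ->
  exists2 r : R, 0 < r & forall w, enorm (w - z) < r -> Om w -> (u w < c%:E)%E.
Proof.
by move=> uu Oz /((uu z Oz).2 c)/nbhs_enormP[r r0 h]; exists r.
Qed.

Lemma open_near Om z : open Om -> Om z ->
  exists2 r : R, 0 < r & forall w, enorm (w - z) < r -> Om w.
Proof. by rewrite openE => oO /oO/nbhs_enormP. Qed.

Lemma openP Om : (forall z, Om z -> exists2 r : R, 0 < r & forall w, enorm (w - z) < r -> Om w) ->
  open Om.
Proof. by move=> h; rewrite openE => z /h H; apply/nbhs_enormP. Qed.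

Lemma usc_path_measurable Om u (g : R -> Cn) : usc_on Om u -> (forall x, Om (g x)) ->
  (forall x (e : R), 0 < e -> \forall y \near x, enorm (g y - g x) < e) ->
  measurable_fun I2 (u \o g : TR -> \bar R).
Proof.
move=> uu Og cg; apply: measurable_usc => t c /= uc.
have [r r0 h] := usc_on_near uu (Og t) uc.
by have := cg t _ r0; apply: filterS => y /h; exact.
Qed.

Lemma circle_path_continuous z b (x : R) (e : R) : 0 < e ->
  \forall y \near x, enorm ((z + cis y *: b) - (z + cis x *: b)) < e.
Proof.
move=> e0; have s1 : 0 < enorm b + 1 by rewrite ltr_wpDl ?enorm_ge0.
near=> y; rewrite opprD addrACA subrr add0r -scalerBl enormZ.
apply: (@le_lt_trans _ _ (cabs (cis y - cis x) * (enorm b + 1))).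
  by rewrite ler_wpM2l ?cabs_ge0// lerDl.
rewrite -ltr_pdivlMr//; near: y; apply: continuous_cis_nbhs.
exact: divr_gt0.
Unshelve. all: by end_near. Qed.

Lemma usc_circle_measurable Om u z b : usc_on Om u -> (forall x, Om (z + cis x *: b)) ->
  measurable_fun I2 (fun x : TR => u (z + cis x *: b)).
Proof.
move=> uu Oc; apply: (usc_path_measurable uu Oc) => x e e0.
exact: circle_path_continuous.
Qed.

Lemma enorm_cisZ x b : enorm (cis x *: b) = enorm b.
Proof. by rewrite enormZ cabs_cis mul1r. Qed.

Lemma psh_submean Om u z b : psh Om u ->
  (forall t : C, cabs t <= 1 -> Om (z + t *: b)) -> (u z <= lmean u z b)%E.
Proof.
move=> [_ pu] Oc; have [_ /(_ 0 1 ltr01)] := pu z b.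
rewrite circle_mean_line !scale0r !addr0 scale1r; apply => t /=.
by rewrite subr0 normcE_cabs lecR; exact: Oc.
Qed.

Lemma psh_lpsh Om u : open Om -> psh Om u -> lpsh Om u.
Proof.
move=> oO pu; split; first exact: pu.1.
move=> z Oz e e0; have [r r0 zr] := open_near oO Oz.
exists r => // b br; rewrite (le_trans (psh_submean (z := z) (b := b) pu _))//.
  move=> t t1; apply: zr; rewrite addrAC subrr add0r enormZ.
  by rewrite (le_lt_trans _ br)// ler_piMl// enorm_ge0.
by rewrite leeDl// lee_fin mulr_ge0 ?sqr_ge0// ltW.
Qed.

(** Outside [Om] the value is the floor [- j]: upper semicontinuity at points of [Om] and the bounds
    are kept, while the sup-convolution can run over the whole space. *)
Definition trunc Om u (j : nat) (y : Cn) : R :=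
  if `[< Om y >] then fine (maxe (u y) (- j%:R)%:E) else - j%:R.

Section Trunc.
Variables (Om : set Cn) (u : Cn -> \bar R).
Hypotheses (u0 : forall z, Om z -> (u z <= 0)%E).

Lemma truncE j y : Om y -> (trunc Om u j y)%:E = maxe (u y) (- j%:R)%:E.
Proof.
move=> Oy; rewrite /trunc; case: asboolP => // _; rewrite fineK//.
rewrite fin_numE; apply/andP; split.
  by rewrite -ltNye lt_max ltNyr orbT.
by rewrite -ltey gt_max ltry (le_lt_trans (u0 Oy))// ltry.
Qed.

Lemma trunc_ge j y : - j%:R <= trunc Om u j y.
Proof.
have [Oy|Oy] := pselect (Om y); first by rewrite -lee_fin truncE// le_max lexx orbT.
by rewrite /trunc asboolF.
Qed.

Lemma trunc_le0 j y : trunc Om u j y <= 0.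
Proof.
have [Oy|Oy] := pselect (Om y).
  by rewrite -lee_fin truncE// ge_max u0//= lee_fin oppr_le0.
by rewrite /trunc asboolF// oppr_le0.
Qed.

Lemma trunc_mono j k y : (j <= k)%N -> trunc Om u k y <= trunc Om u j y.
Proof.
move=> jk; have jkR : - k%:R <= - j%:R :> R by rewrite lerN2 ler_nat.
have [Oy|Oy] := pselect (Om y); last by rewrite /trunc asboolF.
rewrite -lee_fin !truncE// ge_max !le_max lexx/=.
by rewrite lee_fin jkR orbT.
Qed.

Lemma trunc_usc j y c : usc_on Om u -> Om y -> trunc Om u j y < c ->
  \forall y' \near y, trunc Om u j y' < c.
Proof.
move=> uu Oy; rewrite -lte_fin truncE// gt_max => /andP[uc jc].
have [r r0 h] := usc_on_near uu Oy uc.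
apply/nbhs_enormP; exists r => // w /h wu.
have [Ow|Ow] := pselect (Om w); last by rewrite /trunc asboolF.
by rewrite -lte_fin truncE// gt_max wu//.
Qed.

Lemma trunc_near_submean j y : open Om -> lpsh Om u -> Om y ->
  near_submean (trunc Om u j) y.
Proof.
move=> oO [uu lu] Oy e e0; have [r r0 hr] := lu y Oy e e0.
have [r' r0' hr'] := open_near oO Oy.
exists (Num.min r r'); first by rewrite lt_min r0.
move=> b; rewrite lt_min => /andP[br br'].
have Oc x : Om (y + cis x *: b).
  by apply: hr'; rewrite addrAC subrr add0r enorm_cisZ.
have mu := usc_circle_measurable uu Oc.
have bt : bmeas (fun x => trunc Om u j (y + cis x *: b)).
  split; last first.
    by exists j%:R => t _; rewrite ler_norml trunc_ge (le_trans (trunc_le0 _ _)).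
  apply/measurable_EFinP; apply: (eq_measurable_fun (fun x => maxe (u (y + cis x *: b)) (- j%:R)%:E)).
    by move=> x _; rewrite /= truncE.
  exact: measurable_maxe.
split=> //.
rewrite -lee_fin truncE// ge_max; apply/andP; split.
  apply: le_trans (hr b br) _; rewrite EFinD leeD2r// -cmean_fin//.
  apply: cmean_le => //; first by case: bt => /measurable_EFinP.
  by move=> t _ /=; rewrite truncE// le_max lexx.
rewrite lee_fin -[X in X <= _]addr0; apply: lerD; last by rewrite mulr_ge0 ?sqr_ge0 ?ltW.
rewrite -(rmean_cst (- j%:R)); apply: rmean_le => //; first exact: bmeas_cst.
by move=> t _; exact: trunc_ge.
Qed.

End Trunc.

(** The sup-convolutions of the truncations are continuous along the curve and satisfy the
    infinitesimal submean inequality there; [disc_submean] makes it global, and the parameter of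
    both regularisations then tends to infinity. *)
Theorem lpsh_curve Om u a b w (p : {poly C}) : open Om -> lpsh Om u ->
  (forall z, Om z -> (u z <= 0)%E) ->
  (forall t : C, cabs t <= 1 -> Om (curve a b w p t)) ->
  (u (curve a b w p 0%R) <= cmean (fun x => u (curve a b w p (cis x))))%E.
Proof.
move=> oO lu u0 fO; set f := curve a b w p in fO *.
have [d d0 fd] : exists2 d : R, 0 < d & forall t y, cabs t <= 1 ->
    enorm (y - f t) <= d -> Om y.
  have /compact_near_coveringP cK : compact [set t : C | cabs t <= 1].
    apply: (@closed_bounded_compactC _ _ 1) => //.
    rewrite (_ : [set t | _] = cabs @^-1` [set x | x <= 1])//.
    apply: closed_comp => [t _|]; [exact: continuous_cabs|exact: closed_le].
  have := cK R (0^'+) (fun d t => forall y, enorm (y - f t) <= d -> Om y) _ _.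
  case=> [t t1|d /= d0 dK].
    have [r r0 hr] := open_near oO (fO t t1).
    have r2 : 0 < r / 2 by rewrite divr_gt0.
    have [r' r0' hr'] := curve_continuous a b w p t r2.
    have nt : \forall s \near t, cabs (s - t) < r' by apply/nbhs_cabsP; exists r'.
    near=> s d.
    have sd : d < r / 2 by near: d; exact: nbhs_right_lt.
    have st : cabs (s - t) < r' by near: s.
    move=> y yd; apply: hr; rewrite (le_lt_trans (enorm_triangle (f s) _ _))//.
    by rewrite (splitr r) ltrD ?hr'// (le_lt_trans yd).
  exists (d / 2); first by rewrite divr_gt0.
  move=> t y t1; apply: (dK (d / 2)) => //=; last by rewrite divr_gt0.
  rewrite sub0r normrN gtr0_norm ?divr_gt0//.
  by rewrite ltr_pdivrMr// ltr_pMr// ltr1n.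
(* With this choice l d^2 = j + 1 exceeds the oscillation [j] of the truncation, so the suprema are
   attained within [d] of the curve, inside [Om], where the submean inequality of [u] is
   available. *)
pose l (j : nat) : R := j.+1%:R / d ^+ 2.
have l0 j : 0 < l j by rewrite divr_gt0// exprn_gt0.
have ld j : j%:R < l j * d ^+ 2.
  by rewrite /l divfK ?ltr_nat// gt_eqF// exprn_gt0.
pose g j := trunc Om u j.
have gM j := @trunc_ge Om u u0 j; have g0 j := @trunc_le0 Om u u0 j.
pose S j z := supconv (l j) (g j) z.
have cV j : continuous (fun t => S j (f t)).
  exact: (supconv_curve_continuous (l0 j) (gM j) (g0 j)).
have sub j : S j (f 0) <= rmean (fun x => S j (f (cis x))).
  apply: (disc_submean (cV j)) => t t1.
  apply: (supconv_curve_submean (l0 j) (gM j) (g0 j) (ltW d0) (ld j)).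
    by move=> y c /(fd t y (ltW t1)) Oy; exact: (trunc_usc u0 lu.1 Oy).
  by move=> y /(fd t y (ltW t1)) Oy; exact: (trunc_near_submean u0 _ oO lu Oy).
have cc j : continuous (fun x => S j (f (cis x)) : R).
  move=> x; apply: (@continuous_comp _ _ _ (fun x => cis x) (fun t => S j (f t))); last exact: cV.
  have := @continuous_circle _ 0 1 x; rewrite (_ : (fun x => _) = cis)//.
  by apply/funext => y; rewrite add0r mulr1.
have fc x : Om (f (cis x)) by apply: fO; rewrite cabs_cis.
have mS j := bmeas_continuous (cc j).
apply: (@cmean_lim _ (fun j x => (S j (f (cis x)))%:E)).
- apply: (usc_path_measurable lu.1 fc) => x e e0.
  have [r r0 hr] := curve_continuous a b w p (cis x) e0.
  near=> y; apply: hr; near: y; exact: continuous_cis_nbhs.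
- by move=> x _; exact: u0.
- by move=> j; apply/measurable_EFinP; case: (mS j).
- by move=> j x _; rewrite lee_fin; exact: supconv_le0.
- move=> j k x _ jk; rewrite lee_fin; apply: (supconv_lub (l0 k) (g0 k)) => y.
  apply: le_trans (supconv_ub (l0 j) (g0 j) _ y); apply: lerB; first exact: trunc_mono.
  by rewrite ler_wpM2r ?sqr_ge0// /l ler_wpM2r ?invr_ge0 ?sqr_ge0// ler_nat.
- move=> x c _ uc; have [r r0 hr] := usc_on_near lu.1 (fc x) uc.
  (* Two demands on [k]: the floor [- k] is at most [c], for points closer than [r], and the penalty
     l_k r^2 is at least |c|, for the other points. *)
  pose k := (Num.trunc (`|c| + `|c| * (d ^+ 2 / r ^+ 2)) ).+1; exists k.
  rewrite lee_fin; apply: (supconv_lub (l0 k) (g0 k)) => y.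
  have q0 : 0 <= `|c| * (d ^+ 2 / r ^+ 2).
    by apply: mulr_ge0 => //; apply: divr_ge0; exact: sqr_ge0.
  have kc : `|c| + `|c| * (d ^+ 2 / r ^+ 2) <= k%:R.
    have h0 := addr_ge0 (normr_ge0 c) q0.
    by have /andP[_ /ltW] := truncn_itv h0.
  have nc : - `|c| <= c by rewrite lerNl -normrN ler_norm.
  have kc' : - k%:R <= c by lra.
  have y0 : 0 <= l k * enorm (y - f (cis x)) ^+ 2 by rewrite mulr_ge0 ?sqr_ge0// ltW.
  have [yr|yr] := ltP (enorm (y - f (cis x))) r.
    rewrite lerBlDr (@le_trans _ _ c) ?lerDl//.
    have [Oy|Oy] := pselect (Om y); last by rewrite /g /trunc asboolF.
    by rewrite -lee_fin truncE// ge_max lee_fin kc' andbT ltW// hr.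
  rewrite lerBlDr (le_trans (g0 k y))// -lerBlDl add0r (le_trans (_ : _ <= `|c|))//.
    by rewrite lerNl.
  have rr : 0 < r ^+ 2 by rewrite exprn_gt0.
  have dd : 0 < d ^+ 2 by rewrite exprn_gt0.
  apply: (@le_trans _ _ (l k * r ^+ 2)); last first.
    by rewrite ler_pM2l// ler_pXn2r// nnegrE ?enorm_ge0// ltW.
  rewrite /l mulrAC ler_pdivlMr// -ler_pdivrMr// -mulrA.
  apply: le_trans (_ : k%:R <= _); last by rewrite ler_nat.
  by have := normr_ge0 c; lra.
- move=> j; apply: (@le_trans _ _ (S j (f 0))%:E).
    apply: (@le_trans _ _ (g j (f 0))%:E).
      by rewrite truncE ?le_max ?lexx//; apply: fO; rewrite cabs0.
    by rewrite lee_fin; exact: supconv_ge.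
  rewrite (_ : cmean _ = (rmean (fun x => S j (f (cis x))))%:E) ?lee_fin//.
  exact: (cmean_fin (mS j)).
Unshelve. all: by end_near. Qed.

End Psh.

Lemma lteD_split {R : realType} (x y : \bar R) (c : R) : (x < +oo)%E -> (y < +oo)%E ->
  (x + y < c%:E)%E -> exists c1 c2, [/\ (x < c1%:E)%E, (y < c2%:E)%E & c1 + c2 = c].
Proof.
case: x => [x||] _ //; case: y => [y||] _ //.
- rewrite -EFinD lte_fin => xyc; exists (x + (c - (x + y)) / 2), (y + (c - (x + y)) / 2).
  have e0 : 0 < (c - (x + y)) / 2 by rewrite divr_gt0// subr_gt0.
  by split; rewrite ?lte_fin ?ltrDl//; field.
- by exists (x + 1), (c - (x + 1)); split; rewrite ?lte_fin ?ltrDl ?ltNyr//; ring.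
- by exists (c - (y + 1)), (y + 1); split; rewrite ?lte_fin ?ltrDl ?ltNyr//; ring.
- by exists 0, c; split; rewrite ?ltNyr// add0r.
Qed.

Section PshOps.
Context {R : realType} {n : nat}.
Local Notation C := R[i].
Local Notation Cn := 'rV[C]_n.
Local Notation TR := (measurableTypeR R).
Local Notation I2 := (`[0, 2 * pi]%classic : set TR).
Implicit Types (Om U : set Cn) (u v : Cn -> \bar R) (z a b w : Cn).

Lemma usc_onP Om u : (forall z, Om z -> (u z < +oo)%E) ->
  (forall z (c : R), Om z -> (u z < c%:E)%E ->
    exists2 r : R, 0 < r & forall w, enorm (w - z) < r -> Om w -> (u w < c%:E)%E) ->
  usc_on Om u.
Proof.
move=> uy uu z Oz; split; first exact: uy.
by move=> c /(uu z c Oz)[r r0 h]; apply/nbhs_enormP; exists r.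
Qed.

Lemma pshP Om u : psh Om u <-> usc_on Om u /\
  forall z b, (forall t : C, cabs t <= 1 -> Om (z + t *: b)) -> (u z <= lmean u z b)%E.
Proof.
split=> [pu|[uu su]]; first by split; [exact: pu.1|move=> z b; exact: psh_submean].
split=> // a b; split.
  move=> t Ot; split; first exact: (uu _ Ot).1.
  move=> c uc; have [r r0 hr] := usc_on_near uu Ot uc.
  apply/nbhs_cabsP; exists (r / (enorm b + 1)).
    by rewrite divr_gt0// ltr_wpDl// enorm_ge0.
  move=> s; rewrite ltr_pdivlMr ?ltr_wpDl ?enorm_ge0// => st Os; apply: hr => //.
  rewrite opprD addrACA subrr add0r -scalerBl enormZ (le_lt_trans _ st)//.
  by rewrite ler_wpM2l ?cabs_ge0// lerDl.
move=> t r r0 rO; rewrite circle_mean_line; apply: su => s s1.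
rewrite -addrA scalerA -scalerDl; apply: rO => /=.
rewrite addrAC subrr add0r normcE_cabs lecR cabsM cabsR gtr0_norm//.
by rewrite ler_piMl// ltW.
Qed.

Lemma psh_subset Om U u : U `<=` Om -> psh Om u -> psh U u.
Proof.
move=> UO /pshP[uu su]; apply/pshP; split; last first.
  by move=> z b Ub; apply: su => t /Ub /UO.
apply: usc_onP => [z /UO/uu[]//|z c /UO Oz uc].
have [r r0 h] := usc_on_near uu Oz uc; exists r => // w wr /UO; exact: h.
Qed.

(** The degenerate curve with [w = 0] and [p = 0] is a disc in a complex line, so the infinitesimal
    inequality gives the full one. *)
Lemma lpsh_psh Om u : open Om -> (forall z, Om z -> (u z <= 0)%E) -> lpsh Om u -> psh Om u.
Proof.
move=> oO u0 lu; apply/pshP; split; first exact: lu.1.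
move=> z b Ob; have := @lpsh_curve _ _ Om u z b 0 0 oO lu u0.
have E t : curve z b 0 0 t = z + t *: b by rewrite /curve scaler0 addr0.
rewrite E scale0r addr0.
under [X in cmean X]eq_fun do rewrite E.
by apply => t t1; rewrite E; exact: Ob.
Qed.

(** On a complex line the composite is [u] along a polynomial curve, where [lpsh_curve] is the
    submean inequality. *)
Lemma psh_compose Om U u (phi : Cn -> Cn) : open Om ->
  psh Om u -> (forall z, Om z -> (u z <= 0)%E) ->
  (forall z, U z -> Om (phi z)) ->
  (forall z (e : R), 0 < e -> exists2 r : R, 0 < r &
    forall w, enorm (w - z) < r -> enorm (phi w - phi z) < e) ->
  (forall a b, exists w p, forall t : C, phi (a + t *: b) = curve a b w p t) ->
  psh U (u \o phi).
Proof.
move=> oO pu u0 UO cphi phic; have uu := pu.1; apply/pshP; split.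
  apply: usc_onP => [z /UO/uu[]//|z c /UO Oz uc].
  have [r r0 h] := usc_on_near uu Oz uc; have [r' r0' h'] := cphi z _ r0.
  by exists r' => // w /h' wr /UO; exact: h.
move=> z b Ub; have [w [p E]] := phic z b.
have := @lpsh_curve _ _ Om u z b w p oO (psh_lpsh oO pu) u0.
rewrite -E scale0r addr0.
under [X in cmean X]eq_fun do rewrite -E.
by apply => t t1; rewrite -E; apply: UO; exact: Ub.
Qed.

(** The gluing principle: [lpsh] looks at arbitrarily small circles only, and [lpsh_psh] restores
    the large ones. *)
Lemma psh_local Om u : open Om -> (forall z, Om z -> (u z <= 0)%E) ->
  (forall z, Om z -> exists U v, [/\ open U, U z, U `<=` Om, psh U v &
     forall w, U w -> u w = v w]) -> psh Om u.
Proof.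
move=> oO u0 hl; apply: lpsh_psh => //; split.
  apply: usc_onP => [z Oz|z c Oz].
    by rewrite (le_lt_trans (u0 z Oz))// ltry.
  have [U [v [oU Uz UO pv uv]]] := hl z Oz; rewrite uv// => vc.
  have [r r0 h] := usc_on_near pv.1 Uz vc; have [r' r0' h'] := open_near oU Uz.
  exists (Num.min r r'); first by rewrite lt_min r0.
  by move=> w; rewrite lt_min => /andP[wr /h' Uw] _; rewrite uv//; exact: h.
move=> z Oz e e0; have [U [v [oU Uz UO pv uv]]] := hl z Oz.
have [r r0 h] := (psh_lpsh oU pv).2 z Uz e e0; have [r' r0' h'] := open_near oU Uz.
exists (Num.min r r'); first by rewrite lt_min r0.
move=> b; rewrite lt_min => /andP[br br']; rewrite uv//.
rewrite (_ : lmean u z b = lmean v z b); first exact: h.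
apply: eq_cmean => x _; apply: uv; apply: h'.
by rewrite addrAC subrr add0r enorm_cisZ.
Qed.

Lemma psh_neg_max Om u v : psh_neg Om u -> psh_neg Om v ->
  psh_neg Om (fun z => maxe (u z) (v z)).
Proof.
move=> [/pshP[uu su] u0] [/pshP[uv sv] v0]; split; last first.
  by move=> z Oz; rewrite ge_max u0//= v0.
have um : usc_on Om (fun z => maxe (u z) (v z)).
  apply: usc_onP => [z Oz|z c Oz]; first by rewrite gt_max (uu z Oz).1 (uv z Oz).1.
  rewrite gt_max => /andP[/(usc_on_near uu Oz)[r r0 h] /(usc_on_near uv Oz)[s s0 k]].
  exists (Num.min r s); first by rewrite lt_min r0.
  by move=> w; rewrite lt_min => /andP[wr ws] Ow; rewrite gt_max h//= k.
apply/pshP; split=> // z b Ob.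
have Oc x : Om (z + cis x *: b) by apply: Ob; rewrite cabs_cis.
have mm := usc_circle_measurable um Oc.
rewrite ge_max; apply/andP; split.
  apply: le_trans (su z b Ob) _; apply: cmean_le => //; first exact: (usc_circle_measurable uu Oc).
  by move=> x _; rewrite le_max lexx.
apply: le_trans (sv z b Ob) _; apply: cmean_le => //; first exact: (usc_circle_measurable uv Oc).
by move=> x _; rewrite le_max lexx orbT.
Qed.

Lemma psh_neg_add Om u v : psh_neg Om u -> psh_neg Om v ->
  psh_neg Om (fun z => u z + v z)%E.
Proof.
move=> [/pshP[uu su] u0] [/pshP[uv sv] v0]; split; last first.
  by move=> z Oz; rewrite adde_le0 ?u0 ?v0.
apply/pshP; split.
  apply: usc_onP => [z Oz|z c Oz].
    by rewrite (le_lt_trans (y := 0%E)) ?ltry// adde_le0 ?u0 ?v0.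
  move=> /(lteD_split (uu z Oz).1 (uv z Oz).1)[c1 [c2 [uc vc <-]]].
  have [r r0 h] := usc_on_near uu Oz uc; have [s s0 k] := usc_on_near uv Oz vc.
  exists (Num.min r s); first by rewrite lt_min r0.
  by move=> w; rewrite lt_min => /andP[wr ws] Ow; rewrite EFinD lteD ?h ?k.
move=> z b Ob.
have Oc x : Om (z + cis x *: b) by apply: Ob; rewrite cabs_cis.
rewrite /lmean cmeanD; first exact: leeD (su z b Ob) (sv z b Ob).
- exact: usc_circle_measurable uu Oc.
- exact: usc_circle_measurable uv Oc.
- by move=> x _; exact: u0.
- by move=> x _; exact: v0.
Qed.

Lemma psh_neg_scale Om u (c : R) : 0 < c -> psh_neg Om u ->
  psh_neg Om (fun z => c%:E * u z)%E.
Proof.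
move=> c0 [/pshP[uu su] u0]; split; last first.
  by move=> z Oz; rewrite mule_ge0_le0 ?u0// lee_fin ltW.
apply/pshP; split.
  apply: usc_onP => [z Oz|z d Oz].
    by rewrite (le_lt_trans (y := 0%E)) ?ltry// mule_ge0_le0 ?u0// lee_fin ltW.
  have E (x : \bar R) : (c%:E * x < d%:E)%E = (x < (d / c)%:E)%E.
    by rewrite -[RHS](lte_pmul2l (z := c%:E)) ?lte_fin// -EFinM mulrCA divff ?mulr1 ?gt_eqF.
  rewrite E => /(usc_on_near uu Oz)[r r0 h]; exists r => // w wr Ow; rewrite E; exact: h.
move=> z b Ob.
have Oc x : Om (z + cis x *: b) by apply: Ob; rewrite cabs_cis.
rewrite /lmean cmeanZ; [|exact: ltW|exact: usc_circle_measurable uu Oc|by move=> x _; exact: u0].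
by rewrite lee_pmul2l// ?lte_fin//; exact: su.
Qed.

Lemma psh_neg_cst Om (c : \bar R) : (c <= 0)%E -> psh_neg Om (fun=> c).
Proof.
move=> c0; split=> //; apply/pshP; split.
  apply: usc_onP => [z _|z d _ cd]; first by rewrite (le_lt_trans c0)// ltry.
  by exists 1.
by move=> z b _; rewrite /lmean cmean_cst.
Qed.

Lemma psh_neg_sum Om (J : Type) (r : seq J) (u : J -> Cn -> \bar R) :
  (forall j, psh_neg Om (u j)) -> psh_neg Om (fun z => \sum_(j <- r) u j z)%E.
Proof.
move=> pu; elim: r => [|j r IH].
  by under eq_fun do rewrite big_nil; exact: psh_neg_cst.
by under eq_fun do rewrite big_cons; exact: psh_neg_add.
Qed.

End PshOps.

(** * Logarithmic singularities *)

Section LogPsh.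
Context {R : realType}.

(** The mean value theorem: the difference has derivative x^2 / (1 + x), with denominator at least
    1/2. *)
Lemma ln_taylor2 (y : R) : `|y| <= 1 / 2 -> `|ln (1 + y) - (y - y ^+ 2 / 2)| <= 2 * `|y| ^+ 3.
Proof.
move=> y2; pose h (x : R) := ln (1 + x) - (x - x ^+ 2 / 2).
have dh (x : R) : - (1 / 2) <= x -> is_derive x (1 : R) h (x ^+ 2 / (1 + x)).
  move=> x1; have x0 : 0 < 1 + x by lra.
  have ? := is_derive1_ln x0.
  apply: is_derive_eq; rewrite /GRing.scale/= ?mulr1 ?expr1.
  by field; rewrite gt_eqF.
have ch (a b : R) : - (1 / 2) <= a -> {within `[a, b], continuous h}.
  move=> a1; apply: derivable_within_continuous => x; rewrite in_itv/= => /andP[ax _].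
  by have [] := dh x (le_trans a1 ax).
have h0 : h 0 = 0 by rewrite /h addr0 ln1 expr0n/= mul0r !subr0.
have bd (c : R) : `|c| <= `|y| -> `|c ^+ 2 / (1 + c) * y| <= 2 * `|y| ^+ 3.
  move=> cy; have c2 : `|c| <= 1 / 2 by exact: le_trans y2.
  have c1 : 1 / 2 <= 1 + c by move: c2; rewrite ler_norml => /andP[]; lra.
  have c0 : 0 < 1 + c by lra.
  rewrite 2!normrM normrX normfV (gtr0_norm c0) (exprSr `|y| 2) (mulrA 2).
  apply: ler_wpM2r => //; rewrite ler_pdivrMr//.
  have : `|c| ^+ 2 <= `|y| ^+ 2 by rewrite ler_pXn2r// nnegrE.
  have : 0 <= `|y| ^+ 2 by rewrite sqr_ge0.
  nra.
rewrite -/(h y); case: (ltgtP y 0) => [yn|yp|->]; last first.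
- by rewrite h0 normr0 expr0n mulr0.
- have d1 (x : R) : x \in `]0, y[ -> is_derive x (1 : R) h (x ^+ 2 / (1 + x)).
    by rewrite in_itv/= => /andP[x0 _]; apply: dh; lra.
  have n0 : - (1 / 2) <= 0 :> R by lra.
  have [c] := MVT yp d1 (ch _ _ n0).
  rewrite in_itv/= h0 !subr0 => /andP[c0 cy] ->; apply: bd.
  by rewrite !gtr0_norm// ltW.
- have y1 : - (1 / 2) <= y by move: y2; rewrite ler_norml => /andP[].
  have d1 (x : R) : x \in `]y, 0[ -> is_derive x (1 : R) h (x ^+ 2 / (1 + x)).
    by rewrite in_itv/= => /andP[x0 _]; apply: dh; lra.
  have [c] := MVT yn d1 (ch _ _ y1).
  rewrite in_itv/= h0 !sub0r => /andP[c0 cy] E.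
  rewrite -normrN E -normrN -mulrN opprK; apply: bd.
  by rewrite !ltr0_norm// lerN2 ltW.
Qed.

Section Circle.
Variable n : nat.
Local Notation C := R[i].
Local Notation Cn := 'rV[C]_n.
Implicit Types z b : Cn.

(* The squared modulus of the Hermitian product of [z] and [b]. *)
Definition herm2 z b : R := hdot z b ^+ 2 + hdot z ('i%C *: b) ^+ 2.

Lemma enorm_dist z b : `|enorm z - enorm b| <= enorm (z - b).
Proof.
have h1 := enormB z b; have h2 := enormB b z; rewrite (enorm_distC b) in h2.
by rewrite ler_norml h1 andbT lerNl opprB.
Qed.

Lemma enorm_circle_sqr z b x : enorm (z + cis x *: b) ^+ 2 =
  enorm z ^+ 2 + enorm b ^+ 2 +
  2 * complex.Re (cis x * (hdot z b +i* (- hdot z ('i%C *: b)))%C).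
Proof.
rewrite enorm_hdot hdotDl !hdotDr -!enorm_hdot enorm_cisZ (hdotC _ z) hdot_complex.
ring.
Qed.

(** An expansion to second order and not merely an inequality: the quadratic term is nonnegative in
    general, by [hdot_bessel], but [log_pole_bound] needs that it vanishes on the complex line
    through the pole. *)
Lemma ln_circle z : z != 0 -> exists K r : R, [/\ 0 <= K, 0 < r &
  forall b, enorm b < r ->
   [/\ bmeas (fun x => ln (enorm (z + cis x *: b))), forall x, z + cis x *: b != 0 &
    `|rmean (fun x => ln (enorm (z + cis x *: b))) - ln (enorm z) -
      (enorm b ^+ 2 / enorm z ^+ 2 - herm2 z b / enorm z ^+ 4) / 2| <= K * enorm b ^+ 3]].
Proof.
rewrite -enorm_pos; set m := enorm z => m0.
(* The radius [m / 6] makes the relative increment [y] at most 3 B / m, hence at most 1/2; in 28,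
   the part 27 is the cubic error (3 B / m)^3 and the part 1 absorbs the quartic term. *)
pose K : R := 28 / m ^+ 3; pose r := m / 6.
have r0 : 0 < r by rewrite divr_gt0.
exists K, r; split => //; first by rewrite divr_ge0// exprn_ge0// ltW.
move=> b; rewrite /r; set B := enorm b => Br.
have B0 : 0 <= B by exact: enorm_ge0.
pose k : C := (hdot z b +i* (- hdot z ('i%C *: b)))%C.
have k2 : cabs k ^+ 2 = herm2 z b by rewrite cabs_sqr/= sqrrN.
have kmB : cabs k ^+ 2 <= (m * B) ^+ 2.
  rewrite k2 /herm2 -(hdotC b) -(hdotC ('i%C *: b)).
  by have := hdot_bessel b z; rewrite exprMn mulrC.
have {}kmB : cabs k <= m * B.
  by rewrite -(ler_pXn2r (n := 2))// nnegrE ?cabs_ge0// mulr_ge0// ltW.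
pose y x := (2 * complex.Re (cis x * k) + B ^+ 2) / m ^+ 2.
have yb x : `|y x| <= 3 * B / m.
  rewrite /y normrM normfV [`|m ^+ 2|]ger0_norm ?sqr_ge0// ler_pdivrMr ?exprn_gt0//.
  have -> : 3 * B / m * m ^+ 2 = 3 * B * m by field; rewrite gt_eqF.
  rewrite (le_trans (ler_normD _ _))// [`|B ^+ 2|]ger0_norm ?sqr_ge0//.
  rewrite normrM ger0_norm//.
  have : `|complex.Re (cis x * k)| <= m * B.
    by rewrite (le_trans (Re_le_cabs _))// cabsM cabs_cis mul1r.
  have : B ^+ 2 <= B * m by rewrite expr2 ler_wpM2l//; move: Br; lra.
  by rewrite (mulrC m); lra.
have yh x : `|y x| <= 1 / 2.
  rewrite (le_trans (yb x))// ler_pdivrMr//; move: Br; lra.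
have E x : enorm (z + cis x *: b) ^+ 2 = m ^+ 2 * (1 + y x).
  by rewrite enorm_circle_sqr -/k -/m -/B /y; field; rewrite gt_eqF.
have y1 x : 0 < 1 + y x by have := yh x; rewrite ler_norml => /andP[]; lra.
have nz x : z + cis x *: b != 0.
  rewrite -enorm_pos lt_neqAle enorm_ge0 andbT eq_sym.
  rewrite -sqrf_eq0 E mulf_neq0// ?gt_eqF// exprn_gt0//.
have lnE x : ln (enorm (z + cis x *: b)) = ln m + ln (1 + y x) / 2.
  have e0 : 0 < enorm (z + cis x *: b) by rewrite enorm_pos.
  have : ln (enorm (z + cis x *: b) ^+ 2) = ln (m ^+ 2 * (1 + y x)) by rewrite E.
  rewrite lnM ?posrE ?exprn_gt0// !lnXn// !(mulr2n (ln _)); lra.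
(* The second order expansion of the logarithm is a trigonometric polynomial: an explicit constant
   plus Re q with q(0) = 0, of mean zero. *)
pose p x := y x - y x ^+ 2 / 2.
pose q : {poly C} := ((2 / m ^+ 2 - 2 * B ^+ 2 / m ^+ 4)%:C%C * k)%:P * 'X
   - ((m ^+ 4)^-1%:C%C * k ^+ 2)%:P * 'X^2.
have pE x : p x = (B ^+ 2 / m ^+ 2 - herm2 z b / m ^+ 4 - B ^+ 4 / (2 * m ^+ 4)) +
    complex.Re q.[cis x * 1].
  rewrite /p /y /q hornerD hornerN 2!hornerM !hornerC hornerX hornerXn mulr1 -k2 cabs_sqr.
  have := cos2Dsin2 x; rewrite /cis; set c := cos x; set s := sin x => cs.
  case: (k) => u v /=.
  have -> : u ^+ 2 + v ^+ 2 = (u ^+ 2 + v ^+ 2) * (c ^+ 2 + s ^+ 2) by rewrite cs mulr1.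
  have mn : m != 0 by rewrite gt_eqF.
  field.
  exact: mn.
have bp : bmeas p.
  rewrite (funext pE).
  by apply: bmeasD; [exact: bmeas_cst|exact: bmeas_Re_poly].
have rp : rmean p = B ^+ 2 / m ^+ 2 - herm2 z b / m ^+ 4 - B ^+ 4 / (2 * m ^+ 4).
  rewrite (funext pE).
  rewrite rmeanD; [|exact: bmeas_cst|exact: bmeas_Re_poly].
  rewrite rmean_cst rmean_Re_poly hornerD hornerN 2!hornerM !hornerC hornerX hornerXn.
  by rewrite expr0n /= !mulr0 !subr0 addr0.
have cg : continuous (fun x : R => enorm (z + cis x *: b)).
  move=> x; apply/cvgrPdist_lt => e e0.
  have := circle_path_continuous z b x e0; apply: filterS => t.
  by apply: le_lt_trans; rewrite enorm_distC enorm_dist.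
have bl : bmeas (fun x => ln (enorm (z + cis x *: b))).
  apply: bmeas_continuous => x; apply: (@continuous_comp _ _ _ (fun x : R => enorm (z + cis x *: b)) (@ln R)); first exact: cg.
  by apply: continuous_ln; rewrite enorm_pos.
split=> //.
have est x : `|ln (enorm (z + cis x *: b)) - ln m - p x / 2| <= 27 * B ^+ 3 / m ^+ 3.
  rewrite lnE (_ : _ - _ = (ln (1 + y x) - p x) / 2); last by field.
  rewrite normrM [`|2^-1|]ger0_norm// ler_pdivrMr//.
  apply: le_trans (ln_taylor2 (yh x)) _.
  have : `|y x| ^+ 3 <= (3 * B / m) ^+ 3.
    by rewrite ler_pXn2r// nnegrE// divr_ge0 ?mulr_ge0// ltW.
  rewrite !exprMn exprVn; lra.
have bq : bmeas (fun x => ln (enorm (z + cis x *: b)) - ln m - p x / 2).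
  apply: bmeasB; first by apply: bmeasB => //; exact: bmeas_cst.
  by under eq_fun do rewrite mulrC; exact: bmeasZ.
have : `|rmean (fun x => ln (enorm (z + cis x *: b)) - ln m - p x / 2)| <= 27 * B ^+ 3 / m ^+ 3.
  rewrite ler_norml; apply/andP; split.
    rewrite -[leLHS]rmean_cst; apply: rmean_le => //; first exact: bmeas_cst.
    by move=> x _; have := est x; rewrite ler_norml => /andP[].
  rewrite -[leRHS]rmean_cst; apply: rmean_le => //; first exact: bmeas_cst.
  by move=> x _; have := est x; rewrite ler_norml => /andP[].
rewrite rmeanB; [|by apply: bmeasB => //; exact: bmeas_cst|by under eq_fun do rewrite mulrC; exact: bmeasZ].
rewrite rmeanB//; last exact: bmeas_cst.
rewrite rmean_cst (_ : rmean (fun x => p x / 2) = rmean p / 2); last first.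
  by under eq_fun do rewrite mulrC; rewrite rmeanZ// mulrC.
rewrite rp.
have small : `|B ^+ 4 / (2 * m ^+ 4) / 2| <= B ^+ 3 / m ^+ 3.
  have m4 : 0 < m ^+ 4 by rewrite exprn_gt0.
  have m3 : 0 < m ^+ 3 by rewrite exprn_gt0.
  have p2 : 0 <= B ^+ 4 by rewrite exprn_ge0.
  have p3 : 0 <= B ^+ 3 by rewrite exprn_ge0.
  rewrite ger0_norm; last by rewrite !divr_ge0// mulr_ge0// ltW.
  have -> : B ^+ 4 / (2 * m ^+ 4) / 2 = B ^+ 3 / m ^+ 3 * (B / m / 4).
    by field; rewrite gt_eqF.
  rewrite ler_piMr//; first by rewrite divr_ge0// ltW.
  by rewrite ler_pdivrMr// ler_pdivrMr//; move: Br; lra.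
set X := rmean _ - ln m; set Y := (_ - _ / m ^+ 4) => H.
rewrite (_ : X - Y / 2 = (X - (Y - B ^+ 4 / (2 * m ^+ 4)) / 2) - B ^+ 4 / (2 * m ^+ 4) / 2); last by field; rewrite gt_eqF.
rewrite (le_trans (ler_normB _ _))// (le_trans (lerD H small))// /K.
by rewrite le_eqVlt; apply/orP; left; apply/eqP; field; rewrite gt_eqF.
Qed.

End Circle.
End LogPsh.

Ltac lra_cleared :=
  repeat match goal with x := _ |- _ => clearbody x end;
  repeat match goal with H : ?T |- _ =>
    lazymatch T with
    | is_true (Order.le _ _) => fail
    | is_true (Order.lt _ _) => fail
    | @eq (Real.sort _) _ _ => fail
    | _ => clear H
    end
  end; lra.

Section ELog.
Context {R : realType}.

Definition elog (x : R) : \bar R := if x == 0 then -oo%E else (ln x)%:E.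

Lemma elog_lt (x c : R) : 0 <= x -> (elog x < c%:E)%E = (x < expR c).
Proof.
rewrite /elog le_eqVlt eq_sym => /predU1P[->|x0]; first by rewrite eqxx ltNyr expR_gt0.
by rewrite gt_eqF// lte_fin -[in RHS](lnK x0) ltr_expR.
Qed.

Lemma elog_le (x c : R) : 0 <= x -> (elog x <= c%:E)%E = (x <= expR c).
Proof.
rewrite /elog le_eqVlt eq_sym => /predU1P[->|x0].
  by rewrite eqxx leNye ltW// expR_gt0.
by rewrite gt_eqF// lee_fin -[in RHS](lnK x0) ler_expR.
Qed.

Lemma elog_mono (x y : R) : 0 <= x -> x <= y -> (elog x <= elog y)%E.
Proof.
move=> x0 xy; apply: lee_realP => c; rewrite elog_lt ?(le_trans x0 xy)// => yc.
by rewrite elog_le// (le_trans xy)// ltW.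
Qed.

Lemma elog_gt0 (x : R) : 0 < x -> elog x = (ln x)%:E.
Proof. by move=> x0; rewrite /elog gt_eqF. Qed.

Variable n : nat.
Local Notation C := R[i].
Local Notation Cn := 'rV[C]_n.
Implicit Types (Om : set Cn) (u : Cn -> \bar R) (z a b : Cn).

(** Off the pole the quadratic term of [ln_circle] is nonnegative and the cubic error is absorbed by
    [e] times the square; at the pole the value -oo leaves nothing to prove. Dividing by [D] makes
    the function nonpositive. *)
Lemma psh_neg_log Om a (D : R) : open Om -> 0 < D -> (forall z, Om z -> enorm (z - a) <= D) ->
  psh_neg Om (fun z => elog (enorm (z - a) / D)).
Proof.
move=> oO D0 aD.
have q0 z : 0 <= enorm (z - a) / D by rewrite divr_ge0 ?enorm_ge0// ltW.
have u0 z : Om z -> (elog (enorm (z - a) / D) <= 0)%E.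
  by move=> /aD zD; rewrite elog_le// expR0 ler_pdivrMr// mul1r.
split=> //; apply: lpsh_psh => //; split.
  apply: usc_onP => [z /u0 zu|z c _]; first by rewrite (le_lt_trans zu)// ltry.
  rewrite elog_lt// ltr_pdivrMr// => zc; exists (expR c * D - enorm (z - a)).
    by rewrite subr_gt0.
  move=> w wz _; rewrite elog_lt// ltr_pdivrMr//.
  by have := enorm_triangle z w a; lra.
move=> z _ e e0; have [->|za] := eqVneq z a.
  by exists 1 => // b _; rewrite subrr enorm0 mul0r /elog eqxx leNye.
have za0 : z - a != 0 by rewrite subr_eq0.
have [K [r [K0 r0 hK]]] := ln_circle za0.
have K1 : 0 < K + 1 by rewrite ltr_wpDl.
exists (Num.min r (e / (K + 1))); first by rewrite lt_min r0 divr_gt0.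
move=> b; rewrite lt_min ltr_pdivlMr// => /andP[br bK].
have [bl nz H] := hK b br; set m := enorm (z - a) in H *; set B := enorm b in bK H *.
have m0 : 0 < m by rewrite enorm_pos.
have -> : lmean (fun z => elog (enorm (z - a) / D)) z b =
    (rmean (fun x => ln (enorm (z - a + cis x *: b)) - ln D))%:E.
  rewrite -cmean_fin; last by apply: bmeasB => //; exact: bmeas_cst.
  apply: eq_cmean => x _; rewrite /= addrAC.
  have p : 0 < enorm (z - a + cis x *: b) by rewrite enorm_pos.
  by rewrite elog_gt0 ?divr_gt0// ln_div ?posrE.
rewrite rmeanB ?rmean_cst//; last exact: bmeas_cst.
rewrite elog_gt0 ?divr_gt0// ln_div ?posrE// -EFinD lee_fin.
have bes : 0 <= B ^+ 2 / m ^+ 2 - herm2 (z - a) b / m ^+ 4.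
  rewrite subr_ge0 ler_pdivrMr ?exprn_gt0//.
  have -> : B ^+ 2 / m ^+ 2 * m ^+ 4 = B ^+ 2 * m ^+ 2 by field; rewrite gt_eqF.
  by rewrite /herm2 (hdotC _ b) (hdotC _ ('i%C *: b)); exact: hdot_bessel.
have B0 : 0 <= B by exact: enorm_ge0.
have : K * B ^+ 3 <= e * B ^+ 2.
  have -> : K * B ^+ 3 = (K * B) * B ^+ 2 by ring.
  rewrite ler_wpM2r ?sqr_ge0//; move: bK; rewrite mulrDr mulr1; nra.
move: H; rewrite ler_norml => /andP[]; set X := rmean _; set Y := (_ - _ / m ^+ 4) in bes *.
lra.
Qed.

(** The equality case of Cauchy-Schwarz; it expresses that the logarithm is harmonic on punctured
    complex lines through its pole. *)
Lemma herm2_radial (t s : C) z : herm2 (t *: z) (s *: z) =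
  (cabs t * enorm z) ^+ 2 * (cabs s * enorm z) ^+ 2.
Proof.
have E (c d : C) : hdot (c *: z) (d *: z) = complex.Re (c^*%C * d) * enorm z ^+ 2.
  rewrite enorm_hdot /hdot mulr_sumr; apply: eq_bigr => j _; rewrite !mxE.
  by case: (z 0 j) c d => a b [c1 c2] [d1 d2] /=; ring.
rewrite /herm2 scalerA !E !exprMn !cabs_sqr; case: t s => a b [c d] /=; ring.
Qed.

End ELog.

Section LogPole.
Context {R : realType} {n : nat}.
Hypothesis n0 : (0 < n)%N.
Local Notation C := R[i].
Local Notation Cn := 'rV[C]_n.
Implicit Types (Om : set Cn) (u : Cn -> \bar R) (z a b : Cn).

Definition evec : Cn := delta_mx 0 (Ordinal n0).

Lemma enorm_evec : enorm evec = 1.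
Proof.
rewrite /enorm (bigD1 (Ordinal n0))//= big1 ?addr0.
  by rewrite mxE !eqxx/= expr1n expr0n addr0 sqrtr1.
by move=> j /negPf jn; rewrite mxE jn andbF /= expr0n addr0.
Qed.

Lemma log_poleP u a : log_pole u a -> exists (c r : R), 0 < r /\
  forall z, z != a -> enorm (z - a) < r -> (u z <= (ln (enorm (z - a)) + c)%:E)%E.
Proof.
move=> [c /nbhs_enormP[r r0 h]]; exists c, r; split=> // z za zr.
exact: h zr za.
Qed.

(** The punctured bound is silent at [a] itself, but the submean inequality on circles of radius [s]
    around [a] gives u a <= ln s + c for all small [s]. *)
Lemma log_pole_center Om u a : open Om -> psh Om u -> Om a -> log_pole u a -> u a = -oo%E.
Proof.
move=> oO pu Oa /log_poleP[c [r [r0 h]]]; have [r' r0' h'] := open_near oO Oa.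
apply/eqP; rewrite -leeNy_eq; apply: lee_realP => d _.
pose s := Num.min (Num.min r r' / 2) (expR (d - c)).
have m0 : 0 < Num.min r r' by rewrite lt_min r0.
have s0 : 0 < s by rewrite lt_min expR_gt0 divr_gt0.
have [sr sr' se] : [/\ s < r, s < r' & s <= expR (d - c)].
  have h1 : s <= Num.min r r' / 2 by rewrite ge_min lexx.
  have h2 : Num.min r r' <= r by rewrite ge_min lexx.
  have h3 : Num.min r r' <= r' by rewrite ge_min lexx orbT.
  have h4 : s <= expR (d - c) by rewrite ge_min lexx orbT.
  by split; lra.
pose b : Cn := (s%:C)%C *: evec.
have bs : enorm b = s by rewrite enormZ enorm_evec mulr1 cabsR gtr0_norm.
have Ob (t : C) : cabs t <= 1 -> Om (a + t *: b).
  move=> t1; apply: h'; rewrite addrAC subrr add0r enormZ bs.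
  by rewrite (le_lt_trans _ sr')// ler_piMl// ltW.
have Oc x : Om (a + cis x *: b) by apply: Ob; rewrite cabs_cis.
apply: le_trans (psh_submean pu Ob) _; rewrite -[leRHS]cmean_cst.
apply: cmean_le; first exact: usc_circle_measurable pu.1 Oc.
  exact: measurable_cst.
move=> x _; have e : a + cis x *: b - a = cis x *: b by rewrite addrAC subrr add0r.
have nn : a + cis x *: b != a.
  by rewrite -subr_eq0 e -enorm_eq0 enorm_cisZ bs gt_eqF.
apply: le_trans (h _ nn _) _; rewrite e enorm_cisZ bs// lee_fin.
by rewrite -lerBrDr -(expRK (d - c)) ler_ln ?posrE ?expR_gt0.
Qed.

(* Maximum principle on the punctured disc of the complex line through [a] and
   [z], for [u] minus a slightly weaker multiple of the logarithm. *)
Lemma log_pole_bound Om u a (r : R) : open Om -> psh Om u ->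
  (forall z, Om z -> (u z <= 0)%E) -> log_pole u a -> 0 < r ->
  (forall w, enorm (w - a) < r -> Om w) ->
  forall z, enorm (z - a) < r -> (u z <= elog (enorm (z - a) / r))%E.
Proof.
move=> oO pu u0 lp r0 rO z zr.
have [->|za] := eqVneq z a.
  rewrite (log_pole_center oO pu _ lp) ?leNye//.
  by apply: rO; rewrite subrr enorm0.
have s0 : 0 < enorm (z - a) by rewrite enorm_pos subr_eq0.
set s := enorm (z - a) in s0 zr *; rewrite elog_gt0 ?divr_gt0//.
rewrite leNgt; apply/negP => lnu.
have Oz : Om z by exact: rO.
case Euz : (u z) lnu (u0 z Oz) => [x0||] //; rewrite lte_fin lee_fin => lnx0 x00.
(* The bound is assumed to fail at [z]. A level strictly between the two values gives a radius [r']
   slightly below [r] with ln (s / r') = c, so the bound still fails for the smaller disc, whose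
   closure lies in [Om]. *)
pose c := (x0 + ln (s / r)) / 2.
have [cx lc] : c < x0 /\ ln (s / r) < c by rewrite /c; split; lra.
have c0 : c < 0 by lra.
pose r' := s * expR (- c).
have r'0 : 0 < r' by rewrite mulr_gt0// expR_gt0.
have r'r : r' < r.
  have : expR (ln (s / r)) < expR c by rewrite ltr_expR.
  rewrite lnK ?posrE ?divr_gt0// ltr_pdivrMr// /r' => h.
  by rewrite expRN ltr_pdivrMr ?expR_gt0// mulrC.
have lnr' : ln r' = ln s - c by rewrite lnM ?posrE ?expR_gt0// expRK.
pose T := expR (- c).
have T1 : 1 < T by rewrite expR_gt1 oppr_gt0.
have T0 : 0 < T by exact: lt_trans T1.
(* The logarithm is subtracted with weight 1 - e, so that the difference still tends to -oo at the
   pole; at t = 1 this costs at most (x0 - c) / 2. *)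
pose e := Num.min (1 / 2) ((x0 - c) / (- (2 * c))).
have e0 : 0 < e by rewrite lt_min divr_gt0//= divr_gt0 ?subr_gt0//; lra.
have e1 : e <= 1 / 2 by rewrite ge_min lexx.
have ec : - (e * c) <= (x0 - c) / 2.
  have : e <= (x0 - c) / (- (2 * c)) by rewrite ge_min lexx orbT.
  by rewrite ler_pdivlMr; lra.
pose g := (x0 - c) / 4.
have g0 : 0 < g by rewrite divr_gt0// subr_gt0.
(* The weight of |t|^2, which makes [P] strictly subharmonic and adds at most g / 2 on the
   annulus. *)
pose h := g / (2 * T ^+ 2).
have TT0 : 0 < T ^+ 2 by rewrite exprn_gt0.
have h0 : 0 < h by rewrite divr_gt0// mulr_gt0.
have hT : h * T ^+ 2 = g / 2 by rewrite /h; field; rewrite gt_eqF.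
have [c1 [d [d0 ud]]] := log_poleP lp.
pose la := Num.min (Num.min ((g - c1 - ln r' * (1 - e)) / e) (ln (d / 2))) (ln s - 1).
have [la1 la2 la3] : [/\ e * la + c1 + (1 - e) * ln r' <= g, la <= ln (d / 2) & la <= ln s - 1].
  have h1 : la <= (g - c1 - ln r' * (1 - e)) / e by rewrite !ge_min lexx.
  have h2 : la <= ln (d / 2) by rewrite !ge_min lexx orbT.
  have h3 : la <= ln s - 1 by rewrite !ge_min lexx !orbT.
  by split=> //; move: h1; rewrite ler_pdivlMr// => h1; lra_cleared.
pose tau := expR la / s.
have tau0 : 0 < tau by rewrite divr_gt0// expR_gt0.
have taus : tau * s = expR la by rewrite /tau divfK// gt_eqF.
have tau1 : tau < 1.
  rewrite ltr_pdivrMr// mul1r -[X in _ < X](lnK s0) ltr_expR; lra_cleared.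
pose j := (Num.trunc (`|(1 - e) * (ln r' - la)| + g)).+1.
have jg : (1 - e) * (ln r' - la) + g < j%:R.
  have := truncn_itv (addr_ge0 (normr_ge0 ((1 - e) * (ln r' - la))) (ltW g0)).
  move=> /andP[_]; apply: le_lt_trans; rewrite lerD2r; exact: ler_norm.
pose v := z - a.
have v0 : v != 0 by rewrite subr_eq0.
pose gg (t : C) := trunc Om u j (a + t *: v).
(* [P] is at least 2 g at t = 1, the point [z], and below 2 g on both boundary circles of the
   annulus, so its maximum is interior. The level [j] is large enough for the truncation floor not
   to spoil the inner circle. *)
pose P (t : C) := gg t - (1 - e) * (ln (enorm (t *: v)) - ln r') + h * cabs t ^+ 2.
have nv (t : C) : enorm (t *: v) = cabs t * s by rewrite enormZ.
have OT (t : C) : cabs t <= T -> Om (a + t *: v).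
  move=> tT; apply: rO; rewrite addrAC subrr add0r nv (le_lt_trans _ r'r)//.
  by rewrite /r' mulrC ler_wpM2l// ltW.
have gl0 t : gg t <= 0 by exact: trunc_le0.
have P1 : 2 * g <= P 1.
  rewrite /P nv cabs1 mul1r expr1n mulr1 lnr'.
  have : x0 <= gg 1.
    by rewrite -lee_fin truncE// scale1r addrC subrK ?Euz ?le_max ?lexx.
  by rewrite /g; lra_cleared.
have PT t : cabs t = T -> P t < 2 * g.
  move=> tT; rewrite /P nv tT hT (_ : T * s = r') ?subrr ?mulr0 ?subr0; last exact: mulrC.
  by have := gl0 t; lra_cleared.
have Ptau t : cabs t = tau -> P t < 2 * g.
  move=> tt; rewrite /P nv tt taus expRK.
  have ht : h * tau ^+ 2 <= g / 2.
    rewrite -hT ler_pM2l// ler_pXn2r// ?nnegrE ?ltW//; exact: lt_trans T1.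
  have Oat : Om (a + t *: v) by apply: OT; rewrite tt ltW// (lt_trans tau1).
  have : gg t <= Num.max (la + c1) (- j%:R).
    rewrite -lee_fin truncE// EFin_max ge_max !le_max; apply/andP; split; last first.
      by rewrite lexx orbT.
    apply/orP; left; apply: le_trans (ud _ _ _) _.
    - by rewrite -subr_eq0 addrAC subrr add0r -enorm_eq0 nv tt taus gt_eqF// expR_gt0.
    - rewrite addrAC subrr add0r nv tt taus.
      apply: (@le_lt_trans _ _ (d / 2)); last by lra_cleared.
      by rewrite -[leRHS]lnK ?posrE ?divr_gt0// ler_expR.
    - by rewrite addrAC subrr add0r nv tt taus expRK lee_fin.
  by rewrite le_max => /orP[] H; lra_cleared.
have cA : compact [set t : C | tau <= cabs t /\ cabs t <= T].
  apply: (@closed_bounded_compactC _ _ T) => [|t []//].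
  apply: (@closedI _ (cabs @^-1` [set x | tau <= x]) (cabs @^-1` [set x | x <= T])).
    by apply: closed_comp => [t _|]; [exact: continuous_cabs|exact: closed_ge].
  by apply: closed_comp => [t _|]; [exact: continuous_cabs|exact: closed_le].
have [|t k [t1 t2] Pk|t [t1 t2] tmax] := @usc_max _ _ _ P cA.
- by exists 1; rewrite /= cabs1; split; exact: ltW.
- pose F (t : C) := - (1 - e) * (ln (cabs t * s) - ln r') + h * cabs t ^+ 2.
  have PE y : P y = gg y + F y by rewrite /P /F nv; ring.
  have cF : {for cabs t, continuous (fun y : R => (- (1 - e) * (ln (y * s) - ln r') + h * y ^+ 2 : R))}.
    have ts0 : 0 < cabs t by exact: lt_le_trans t1.
    have cl : {for cabs t, continuous (fun y : R => ln (y * s))}.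
      apply: (@continuous_comp _ _ _ (fun y : R => y * s) (@ln R)); first exact: mulrr_continuous.
      by apply: continuous_ln; rewrite mulr_gt0.
    apply: cvgD; last first.
      by apply: cvgM; [exact: cvg_cst|apply: (@cvgM _ _ _ _ id id); exact: cvg_id].
    apply: cvgM; first exact: cvg_cst.
    apply: cvgB; last exact: cvg_cst.
    exact: cl.
  pose q := (k - P t) / 2.
  have q0 : 0 < q by rewrite divr_gt0// subr_gt0.
  have cF' : {for t, continuous F} by apply: continuous_comp cF; exact: continuous_cabs.
  have /nbhs_enormP[p p0 hp] : \forall y' \near a + t *: v, trunc Om u j y' < gg t + q.
    by apply: trunc_usc; rewrite ?ltrDl//; [exact: pu.1|exact: OT].
  have nF : \forall y \near t, F y < F t + q.
    move: cF' => /cvgrPdist_lt/(_ _ q0); apply: filterS => y.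
    by rewrite ltr_norml => /andP[]; lra_cleared.
  have nt : \forall y \near t, cabs (y - t) < p / s.
    by apply/nbhs_cabsP; exists (p / s) => //; exact: divr_gt0.
  near=> y => _; rewrite PE.
  have y1 : gg y < gg t + q.
    apply: hp; rewrite opprD addrACA subrr add0r -scalerBl nv -ltr_pdivlMr//.
    by near: y.
  have y2 : F y < F t + q by near: y.
  have : k = P t + 2 * q by rewrite /q; field.
  by rewrite PE; lra_cleared.
have Pt : 2 * g <= P t.
  by apply: le_trans P1 (tmax _ _); rewrite /= cabs1; split; exact: ltW.
have {}t1 : tau < cabs t.
  by rewrite lt_neqAle t1 andbT; apply/eqP => /esym/Ptau; lra_cleared.
have {}t2 : cabs t < T.
  by rewrite lt_neqAle t2 andbT; apply/eqP => /PT; lra_cleared.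
have tv0 : t *: v != 0 by rewrite -enorm_pos nv mulr_gt0// (lt_trans tau0).
have [K [p [K0 p0 hK]]] := ln_circle tv0.
have e20 : 0 < h / (4 * s ^+ 2) by rewrite divr_gt0// mulr_gt0// exprn_gt0.
have [p' p'0 hp'] := @trunc_near_submean _ _ Om u u0 j _ oO (psh_lpsh oO pu) (OT t (ltW t2)) _ e20.
have K1 : 0 < (K + 1) * s ^+ 3 by rewrite mulr_gt0 ?exprn_gt0// ltr_wpDl.
pose m := Num.min (Num.min (p / s) (p' / s)) (Num.min (Num.min (cabs t - tau) (T - cabs t)) (h / 4 / ((K + 1) * s ^+ 3))).
have m0 : 0 < m.
  rewrite !lt_min !subr_gt0 t1 t2 (divr_gt0 p0 s0) (divr_gt0 p'0 s0) /=.
  by rewrite divr_gt0// divr_gt0.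
pose o := m / 2.
have o0 : 0 < o by rewrite divr_gt0.
have [ o1 o2 o3 o4 o5] : [/\ o * s < p, o * s < p', o <= cabs t - tau, o <= T - cabs t &
    o * ((K + 1) * s ^+ 3) <= h / 4].
  have om : o < m by rewrite /o; lra_cleared.
  have h1 : m <= p / s by rewrite !ge_min lexx.
  have h2 : m <= p' / s by rewrite !ge_min lexx !orbT.
  have h3 : m <= cabs t - tau by rewrite !ge_min lexx !orbT.
  have h4 : m <= T - cabs t by rewrite !ge_min lexx !orbT.
  have h5 : m <= h / 4 / ((K + 1) * s ^+ 3) by rewrite !ge_min lexx !orbT.
  split; last (by rewrite -ler_pdivlMr// (le_trans _ h5)// ltW).
  - by rewrite -ltr_pdivlMr// (lt_le_trans om).
  - by rewrite -ltr_pdivlMr// (lt_le_trans om).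
  - by rewrite (le_trans _ h3)// ltW.
  - by rewrite (le_trans _ h4)// ltW.
pose si : C := (o%:C)%C.
have cs : cabs si = o by rewrite cabsR gtr0_norm.
have b1 : enorm (si *: v) = o * s by rewrite nv cs.
have [bl nz] := hK (si *: v) ltac:(by rewrite b1).
rewrite herm2_radial b1 cs => Hl.
have [bg] := hp' (si *: v) ltac:(by rewrite b1); rewrite b1 => Hg.
have bc := bmeas_cabs_sqr t si; have mc := rmean_cabs_sqr t si.
have circ x : cabs (cis x * si) = o by rewrite cabsM cabs_cis mul1r.
have inA x : tau <= cabs (t + cis x * si) /\ cabs (t + cis x * si) <= T.
  have := cabsD t (cis x * si); have := cabsD (t + cis x * si) (- (cis x * si)).
  by rewrite addrK cabsN circ; clear -o3 o4; split; lra.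
have Pmax x : P (t + cis x * si) <= P t by exact: (tmax _ (inA x)).
have PE x : P (t + cis x * si) = trunc Om u j (a + t *: v + cis x *: (si *: v)) -
    (1 - e) * ln (enorm (t *: v + cis x *: (si *: v))) + (1 - e) * ln r' +
    h * cabs (t + cis x * si) ^+ 2.
  by rewrite /P /gg scalerDl !scalerA !addrA mulrBr opprB [X in X + _]addrA addrAC.
have : rmean (fun x => P (t + cis x * si)) <= P t.
  rewrite -[leRHS]rmean_cst; apply: rmean_le => //; last exact: bmeas_cst.
  rewrite (funext PE); apply: bmeasD; last exact: bmeasZ.
  apply: bmeasD; last exact: bmeas_cst.
  by apply: bmeasB => //; exact: bmeasZ.
rewrite (funext PE) rmeanD; last 2 first.
- by apply: bmeasD; [apply: bmeasB => //; exact: bmeasZ|exact: bmeas_cst].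
- exact: bmeasZ.
rewrite rmeanD; [|by apply: bmeasB => //; exact: bmeasZ|exact: bmeas_cst].
rewrite rmeanB//; last exact: bmeasZ.
rewrite (rmeanZ (1 - e) bl) (rmeanZ h bc) rmean_cst mc cs.
move: Hl; rewrite nv; set X := rmean (fun x => ln _); set Y := rmean _ in Hg *.
have tn : cabs t != 0 by rewrite gt_eqF// (lt_trans tau0).
have sn : s != 0 by rewrite gt_eqF.
(* Along the radial line the second order term of the logarithm cancels. What is left are two errors
   of at most h/4 o^2 each, against the gain h o^2 of |t|^2. *)
have -> : (o * s) ^+ 2 / (cabs t * s) ^+ 2 -
    (cabs t * s) ^+ 2 * (o * s) ^+ 2 / (cabs t * s) ^+ 4 = 0.
  by field; rewrite sn tn.
rewrite mul0r subr0 ler_norml => /andP[_ Hl].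
rewrite /P -/(gg t) nv => Hm.
have Hs : h / (4 * s ^+ 2) * (o * s) ^+ 2 = h / 4 * o ^+ 2 by field.
move: Hg; rewrite Hs => Hg.
have HK : K * (o * s) ^+ 3 <= h / 4 * o ^+ 2.
  have -> : K * (o * s) ^+ 3 = o * (K * s ^+ 3) * o ^+ 2 by ring.
  rewrite ler_wpM2r ?sqr_ge0// (le_trans _ o5)// ler_pM2l//.
  by rewrite ler_pM2r ?exprn_gt0// lerDl.
have ho : 0 < h * o ^+ 2 by rewrite mulr_gt0// exprn_gt0.
have e1' : 0 <= 1 - e by clear -e1; lra.
have : (1 - e) * (X - ln (cabs t * s)) <= h / 4 * o ^+ 2.
  apply: le_trans (_ : (1 - e) * (K * (o * s) ^+ 3) <= _).
    by rewrite ler_wpM2l.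
  apply: le_trans (ler_wpM2l e1' HK) _.
  apply: ler_piMl; last by rewrite gerBl ltW.
  by rewrite mulr_ge0 ?sqr_ge0// divr_ge0// ltW.
have ggE : gg t = trunc Om u j (a + t *: v) by [].
move: Hm Hg; rewrite -!ggE; clear -ho; lra.
Unshelve. all: by end_near. Qed.

End LogPole.

(** * Barriers and Green functions *)

Section Barrier.
Context {R : realType} {n : nat}.
Local Notation C := R[i].
Local Notation Cn := 'rV[C]_n.
Implicit Types (u v : Cn -> \bar R) (z w a p : Cn).

(** Constant sequences qualify ([icvg_cst]), so results on sequences also yield those on a single
    tuple. *)
Definition icvg (Om : set Cn) M (T : nat -> M.-tuple Cn) (L : M.-tuple Cn) :=
  [/\ forall k j, Om (tnth (T k) j), forall j, Om (tnth L j) &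
   forall r : R, 0 < r -> exists K, forall k, (K <= k)%N -> forall j : 'I_M,
     enorm (tnth (T k) j - tnth L j) < r].

Lemma eventually_ord (M : nat) (P : 'I_M -> nat -> Prop) :
  (forall j, exists K, forall k, (K <= k)%N -> P j k) ->
  exists K, forall k, (K <= k)%N -> forall j, P j k.
Proof.
move=> h; pose f j := sval (cid (h j)); exists (\max_j f j) => k fk j.
by rewrite /f in fk; apply: (svalP (cid (h j))); apply: leq_trans (leq_bigmax j) fk.
Qed.

Lemma interior_cvg_icvg (Om : set Cn) M (T : nat -> M.-tuple Cn) L :
  interior_cvg Om T L -> icvg Om T L.
Proof.
move=> [_ TO LO TL]; split.
- by move=> k j; apply: (TO k); exact: mem_tnth.
- by move=> j; apply: LO; exact: mem_tnth.
- move=> r r0; apply: eventually_ord => j.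
  have nb : nbhs (tnth L j) [set w | enorm (w - tnth L j) < r].
    by apply/nbhs_enormP; exists r.
  have [K _ hK] := TL j _ nb.
  by exists K => k Kk; exact: hK.
Qed.

Lemma icvg_cst (Om : set Cn) M (T : M.-tuple Cn) : (forall j, Om (tnth T j)) ->
  icvg Om (fun=> T) T.
Proof.
by move=> TO; split=> // r r0; exists 0%N => k _ j; rewrite subrr enorm0.
Qed.

Lemma closed_ball_compact p (r : R) : compact [set z : Cn | enorm (z - p) <= r].
Proof.
apply: (@closed_bounded_compact _ _ _ (r + enorm p)).
  apply: closed_enormP => y /negP; rewrite -ltNge => yd.
  exists (enorm (y - p) - r); rewrite ?subr_gt0// => w wy /=; apply/negP; rewrite -ltNge.
  by have := enorm_triangle w y p; rewrite (enorm_distC y w); lra.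
by move=> y /= yd; have := enormD (y - p) p; rewrite subrK; lra.
Qed.

Lemma min_pos_ord (M : nat) (f : 'I_M -> R) : (forall j, 0 < f j) ->
  exists2 m : R, 0 < m & forall j, m <= f j.
Proof.
move=> f0; exists (\big[Order.min/1]_j f j); first by apply/bigmin_gtP.
by move=> j; exact: bigmin_le.
Qed.

Variables (Om : set Cn) (D : R) (rho : Cn -> R).
Hypotheses (oO : open Om) (D0 : 0 < D)
  (OD : forall z w, Om z -> Om w -> enorm (z - w) <= D)
  (rhoc : forall z (e : R), Om z -> 0 < e -> exists2 r : R, 0 < r &
     forall w, enorm (w - z) < r -> `|rho w - rho z| < e)
  (prho : psh Om (EFin \o rho)) (rho0 : forall z, Om z -> rho z < 0).

Lemma rho_max (K : set Cn) : compact K -> K `<=` Om -> exists2 m : R, m < 0 &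
  forall z, K z -> rho z <= m.
Proof.
move=> cK KO; have [[z0 Kz0]|K0] := pselect (K !=set0); last first.
  by exists (-1); [rewrite oppr_lt0|move=> z Kz; exfalso; apply: K0; exists z].
have [|x c Kx xc|x Kx xmax] := @usc_max _ _ K rho cK.
- by exists z0.
- have [r r0 h] := rhoc (KO _ Kx) (e := c - rho x) ltac:(by rewrite subr_gt0).
  apply/nbhs_enormP; exists r => // w /h; rewrite ltr_norml => /andP[_ H] _; lra.
by exists (rho x) => //; exact: rho0 (KO _ Kx).
Qed.

Lemma psh_neg_rho (A : R) : 0 <= A -> psh_neg Om (fun z => (A * rho z)%:E).
Proof.
rewrite le_eqVlt => /predU1P[<-|A0].
  by under eq_fun do rewrite mul0r; exact: psh_neg_cst.
apply: (@psh_neg_scale _ _ Om (EFin \o rho) A A0); split=> // z /rho0 /ltW.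
by rewrite /= lee_fin.
Qed.

Lemma pole_barrier p (r0 : R) : Om p -> 0 < r0 -> exists r A : R, [/\ 0 < r, 0 <= A &
  forall a, Om a -> enorm (a - p) < r -> exists v, [/\ psh_neg Om v, log_pole v a,
    forall z, Om z -> (elog (enorm (z - a) / D) <= v z)%E &
    forall z, Om z -> r0 <= enorm (z - p) -> ((A * rho z)%:E <= v z)%E]].
Proof.
move=> Op r00; have [r1 r10 hr1] := open_near oO Op.
pose r := Num.min (r0 / 2) (r1 / 2).
have r_0 : 0 < r by rewrite lt_min !divr_gt0.
have [rr0 rr1] : r < r0 /\ r < r1.
  have h1 : r <= r0 / 2 by rewrite ge_min lexx.
  have h2 : r <= r1 / 2 by rewrite ge_min lexx orbT.
  by split; lra.
have BO z : enorm (z - p) <= r -> Om z by move=> zr; apply: hr1; lra.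
have [m m0 hm] := rho_max (@closed_ball_compact p r) BO.
(* On the shell r/2 < |z - p| < r the logarithm is at least ln (r / (4 D)), because [a] is within
   r/4 of [p]; since rho <= m < 0 there, this slope puts [A * rho] below it. *)
pose A := `|ln (r / (4 * D))| / (- m).
have A0 : 0 <= A by rewrite divr_ge0// oppr_ge0 ltW.
have q4 : 0 < r / 4 by rewrite divr_gt0.
exists (r / 4), A; split=> //.
move=> a Oa ap; pose l z := elog (enorm (z - a) / D).
have pl : psh_neg Om l by apply: psh_neg_log => // z Oz; exact: OD.
have pr := psh_neg_rho A0.
have pm := psh_neg_max pl pr.
pose v z := if enorm (z - p) < r then l z else maxe (l z) (A * rho z)%:E.
have shell z : r / 2 < enorm (z - p) -> enorm (z - p) < r -> ((A * rho z)%:E <= l z)%E.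
  move=> z1 z2; have za : r / 4 <= enorm (z - a).
    by have := enorm_triangle a z p; lra.
  apply: (@le_trans _ _ (ln (r / (4 * D)))%:E); last first.
    rewrite /l elog_gt0; last by rewrite divr_gt0// (lt_le_trans q4).
    rewrite lee_fin ler_ln ?posrE ?divr_gt0 ?mulr_gt0// ?(lt_le_trans q4)//.
    by rewrite invfM mulrA ler_pM2r// invr_gt0.
  rewrite lee_fin; apply: (@le_trans _ _ (A * m)).
    by rewrite ler_wpM2l// hm//= ltW.
  rewrite /A mulrAC -mulrA invrN mulrN divff ?lt_eqF// mulrN1.
  by rewrite lerNl -normrN ler_norm.
have v0 z : Om z -> (v z <= 0)%E.
  by move=> Oz; rewrite /v; case: ifP => _; [exact: pl.2|exact: pm.2].
have lv z : Om z -> (l z <= v z)%E.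
  by move=> Oz; rewrite /v; case: ifP => _ //; rewrite le_max lexx.
exists v; split=> //.
- split=> //; apply: psh_local => // z Oz; have [zr|zr] := ltP (enorm (z - p)) r.
    exists [set w | enorm (w - p) < r], l; split=> //.
    + apply: openP => w /= wr; exists (r - enorm (w - p)); rewrite ?subr_gt0//.
      by move=> y yw; have := enorm_triangle w y p; lra.
    + by move=> w /= /ltW; exact: BO.
    + by apply: psh_subset pl.1 => w /= /ltW; exact: BO.
    + by move=> w /= wr; rewrite /v wr.
  exists (Om `&` [set w | r / 2 < enorm (w - p)]), (fun z => maxe (l z) (A * rho z)%:E); split=> //.
  + apply: openI => //; apply: openP => w /= wr; exists (enorm (w - p) - r / 2); rewrite ?subr_gt0//.
    by move=> y yw; have := enorm_triangle y w p; rewrite (enorm_distC w y); lra.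
  + by split=> //=; lra.
  + exact: psh_subset pm.1.
  + move=> w [Ow /= w1]; rewrite /v; case: ifP => // w2.
    by apply/esym/max_idPl; exact: shell.
- exists (- ln D); apply/nbhs_enormP; exists (r - enorm (a - p)); first by lra.
  move=> w wa wna; have wr : enorm (w - p) < r by have := enorm_triangle a w p; lra.
  have w0 : 0 < enorm (w - a) by rewrite enorm_pos subr_eq0.
  by rewrite /v wr /l elog_gt0 ?divr_gt0// ln_div ?posrE.
- move=> z Oz zr; rewrite /v; case: ifP => [zr'|_]; first by exfalso; lra.
  by rewrite le_max lexx orbT.
Qed.

Definition green_family (T : seq Cn) : set (Cn -> \bar R) :=
  [set u | psh_neg Om u /\ forall a, a \in T -> log_pole u a].

Lemma log_pole_le u v a : (\forall z \near a^', (v z <= u z)%E) -> log_pole u a -> log_pole v a.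
Proof.
move=> vu [c uc]; exists c; near=> z.
by apply: (@le_trans _ _ (u z)); near: z.
Unshelve. all: by end_near. Qed.

Lemma near_punctured (P : Cn -> Prop) a (r : R) : 0 < r ->
  (forall z, enorm (z - a) < r -> z != a -> P z) -> \forall z \near a^', P z.
Proof.
by move=> r0 h; apply/nbhs_enormP; exists r => // z zr za; exact: h.
Qed.

(** A sum of one barrier for each pole. That [A] does not depend on [k] is the source of all
    uniformity in [k]; the logarithmic lower bound serves local integrability. *)
Lemma barrier M (T : nat -> M.-tuple Cn) L (r0 : R) : icvg Om T L -> 0 < r0 ->
  exists (A : R) (K : nat), 0 <= A /\ forall k, (K <= k)%N -> exists b,
    [/\ green_family (T k) b,
        forall z, Om z -> (\sum_(j < M) elog (enorm (z - tnth (T k) j) / D) <= b z)%E &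
        forall z, Om z -> (forall j, r0 <= enorm (z - tnth L j)) -> ((A * rho z)%:E <= b z)%E].
Proof.
move=> [TO LO TL] r00.
have h j := cid (pole_barrier (LO j) r00).
pose r j := sval (h j); have h1 j := cid (svalP (h j)).
pose A j := sval (h1 j); have h' j := svalP (h1 j).
have rp j : 0 < r j by have [] := h' j.
have Ap j : 0 <= A j by have [] := h' j.
have [m m0 rm] := min_pos_ord rp.
have [K hK] := TL m m0.
exists (\sum_j A j), K; split; first exact: sumr_ge0.
move=> k Kk.
have hv j : exists v, [/\ psh_neg Om v, log_pole v (tnth (T k) j),
    forall z, Om z -> (elog (enorm (z - tnth (T k) j) / D) <= v z)%E &
    forall z, Om z -> r0 <= enorm (z - tnth L j) -> ((A j * rho z)%:E <= v z)%E].
  have [_ _] := h' j; apply => //; exact: lt_le_trans (hK k Kk j) (rm j).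
pose v j := sval (cid (hv j)); have hv' j := svalP (cid (hv j)).
have v0 j z : Om z -> (v j z <= 0)%E by have [[_ +] _ _ _] := hv' j; apply.
exists (fun z => \sum_(j < M) v j z)%E; split.
- split; first by apply: psh_neg_sum => j; have [] := hv' j.
  move=> a /tnthP[j ->]; have [_ lp _ _] := hv' j; apply: log_pole_le lp.
  have [r1 r10 hr1] := open_near oO (TO k j).
  apply: (near_punctured r10) => z /hr1 Oz _; rewrite (bigD1 j)//=.
  by rewrite geeDl//; apply: sume_le0 => i _; exact: v0.
- by move=> z Oz; apply: lee_sum => j _; have [_ _ + _] := hv' j; apply.
- move=> z Oz zr; rewrite mulr_suml -sumEFin.
  by apply: lee_sum => j _; have [_ _ _] := hv' j; apply.
Qed.

End Barrier.

(** * Deforming competitors by polynomial maps that fix the poles *)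

Section Equicontinuity.
Context {R : realType} {n : nat}.
Local Notation C := R[i].
Local Notation Cn := 'rV[C]_n.
Implicit Types (u v : Cn -> \bar R) (z w a : Cn).

Lemma cabs_prod (J : Type) (r : seq J) (f : J -> C) :
  cabs (\prod_(j <- r) f j) = \prod_(j <- r) cabs (f j).
Proof. by apply: (big_morph (@cabs R)); [exact: cabsM|exact: cabs1]. Qed.

Lemma prod_coord_continuous (J : Type) (s : seq J) (T : J -> Cn) (i : J -> 'I_n) z (e : R) :
  0 < e -> exists2 r : R, 0 < r & forall w, enorm (w - z) < r ->
    cabs (\prod_(j <- s) (w - T j) 0 (i j) - \prod_(j <- s) (z - T j) 0 (i j)) < e.
Proof.
elim: s e => [|j s IH] e e0.
  by exists 1 => // w _; rewrite !big_nil subrr cabs0.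
set f := fun w => \prod_(j <- s) (w - T j) 0 (i j) in IH.
pose A := cabs (f z) + 1; pose B := cabs ((z - T j) 0 (i j)) + 1.
have A0 : 0 < A by rewrite ltr_wpDl ?cabs_ge0.
have B0 : 0 < B by rewrite ltr_wpDl ?cabs_ge0.
have e1 : 0 < Num.min 1 (e / (2 * B)) by rewrite lt_min ltr01 divr_gt0// mulr_gt0.
have [r r0 hr] := IH _ e1.
exists (Num.min r (e / (2 * A))); first by rewrite lt_min r0 divr_gt0// mulr_gt0.
move=> w; rewrite lt_min ltr_pdivlMr ?mulr_gt0// => /andP[/hr].
rewrite lt_min ltr_pdivlMr ?mulr_gt0// => /andP[f1 f2] wA.
rewrite !big_cons -/(f w) -/(f z).
have wz : cabs ((w - z) 0 (i j)) <= enorm (w - z) by exact: cabs_le_enorm.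
have -> : (w - T j) 0 (i j) * f w - (z - T j) 0 (i j) * f z =
    (w - z) 0 (i j) * f w + (z - T j) 0 (i j) * (f w - f z).
  by rewrite !mxE; ring.
rewrite (le_lt_trans (cabsD _ _))// !cabsM.
have fw : cabs (f w) <= A.
  by rewrite -(subrK (f z) (f w)) (le_trans (cabsD _ _))// /A addrC lerD2l ltW.
have h1 : cabs ((w - z) 0 (i j)) * cabs (f w) <= enorm (w - z) * A.
  by rewrite ler_pM ?cabs_ge0.
have h2 : cabs ((z - T j) 0 (i j)) * cabs (f w - f z) <= B * cabs (f w - f z).
  by rewrite ler_wpM2r ?cabs_ge0// lerDl.
lra.
Qed.

Lemma lteD_pos (x : \bar R) (c : R) : (x < c%:E)%E ->
  exists2 e : R, 0 < e & (x + e%:E < c%:E)%E.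
Proof.
case: x => [x||] // xc; last by exists 1.
rewrite lte_fin in xc; exists ((c - x) / 2); first by lra.
by rewrite -EFinD lte_fin; lra.
Qed.

Lemma green_ub (Om : set Cn) (T : seq Cn) u z :
  green_family Om T u -> (u z <= green Om T z)%E.
Proof. by move=> hu; apply: ereal_sup_ubound; exists u. Qed.

Lemma green_lub (Om : set Cn) (T : seq Cn) z (c : \bar R) :
  (forall u, green_family Om T u -> (u z <= c)%E) -> (green Om T z <= c)%E.
Proof. by move=> h; apply: ge_ereal_sup => _ [u hu <-]; exact: h. Qed.

Variables (Om : set Cn) (D : R) (rho : Cn -> R).
Hypotheses (oO : open Om) (D0 : 0 < D)
  (OD : forall z w, Om z -> Om w -> enorm (z - w) <= D)
  (rhoc : forall z (e : R), Om z -> 0 < e -> exists2 r : R, 0 < r &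
     forall w, enorm (w - z) < r -> `|rho w - rho z| < e)
  (prho : psh Om (EFin \o rho)) (rho0 : forall z, Om z -> rho z < 0)
  (rhos : forall c : R, c < 0 -> exists2 d : R, 0 < d &
     forall z, Om z -> rho z < c -> forall h, enorm h < d -> Om (z + h)).

Lemma rho_lt_open (c : R) : open [set z | Om z /\ rho z < c].
Proof.
apply: openP => z [Oz zc]; have [r r0 h] := open_near oO Oz.
have [s s0 k] := rhoc Oz (e := c - rho z) ltac:(by rewrite subr_gt0).
exists (Num.min r s); first by rewrite lt_min r0.
move=> w; rewrite lt_min => /andP[/h Ow /k]; rewrite ltr_norml => /andP[_ H].
by split=> //; lra.
Qed.

Lemma rho_gt_open (c : R) : open [set z | Om z /\ c < rho z].
Proof.
apply: openP => z [Oz zc]; have [r r0 h] := open_near oO Oz.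
have [s s0 k] := rhoc Oz (e := rho z - c) ltac:(by rewrite subr_gt0).
exists (Num.min r s); first by rewrite lt_min r0.
move=> w; rewrite lt_min => /andP[/h Ow /k]; rewrite ltr_norml => /andP[H _].
by split=> //; lra.
Qed.

Section Deform.
Variables (M : nat) (T : M.-tuple Cn) (i : 'I_M -> 'I_n) (wv : Cn).

(* With [i j] a coordinate in which a base point differs from the [j]-th pole,
   [deform] fixes the poles and moves the base point in the direction [wv]. *)
Definition Ppoly (y : Cn) : C := \prod_(j < M) (y - tnth T j) 0 (i j).
Definition deform (y : Cn) : Cn := y + Ppoly y *: wv.

Lemma deform_line a b : exists w p, forall t : C, deform (a + t *: b) = curve a b w p t.
Proof.
exists wv, (\prod_(j < M) (((a - tnth T j) 0 (i j))%:P + (b 0 (i j)) *: 'X)) => t.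
rewrite /deform /curve; congr (_ + _ *: _).
rewrite horner_prod; apply: eq_bigr => j _.
by rewrite !hornerE !mxE; ring.
Qed.

Lemma deform_continuous z (e : R) : 0 < e -> exists2 r : R, 0 < r &
  forall w, enorm (w - z) < r -> enorm (deform w - deform z) < e.
Proof.
move=> e0; have w1 : 0 < 2 * (enorm wv + 1) by rewrite mulr_gt0// ltr_wpDl// enorm_ge0.
have e1 : 0 < e / (2 * (enorm wv + 1)) by rewrite divr_gt0.
have [r r0 h] := prod_coord_continuous (index_enum 'I_M) (tnth T) i z e1.
exists (Num.min r (e / 2)); first by rewrite lt_min r0 divr_gt0.
move=> w; rewrite lt_min => /andP[/h H we].
rewrite /deform opprD addrACA -scalerBl (le_lt_trans (enormD _ _))// enormZ.
move: H; rewrite ltr_pdivlMr// -/(Ppoly w) -/(Ppoly z).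
set x := cabs _ => H; have x0 : 0 <= x by exact: cabs_ge0.
by have := enorm_ge0 wv; lra.
Qed.

Hypothesis TO : forall j, Om (tnth T j).
Let D1 := Num.max D 1.

Lemma Ppoly_le y : Om y -> cabs (Ppoly y) <= D1 ^+ M.
Proof.
move=> Oy; rewrite /Ppoly cabs_prod -[in leRHS](card_ord M) -prodr_const.
apply: ler_prod => j _; rewrite cabs_ge0/= (le_trans (cabs_le_enorm _ _))//.
by rewrite le_max OD.
Qed.

(** Vanishing to first order at each pole, so that [deform] changes distances to the pole by a
    bounded factor only. As [D1] is at least 1, the missing factor does no harm to the power
    [D1 ^+ M]. *)
Lemma Ppoly_le_pole y j : Om y -> cabs (Ppoly y) <= enorm (y - tnth T j) * D1 ^+ M.
Proof.
move=> Oy; rewrite /Ppoly cabs_prod (bigD1 j)//=.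
have D11 : 1 <= D1 by rewrite le_max lexx orbT.
apply: ler_pM; rewrite ?cabs_ge0 ?cabs_le_enorm//.
  by apply: prodr_ge0 => k _; exact: cabs_ge0.
rewrite -[in leRHS](card_ord M) -prodr_const.
rewrite [leRHS](bigD1 j)//= -[leLHS]mul1r ler_pM//.
  by apply: prodr_ge0 => k _; exact: cabs_ge0.
apply: ler_prod => k _; rewrite cabs_ge0/= (le_trans (cabs_le_enorm _ _))//.
by rewrite le_max OD.
Qed.

Variables (e c : R) (b : Cn -> \bar R) (d : R).
Hypotheses (e0 : 0 < e) (c0 : c < 0) (bF : green_family Om T b)
  (bc : forall z, Om z -> c < rho z -> (- e%:E <= b z)%E)
  (Tc : forall j, rho (tnth T j) < c / 2)
  (dO : forall z, Om z -> rho z < c / 2 -> forall h, enorm h < d -> Om (z + h))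
  (wd : D1 ^+ M * enorm wv < d) (w2 : D1 ^+ M * enorm wv <= 1 / 2).

(* The deformation fixes the poles, so composing a competitor with it gives a
   competitor again, once glued with the barrier near the boundary. *)
Lemma green_deform z : Om z -> rho z < c / 2 ->
  (green Om T (deform z) <= green Om T z + e%:E)%E.
Proof.
move=> Oz zc; apply: green_lub => u [[pu u0] up].
have DM0 : 0 <= D1 ^+ M by rewrite exprn_ge0// le_max ler01 orbT.
pose U := [set z | Om z /\ rho z < c / 2].
have oU : open U by exact: rho_lt_open.
have UO y : U y -> Om (deform y).
  move=> [Oy yc]; apply: dO => //; rewrite enormZ (le_lt_trans _ wd)//.
  by rewrite ler_wpM2r ?enorm_ge0// Ppoly_le.
have pud : psh_neg U (u \o deform).
  split; last by move=> y /UO /u0.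
  by apply: (psh_compose oO pu u0 UO deform_continuous); exact: deform_line.
have pude : psh_neg U (fun y => u (deform y) + (- e)%:E)%E.
  apply: (psh_neg_add pud); apply: psh_neg_cst.
  by rewrite lee_fin oppr_le0 ltW.
have pbU : psh_neg U b.
  by split; [apply: psh_subset bF.1.1 => y []|move=> y [Oy _]; exact: bF.1.2].
(* The two definitions agree where c < rho < c/2: there b >= - e, which dominates
   [u (deform y) - e], so the maximum is [b]. *)
pose v y := if `[< U y >] then maxe (u (deform y) + (- e)%:E)%E (b y) else b y.
have vU y : U y -> v y = maxe (u (deform y) + (- e)%:E)%E (b y).
  by move=> Uy; rewrite /v asboolT.
have v0 y : Om y -> (v y <= 0)%E.
  move=> Oy; have [Uy|Uy] := pselect (U y).
    by rewrite vU// ge_max (pude.2 y Uy)//= bF.1.2.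
  by rewrite /v asboolF//; exact: bF.1.2.
have vF : green_family Om T v.
  split; first split=> //.
    apply: psh_local => // y Oy; have [Uy|Uy] := pselect (U y).
      exists U, (fun y => maxe (u (deform y) + (- e)%:E)%E (b y)); split=> //.
      - by move=> x [].
      - exact: (psh_neg_max pude pbU).1.
    exists [set y | Om y /\ c < rho y], b; split.
    - exact: rho_gt_open.
    - split=> //; rewrite ltNge; apply/negP => yc'; apply: Uy; split=> //; apply: le_lt_trans yc' _; have := c0; lra.
    - by move=> x [].
    - by apply: psh_subset bF.1.1 => x [].
    - move=> x [Ox cx]; rewrite /v; case: asboolP => // Ux.
      apply/max_idPr; apply: le_trans (bc Ox cx).
      by rewrite EFinN geeDr//; exact: pud.2 Ux.
  move=> a /tnthP[j aE].
  have Oa : Om a by rewrite aE.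
  have Ua : U a by split=> //; rewrite aE.
  have aT : a \in (T : seq Cn) by rewrite aE mem_tnth.
  have [r1 r10 h1] := open_near oU Ua.
  have [cu [r2 [r20 h2]]] := log_poleP (up a aT).
  have [cb [r3 [r30 h3]]] := log_poleP (bF.2 a aT).
  exists (Num.max (cu + 1) cb).
  pose r := Num.min (Num.min r1 (r2 / 2)) r3.
  apply: (near_punctured (r := r)).
    by rewrite !lt_min r10 r30 divr_gt0.
  move=> y; rewrite !lt_min => /andP[/andP[/h1 Uy y2] y3] ya.
  have y0 : 0 < enorm (y - a) by rewrite enorm_pos subr_eq0.
  (* By [w2] the displacement is at most half the distance to the pole; the distance changes by a
     factor between 1/2 and 3/2, and the logarithm by at most 1 upwards. *)
  have da : enorm (deform y - y) <= enorm (y - a) / 2.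
    rewrite /deform addrAC subrr add0r enormZ.
    apply: (@le_trans _ _ (enorm (y - a) * D1 ^+ M * enorm wv)).
      by rewrite ler_wpM2r ?enorm_ge0// aE; exact: Ppoly_le_pole Uy.1.
    by rewrite -mulrA ler_pM2l// -[2^-1]mul1r.
  have l1 : enorm (deform y - a) <= 3 / 2 * enorm (y - a).
    by have := enorm_triangle y (deform y) a; lra.
  have l2 : enorm (y - a) / 2 <= enorm (deform y - a).
    by have := enorm_triangle (deform y) y a; rewrite (enorm_distC y (deform y)); lra.
  have l0 : 0 < enorm (deform y - a) by lra.
  rewrite vU// ge_max; apply/andP; split.
    apply: (@le_trans _ _ (u (deform y))).
      by rewrite geeDl// lee_fin oppr_le0 ltW.
    apply: (le_trans (h2 _ _ _)); first by rewrite -subr_eq0 -enorm_pos.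
      by apply: le_lt_trans l1 _; lra.
    rewrite lee_fin (@le_trans _ _ (ln (enorm (y - a)) + (cu + 1)))//; last first.
      by rewrite lerD2l le_max lexx.
    have : ln (enorm (deform y - a)) <= ln (enorm (y - a)) + 1.
      apply: (@le_trans _ _ (ln (expR 1 * enorm (y - a)))).
        rewrite ler_ln ?posrE ?mulr_gt0 ?expR_gt0// (le_trans l1)// ler_pM2r//.
        have := expR_ge1Dx (1 : R); lra.
      by rewrite lnM ?posrE ?expR_gt0// expRK addrC.
    lra.
  apply: (le_trans (h3 y ya y3)).
  by rewrite lee_fin lerD2l le_max lexx orbT.
have := green_ub z vF; rewrite vU; last by split.
by rewrite ge_max => /andP[H _]; rewrite -leeBlDr// -EFinN.
Qed.

End Deform.
End Equicontinuity.

(** * Uniform equicontinuity, bounds and plurisubharmonicity of Green functions *)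

Section GreenLimits.
Context {R : realType} {n : nat}.
Hypothesis n0 : (0 < n)%N.
Local Notation C := R[i].
Local Notation Cn := 'rV[C]_n.
Implicit Types (u v : Cn -> \bar R) (z w a : Cn).

Variables (Om : set Cn) (D : R) (rho : Cn -> R).
Hypotheses (oO : open Om) (D0 : 0 < D)
  (OD : forall z w, Om z -> Om w -> enorm (z - w) <= D)
  (rhoc : forall z (e : R), Om z -> 0 < e -> exists2 r : R, 0 < r &
     forall w, enorm (w - z) < r -> `|rho w - rho z| < e)
  (prho : psh Om (EFin \o rho)) (rho0 : forall z, Om z -> rho z < 0)
  (rhos : forall c : R, c < 0 -> exists2 d : R, 0 < d &
     forall z, Om z -> rho z < c -> forall h, enorm h < d -> Om (z + h)).

Lemma notin_tuple_dist M (L : M.-tuple Cn) z : z \notin L ->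
  exists2 d : R, 0 < d & forall j, d <= enorm (z - tnth L j).
Proof.
move=> zL; apply: min_pos_ord => j.
by rewrite enorm_pos subr_eq0; apply: contra zL => /eqP ->; exact: mem_tnth.
Qed.

Section Seq.
Variables (M : nat) (T : nat -> M.-tuple Cn) (L : M.-tuple Cn).
Hypothesis TL : icvg Om T L.
Local Notation G := (fun k => green Om (T k)).

(** The deformation is chosen to send [z] exactly to [w]; this asks for a lower bound of [Ppoly]
    near [z0] uniform in [k], which is why each factor uses a coordinate in which [z0] differs from
    the limit pole. *)
Lemma green_equicont z0 (e : R) : Om z0 -> z0 \notin L -> 0 < e ->
  exists (r : R) (K : nat), 0 < r /\ forall k z w, (K <= k)%N -> enorm (z - z0) < r ->
    enorm (w - z0) < r -> (G k w <= G k z + e%:E)%E.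
Proof.
move=> Oz0 z0L e0; have [TO LO TLr] := TL.
have ex_i j : exists i, (z0 - tnth L j) 0 i != 0.
  apply: contrapT => h; move/negP: z0L; apply; apply/tnthP; exists j.
  apply/subr0_eq/rowP => i; rewrite [RHS]mxE; apply/eqP/negPn/negP => hi.
  by apply: h; exists i.
pose i j := sval (cid (ex_i j)).
have ij j : (z0 - tnth L j) 0 (i j) != 0 by exact: svalP (cid (ex_i j)).
have [d d0 dj] : exists2 d : R, 0 < d & forall j, d <= cabs ((z0 - tnth L j) 0 (i j)).
  by apply: min_pos_ord => j; rewrite lt_neqAle eq_sym cabs_eq0 ij cabs_ge0.
have [r1 r10 ball1] : exists2 r1 : R, 0 < r1 & forall j z, enorm (z - tnth L j) <= r1 -> Om z.
  have h j := open_near oO (LO j).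
  pose s j := s2val (cid2 (h j)).
  have sp j : 0 < s j by exact: s2valP (cid2 (h j)).
  have sO j := s2valP' (cid2 (h j)); rewrite -/(s _) in sO.
  have [m m0 sm] := min_pos_ord sp.
  exists (m / 2); first by rewrite divr_gt0.
  by move=> j z zj; apply: (sO j); apply: le_lt_trans zj (lt_le_trans _ (sm j)); lra.
have [A [K1 [A0 hb]]] := barrier oO D0 OD rhoc prho rho0 TL r10.
have [mx mx0 hmx] : exists2 m : R, m < 0 & rho z0 <= m /\
    forall j z, enorm (z - tnth L j) <= r1 -> rho z <= m.
  have h j := rho_max rhoc rho0 (@closed_ball_compact _ _ (tnth L j) r1) (ball1 j).
  have mp j : 0 < - s2val (cid2 (h j)) by rewrite oppr_gt0; exact: s2valP (cid2 (h j)).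
  have hm j := s2valP' (cid2 (h j)).
  have [m m0 mj] := min_pos_ord mp.
  have z00 := rho0 Oz0.
  exists (Num.max (- m) (rho z0)); first by rewrite gt_max z00 oppr_lt0 m0.
  split=> [|j z zj]; first by rewrite le_max lexx orbT.
  by rewrite le_max; apply/orP; left; apply: le_trans (hm j z zj) _; rewrite lerNr.
(* So close to 0 that the barrier exceeds [- e] where rho > c, and that [z0] and the poles lie well
   inside rho < c/2. *)
pose c := Num.max (mx / 2) (- (e / (A + 1))).
have A1 : 0 < A + 1 by rewrite ltr_wpDl.
have c0 : c < 0 by rewrite gt_max oppr_lt0 divr_gt0//= andbT; lra.
have cm : mx < c by rewrite lt_max; apply/orP; left; lra.
have cA : - e <= A * c.
  have : - (e / (A + 1)) <= c by rewrite le_max lexx orbT.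
  have : (A + 1) * - (e / (A + 1)) = - e by field; rewrite gt_eqF.
  by move=> h1 h2; nra.
have c2 : c / 2 < 0 by lra.
have [de de0 hde] := rhos c2.
pose D1 := Num.max D 1.
have D10 : 0 < D1 ^+ M by rewrite exprn_gt0// lt_max ltr01 orbT.
have r1d : 0 < Num.min r1 (d / 4) by rewrite lt_min r10 divr_gt0.
have [K2 hK2] := TLr _ r1d.
have zc : rho z0 < c / 2 by have [h _] := hmx; lra.
have [r2 r20 hr2] := open_near (rho_lt_open (c := c / 2) oO rhoc) (conj Oz0 zc).
(* Each factor of [Ppoly] is at least [d] at [z0] and [L]; moving the point and the pole costs at
   most d/4 each. *)
pose q := (d / 2) ^+ M.
have q0 : 0 < q by rewrite exprn_gt0// divr_gt0.
(* Since |w - z| <= 2 r3 and the direction is divided by at least [q], this keeps the displacement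
   below both [de], to stay in [Om], and 1/2, to keep the poles. *)
pose r3 := Num.min de (1 / 2) * q / (4 * D1 ^+ M).
have r30 : 0 < r3.
  by rewrite divr_gt0 ?mulr_gt0// lt_min de0 divr_gt0.
exists (Num.min (Num.min r2 (d / 4)) r3), (maxn K1 K2).
split; first by rewrite !lt_min r20 r30 divr_gt0.
move=> k z w; rewrite geq_max => /andP[kK1 kK2].
rewrite !lt_min => /andP[/andP[z1 z2] z3] /andP[_ w3].
have [b [bF _ brho]] := hb k kK1.
have [Oz zc'] := hr2 z z1.
have Pz : q <= cabs (Ppoly (T k) i z).
  rewrite /Ppoly cabs_prod /q -[X in _ ^+ X](card_ord M) -prodr_const.
  apply: ler_prod => j _; rewrite ltW ?divr_gt0//=.
  have /(_ j) := hK2 k kK2; rewrite lt_min => /andP[_ Tj].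
  have h1 := dj j; have h2 := cabs_le_enorm (z - z0) (i j).
  have h3 := cabs_le_enorm (tnth (T k) j - tnth L j) (i j).
  have -> : (z - tnth (T k) j) 0 (i j) = (z0 - tnth L j) 0 (i j) -
      (- ((z - z0) 0 (i j)) + (tnth (T k) j - tnth L j) 0 (i j)).
    by rewrite !mxE; ring.
  set x := (z0 - _) 0 _ in h1 *; set y := (z - z0) 0 _ in h2 *; set t := (tnth (T k) j - tnth L j) 0 (i j) in h3 *.
  have := cabsD (x - (- y + t)) (- y + t); rewrite subrK.
  by have := cabsD (- y) t; rewrite cabsN; lra.
pose wv := (Ppoly (T k) i z)^-1 *: (w - z).
have P0 : Ppoly (T k) i z != 0 by rewrite -cabs_eq0 gt_eqF// (lt_le_trans q0).
have dz : deform (T k) i wv z = w.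
  by rewrite /deform scalerA divff// scale1r addrC subrK.
have wvq : D1 ^+ M * enorm wv <= Num.min de (1 / 2) / 2.
  rewrite /wv enormZ.
  have -> : cabs (Ppoly (T k) i z)^-1 = (cabs (Ppoly (T k) i z))^-1.
    apply: (mulIf (x := cabs (Ppoly (T k) i z))); first by rewrite cabs_eq0.
    by rewrite -cabsM !mulVf ?cabs1 ?cabs_eq0.
  have wz : enorm (w - z) <= 2 * r3.
    by have := enorm_triangle z0 w z; rewrite (enorm_distC z0 z); lra.
  rewrite mulrCA mulrC ler_pdivrMr ?(lt_le_trans q0)//.
  apply: (@le_trans _ _ (D1 ^+ M * (2 * r3))); first by rewrite ler_pM2l.
  have -> : D1 ^+ M * (2 * r3) = Num.min de (1 / 2) / 2 * q.
    by rewrite /r3; field; rewrite gt_eqF.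
  by rewrite ler_pM2l// divr_gt0// lt_min de0 divr_gt0.
have md : Num.min de (1 / 2) <= de by rewrite ge_min lexx.
have mh : Num.min de (1 / 2) <= 1 / 2 by rewrite ge_min lexx orbT.
have m0 : 0 < Num.min de (1 / 2) by rewrite lt_min de0 divr_gt0.
rewrite -[in X in (X <= _)%E]dz.
apply: (@green_deform _ _ Om D rho oO OD rhoc M (T k) i wv (TO k) e c b de) => //.
- move=> y Oy cy; apply: le_trans (brho y Oy _).
    rewrite lee_fin (le_trans cA)// ler_wpM2l// ltW//.
  move=> j; rewrite leNgt; apply/negP => /ltW yj; have [_ /(_ j y yj)] := hmx; lra.
- move=> j; have /(_ j) := hK2 k kK2; rewrite lt_min => /andP[/ltW Tj _].
  by have [_ /(_ j _ Tj)] := hmx; lra.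
- by apply: le_lt_trans wvq _; lra.
- by apply: le_trans wvq _; lra.
Qed.

Lemma green_ge (r0 : R) : 0 < r0 -> exists (A : R) (K : nat), 0 <= A /\
  forall k z, (K <= k)%N -> Om z -> (forall j, r0 <= enorm (z - tnth L j)) ->
    ((A * rho z)%:E <= G k z)%E.
Proof.
move=> r00; have [A [K [A0 hb]]] := barrier oO D0 OD rhoc prho rho0 TL r00.
exists A, K; split=> // k z Kk Oz zL; have [b [bF _ brho]] := hb k Kk.
by apply: le_trans (brho z Oz zL) _; exact: green_ub.
Qed.

End Seq.

Section Single.
Variables (M : nat) (T : M.-tuple Cn).
Hypothesis TO : forall j, Om (tnth T j).

Lemma green_ge_sum z : Om z -> (\sum_(j < M) elog (enorm (z - tnth T j) / D) <= green Om T z)%E.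
Proof.
move=> Oz; have [A [K [_ /(_ K (leqnn _))[b [bF blog _]]]]] :=
  barrier oO D0 OD rhoc prho rho0 (icvg_cst TO) ltr01.
by apply: le_trans (blog z Oz) _; exact: green_ub.
Qed.

Lemma green_le0 z : Om z -> (green Om T z <= 0)%E.
Proof. by move=> Oz; apply: green_lub => u [[_ u0] _]; exact: u0. Qed.

Lemma green_le_elog j (r : R) z : 0 < r ->
  (forall w, enorm (w - tnth T j) < r -> Om w) -> enorm (z - tnth T j) < r ->
  (green Om T z <= elog (enorm (z - tnth T j) / r))%E.
Proof.
move=> r0 rO zr; apply: green_lub => u [[pu u0] up].
by apply: (log_pole_bound n0 oO pu u0 (up _ (mem_tnth _ _)) r0 rO).
Qed.

(** A supremum of upper semicontinuous functions need not be so. Here the logarithmic upper bound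
    gives the limit -oo at a pole, and equicontinuity of the constant sequence gives continuity
    elsewhere. *)
Lemma green_usc : usc_on Om (green Om T).
Proof.
apply: usc_onP => [z /green_le0 z0|z c Oz]; first by rewrite (le_lt_trans z0)// ltry.
have [/tnthP[j ->]|zT] := boolP (z \in T).
  move=> _; have [r r0 hr] := open_near oO (TO j).
  exists (Num.min r (r * expR (c - 1))); first by rewrite lt_min r0 mulr_gt0// expR_gt0.
  move=> w; rewrite lt_min => /andP[wr wc] Ow.
  apply: le_lt_trans (green_le_elog r0 hr wr) _.
  rewrite elog_lt ?divr_ge0 ?enorm_ge0 ?(ltW r0)// ltr_pdivrMr// mulrC.
  by rewrite (lt_trans wc)// ltr_pM2l// ltr_expR; lra.
move=> /lteD_pos[e e0 ec].
have [r [K [r0 h]]] := green_equicont (icvg_cst TO) Oz zT e0.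
exists r => // w wr _; apply: le_lt_trans ec; apply: (h K z w) => //.
by rewrite subrr enorm0.
Qed.

Lemma green_psh : psh_neg Om (green Om T).
Proof.
split; last exact: green_le0.
apply/pshP; split; first exact: green_usc.
move=> z b Ob; apply: green_lub => u hu.
have Oc x : Om (z + cis x *: b) by apply: Ob; rewrite cabs_cis.
apply: le_trans (psh_submean hu.1.1 Ob) _; apply: cmean_le.
- exact: usc_circle_measurable hu.1.1.1 Oc.
- exact: usc_circle_measurable green_usc Oc.
- by move=> x _; exact: green_ub.
Qed.

Lemma green_log_pole a : a \in T -> log_pole (green Om T) a.
Proof.
move=> /tnthP[j ->]; have [r r0 hr] := open_near oO (TO j).
exists (- ln r); apply: (near_punctured r0) => z zr za.
have z0 : 0 < enorm (z - tnth T j) by rewrite enorm_pos subr_eq0.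
apply: le_trans (green_le_elog r0 hr zr) _.
by rewrite elog_gt0 ?divr_gt0// ln_div ?posrE.
Qed.

End Single.
End GreenLimits.

(** * Limits of Green functions *)

Section Limsup.
Context {R : realType} {X : Type}.
Implicit Types (G : nat -> X -> \bar R) (z : X) (c : \bar R).

Definition glim G z : \bar R :=
  ereal_inf [set ereal_sup [set G k z | k in [set k | (K <= k)%N]] | K in setT].

Lemma glim_lt G z c : (glim G z < c)%E -> exists K, forall k, (K <= k)%N -> (G k z < c)%E.
Proof.
move=> /ereal_inf_lt[_ [K _ <-] h]; exists K => k Kk.
by apply: le_lt_trans h; apply: ereal_sup_ubound; exists k.
Qed.

Lemma glim_gt G z c : (c < glim G z)%E -> forall K, exists2 k, (K <= k)%N & (c < G k z)%E.
Proof.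
move=> cG K; apply: contrapT => h; move: cG; apply/negP; rewrite -leNgt.
apply: le_trans (ereal_inf_lbound _) _; first by exists K.
apply: ge_ereal_sup => _ [k Kk <-]; rewrite leNgt; apply/negP => ck.
by apply: h; exists k.
Qed.

Lemma glim_le G z c : (exists K, forall k, (K <= k)%N -> (G k z <= c)%E) -> (glim G z <= c)%E.
Proof.
move=> [K h]; rewrite leNgt; apply/negP => /glim_gt/(_ K)[k Kk].
by rewrite ltNge h.
Qed.

Lemma glim_ge G z c : (exists K, forall k, (K <= k)%N -> (c <= G k z)%E) -> (c <= glim G z)%E.
Proof.
move=> [K h]; rewrite leNgt; apply/negP => /glim_lt[K' h'].
have := h' (maxn K K') (leq_maxr _ _); rewrite ltNge h//; exact: leq_maxl.
Qed.

(** Upper limit at most lower limit: convergence at [z] when the upper limit is finite, and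
    trivially true when it is -oo. *)
Definition gconv G z := forall e : R, 0 < e -> exists K, forall k, (K <= k)%N ->
  (glim G z <= G k z + e%:E)%E.

End Limsup.

Section GreenLimsup.
Context {R : realType} {n : nat}.
Hypothesis n0 : (0 < n)%N.
Local Notation C := R[i].
Local Notation Cn := 'rV[C]_n.
Implicit Types (u v : Cn -> \bar R) (z w a : Cn).

Variables (Om : set Cn) (D : R) (rho : Cn -> R).
Hypotheses (oO : open Om) (D0 : 0 < D)
  (OD : forall z w, Om z -> Om w -> enorm (z - w) <= D)
  (rhoc : forall z (e : R), Om z -> 0 < e -> exists2 r : R, 0 < r &
     forall w, enorm (w - z) < r -> `|rho w - rho z| < e)
  (prho : psh Om (EFin \o rho)) (rho0 : forall z, Om z -> rho z < 0)
  (rhos : forall c : R, c < 0 -> exists2 d : R, 0 < d &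
     forall z, Om z -> rho z < c -> forall h, enorm h < d -> Om (z + h)).

Variables (M : nat) (T : nat -> M.-tuple Cn) (L : M.-tuple Cn).
Hypothesis TL : icvg Om T L.
Local Notation G := (fun k => green Om (T k)).
Let Gam := glim G.

Lemma tuple_compl_open z : z \notin L -> exists2 r : R, 0 < r &
  forall w, enorm (w - z) < r -> w \notin L.
Proof.
move=> /notin_tuple_dist[d d0 h]; exists d => // w wz; apply/negP => /tnthP[j wj].
by have := h j; rewrite -wj enorm_distC leNgt wz.
Qed.

Lemma glim_le0 z : Om z -> (Gam z <= 0)%E.
Proof.
by move=> Oz; apply: glim_le; exists 0%N => k _; exact: green_le0.
Qed.

Lemma glim_ge_rho (r0 : R) : 0 < r0 -> exists2 A : R, 0 <= A &
  forall z, Om z -> (forall j, r0 <= enorm (z - tnth L j)) -> ((A * rho z)%:E <= Gam z)%E.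
Proof.
move=> r00; have [A [K [A0 h]]] := green_ge oO D0 OD rhoc prho rho0 TL r00.
by exists A => // z Oz zL; apply: glim_ge; exists K => k Kk; exact: h.
Qed.

Lemma glim_fin z : Om z -> z \notin L -> exists x : R, Gam z = x%:E.
Proof.
move=> Oz /notin_tuple_dist[d d0 h]; have [A A0 /(_ z Oz h)] := glim_ge_rho d0.
by have := glim_le0 Oz; case: (Gam z) => [x||] // _ _; exists x.
Qed.

Lemma glim_equicont z0 (e : R) : Om z0 -> z0 \notin L -> 0 < e -> exists2 r : R, 0 < r &
  forall z w, enorm (z - z0) < r -> enorm (w - z0) < r -> (Gam w <= Gam z + e%:E)%E.
Proof.
move=> Oz0 z0L e0.
have [r [K [r0 h]]] := green_equicont oO D0 OD rhoc prho rho0 rhos TL Oz0 z0L e0.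
exists r => // z w zr wr.
suff : (Gam w - e%:E <= Gam z)%E by rewrite leeBlDr.
apply: lee_realP => c zc; have [K' hK'] := glim_lt zc.
rewrite leeBlDr//; apply: glim_le; exists (maxn K K') => k.
rewrite geq_max => /andP[kK kK']; apply: le_trans (h k z w kK zr wr) _.
by rewrite leeD2r// ltW// hK'.
Qed.

(** A Hartogs type bound that holds without convergence: equicontinuity of both sides spreads the
    pointwise bound over a neighbourhood, at a cost of e/3 on each side, and compactness does the
    rest. *)
Lemma glim_unif (Q : set Cn) (e : R) : compact Q -> Q `<=` Om -> (forall z, Q z -> z \notin L) ->
  0 < e -> exists N, forall k z, (N <= k)%N -> Q z -> (G k z <= Gam z + e%:E)%E.
Proof.
move=> /compact_near_coveringP cQ QO QL e0; have e3 : 0 < e / 3 by rewrite divr_gt0.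
have [z Qz|N _ hN] := cQ nat \oo (fun k z => (G k z <= Gam z + e%:E)%E) _; last first.
  by exists N => k z Nk Qz; exact: hN Nk z Qz.
have Oz := QO z Qz; have zL := QL z Qz.
have [r [K [r0 h]]] := green_equicont oO D0 OD rhoc prho rho0 rhos TL Oz zL e3.
have [r' r0' h'] := glim_equicont Oz zL e3.
have [x Gx] := glim_fin Oz zL.
have [K' hK'] : exists K, forall k, (K <= k)%N -> (G k z < (x + e / 3)%:E)%E.
  by apply: (@glim_lt _ _ G); rewrite -/(Gam z) Gx lte_fin ltrDl.
have nz : \forall w \near z, enorm (w - z) < Num.min r r'.
  by apply/nbhs_enormP; exists (Num.min r r') => //; rewrite lt_min r0.
near=> w k.
have : enorm (w - z) < Num.min r r' by near: w.
rewrite lt_min => /andP[wr wr'].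
have Kk : (maxn K K' <= k)%N by near: k; exact: nbhs_infty_ge.
move: Kk; rewrite geq_max => /andP[Kk Kk'].
have z0r s : 0 < s -> enorm (z - z) < s by rewrite subrr enorm0.
apply: le_trans (h k z w Kk (z0r _ r0) wr) _.
apply: le_trans (leeD2r _ (ltW (hK' k Kk'))) _.
have := h' w z wr' (z0r _ r0'); rewrite Gx.
case: (Gam w) => [y||] //; rewrite ?leey//= -!EFinD !lee_fin; lra.
Unshelve. all: by end_near. Qed.

(** The value -oo at a limit pole is the limit dictated by the bound [glim_le_elog] around it. *)
Definition glim_ext z : \bar R := if z \in L then -oo%E else Gam z.

Lemma glim_ext_le0 z : Om z -> (glim_ext z <= 0)%E.
Proof.
by move=> Oz; rewrite /glim_ext; case: ifP => _; rewrite ?leNye// glim_le0.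
Qed.

(** Once the moving pole is closer to its limit than [z] is, its distance to [z] is at most twice
    that of the limit pole; the ball of radius [2 * r] leaves room for balls of radius [r] around
    moving poles. *)
Lemma glim_le_elog j (r : R) z : 0 < r -> (forall w, enorm (w - tnth L j) < 2 * r -> Om w) ->
  z != tnth L j -> enorm (z - tnth L j) < r / 2 ->
  (Gam z <= elog (2 * enorm (z - tnth L j) / r))%E.
Proof.
move=> r0 rO zL zr; have [TO _ TLr] := TL.
have d0 : 0 < enorm (z - tnth L j) by rewrite enorm_pos subr_eq0.
have [K hK] := TLr _ d0; apply: glim_le; exists K => k Kk.
have Tj := hK k Kk j.
have zT : enorm (z - tnth (T k) j) < 2 * enorm (z - tnth L j).
  by have := enorm_triangle (tnth L j) z (tnth (T k) j); rewrite (enorm_distC (tnth L j)); lra.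
apply: (le_trans (green_le_elog n0 oO (T := T k) (j := j) r0 _ _)).
- move=> w wT; apply: rO.
  by have := enorm_triangle (tnth (T k) j) w (tnth L j); lra.
- by apply: lt_trans zT _; lra.
apply: elog_mono; first by rewrite divr_ge0 ?enorm_ge0// ltW.
by rewrite ler_pM2r ?invr_gt0// ltW.
Qed.

Lemma glim_ext_usc : usc_on Om glim_ext.
Proof.
apply: usc_onP => [z /glim_ext_le0 z0|z c Oz]; first by rewrite (le_lt_trans z0)// ltry.
rewrite {1}/glim_ext; case: ifPn => [/tnthP[j ->] _|zL].
  have [_ LO _] := TL; have [r r0 hr] := open_near oO (LO j).
  have r2 : 0 < r / 2 by rewrite divr_gt0.
  exists (Num.min (r / 2 / 2) (r / 2 * expR c / 2)).
    by rewrite lt_min !divr_gt0// !mulr_gt0// ?divr_gt0// expR_gt0.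
  move=> w; rewrite lt_min => /andP[w1 w2] Ow; rewrite /glim_ext; case: ifPn => [_|wL].
    by rewrite ltNyr.
  apply: (le_lt_trans (glim_le_elog (j := j) r2 _ _ w1)).
  - by move=> y; rewrite mulrC divfK//; exact: hr.
  - by apply: contra wL => /eqP ->; exact: mem_tnth.
  rewrite elog_lt; last by rewrite divr_ge0 ?mulr_ge0 ?enorm_ge0// ltW.
  by rewrite ltr_pdivrMr//; lra.
move=> /lteD_pos[e e0 ec]; have [r r0 h] := glim_equicont Oz zL e0.
exists r => // w wr _; rewrite /glim_ext; case: ifP => _; first by rewrite ltNyr.
by apply: le_lt_trans ec; apply: h => //; rewrite subrr enorm0.
Qed.

(** By [glim_unif] on a closed ball off the poles, [G k] may be replaced by the upper limit plus [d]
    inside the circle mean, for all large [k]; points of [L] carry the value -oo. *)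
Lemma glim_ext_psh : psh_neg Om glim_ext.
Proof.
split; last exact: glim_ext_le0.
apply: lpsh_psh => //; first exact: glim_ext_le0.
split; first exact: glim_ext_usc.
move=> z Oz e e0; have [zL|zL] := boolP (z \in L).
  by exists 1 => // b _; rewrite /glim_ext zL leNye.
have [r r0 hr] := open_near oO Oz; have [s s0 hs] := tuple_compl_open zL.
pose q := Num.min r s / 2.
have q0 : 0 < q by rewrite divr_gt0// lt_min r0.
have qrs w : enorm (w - z) <= q -> Om w /\ w \notin L.
  have h1 : Num.min r s <= r by rewrite ge_min lexx.
  have h2 : Num.min r s <= s by rewrite ge_min lexx orbT.
  have h3 : 0 < Num.min r s by rewrite lt_min r0.
  by rewrite /q => wq; split; [apply: hr|apply: hs]; lra.
exists q => // b bq; apply: (@le_trans _ _ (lmean glim_ext z b)); last first.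
  by rewrite leeDl// lee_fin mulr_ge0 ?sqr_ge0// ltW.
have Ob (t : C) : cabs t <= 1 -> enorm (z + t *: b - z) <= q.
  move=> t1; rewrite addrAC subrr add0r enormZ (le_trans _ (ltW bq))//.
  by rewrite ler_piMl// enorm_ge0.
have Oc x : Om (z + cis x *: b) by apply: (qrs _ _).1; apply: Ob; rewrite cabs_cis.
have Lc x : z + cis x *: b \notin L by apply: (qrs _ _).2; apply: Ob; rewrite cabs_cis.
rewrite {1}/glim_ext (negPf zL).
apply/lee_addgt0Pr => d d0.
have [N hN] := glim_unif (@closed_ball_compact _ _ z q) (fun w h => (qrs w h).1)
  (fun w h => (qrs w h).2) d0.
apply: glim_le; exists N => k Nk.
have [TO _ _] := TL.
have gp := green_psh n0 oO D0 OD rhoc prho rho0 rhos (TO k).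
apply: (le_trans (psh_submean gp.1 (b := b) _)).
  by move=> t /Ob /qrs[].
suff : (lmean (G k) z b - d%:E <= lmean glim_ext z b)%E by rewrite leeBlDr.
rewrite -EFinN -(cmean_cst (- d)%:E) -cmeanD.
- apply: cmean_le.
  + apply: emeasurable_funD; last exact: measurable_cst.
    exact: usc_circle_measurable gp.1.1 Oc.
  + exact: usc_circle_measurable glim_ext_usc Oc.
  + move=> x _; rewrite /glim_ext (negPf (Lc x)) EFinN leeBlDr//.
    by apply: hN => //; apply: Ob; rewrite cabs_cis.
- exact: usc_circle_measurable gp.1.1 Oc.
- exact: measurable_cst.
- by move=> x _; exact: gp.2.
- by move=> x _; rewrite lee_fin oppr_le0 ltW.
Qed.

Lemma gconv_unif (Q : set Cn) (e : R) : compact Q -> Q `<=` Om -> (forall z, Q z -> z \notin L) ->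
  (forall z, Q z -> gconv G z) ->
  0 < e -> exists N, forall k z, (N <= k)%N -> Q z -> (Gam z <= G k z + e%:E)%E.
Proof.
move=> /compact_near_coveringP cQ QO QL Qc e0; have e3 : 0 < e / 3 by rewrite divr_gt0.
have [z Qz|N _ hN] := cQ nat \oo (fun k z => (Gam z <= G k z + e%:E)%E) _; last first.
  by exists N => k z Nk Qz; exact: hN Nk z Qz.
have Oz := QO z Qz; have zL := QL z Qz.
have [r [K [r0 h]]] := green_equicont oO D0 OD rhoc prho rho0 rhos TL Oz zL e3.
have [r' r0' h'] := glim_equicont Oz zL e3.
have [K' hK'] := Qc z Qz _ e3.
have nz : \forall w \near z, enorm (w - z) < Num.min r r'.
  by apply/nbhs_enormP; exists (Num.min r r') => //; rewrite lt_min r0.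
near=> w k.
have : enorm (w - z) < Num.min r r' by near: w.
rewrite lt_min => /andP[wr wr'].
have Kk : (maxn K K' <= k)%N by near: k; exact: nbhs_infty_ge.
move: Kk; rewrite geq_max => /andP[Kk Kk'].
have z0r s : 0 < s -> enorm (z - z) < s by rewrite subrr enorm0.
apply: le_trans (h' z w (z0r _ r0') wr') _.
apply: le_trans (leeD2r _ (hK' k Kk')) _.
apply: le_trans (leeD2r _ (leeD2r _ (h k w z Kk wr (z0r _ r0)))) _.
rewrite -!addeA -!EFinD le_eqVlt; apply/orP; left; apply/eqP; congr (_ + _%:E)%E; field.
Unshelve. all: by end_near. Qed.

Lemma gconv_locunif : (forall z, Om z -> z \notin L -> gconv G z) ->
  cvg_locunif (Om `\` poles L) G glim_ext.
Proof.
move=> hc z [Oz /negP zL]; have [r r0 hr] := open_near oO Oz; have [s s0 hs] := tuple_compl_open zL.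
pose q := Num.min r s / 2.
have q0 : 0 < q by rewrite divr_gt0// lt_min r0.
have qrs w : enorm (w - z) <= q -> Om w /\ w \notin L.
  have h1 : Num.min r s <= r by rewrite ge_min lexx.
  have h2 : Num.min r s <= s by rewrite ge_min lexx orbT.
  have h3 : 0 < Num.min r s by rewrite lt_min r0.
  by rewrite /q => wq; split; [apply: hr|apply: hs]; lra.
exists [set w | enorm (w - z) <= q].
  by apply/nbhs_enormP; exists q => // w /ltW.
move=> e e0; have e2 : 0 < e / 2 by rewrite divr_gt0.
have cB := @closed_ball_compact _ _ z q.
have BO w (h : enorm (w - z) <= q) := (qrs w h).1.
have BL w (h : enorm (w - z) <= q) := (qrs w h).2.
have [N1 h1] := glim_unif cB BO BL e2.
have [N2 h2] := gconv_unif cB BO BL (fun w h => hc w (BO w h) (BL w h)) e2.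
exists (maxn N1 N2) => // k; rewrite /= geq_max => /andP[k1 k2] w _ /= wq.
have := h1 k w k1 wq; have := h2 k w k2 wq.
rewrite /glim_ext (negPf (BL w wq)); have [x ->] := glim_fin (BO w wq) (BL w wq).
case: (green Om (T k) w) => [y||] //; rewrite -!EFinD -?EFinB !lee_fin lte_fin ltr_norml.
by move=> *; apply/andP; split; lra.
Qed.

End GreenLimsup.

(** One has (1 + d) x <= y + d y + (1 + d) c, and a very negative bound [m] on [y] lets d y swallow
    both the constant [c] and the offset [b]. *)
Lemma scale_shift_le {R : realType} (x y : \bar R) (d c b m : R) : 0 < d ->
  (y <= m%:E)%E -> (x <= y + c%:E)%E -> d * m + (1 + d) * c + b <= 0 ->
  ((1 + d)%:E * x <= y + (- b)%:E)%E.
Proof.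
move=> d0; have d1 : 0 < 1 + d by lra_cleared.
case: y => [y||] //=; last first.
  by case: x => [x||] //= _ _ _; rewrite gt0_muleNy// lte_fin.
rewrite lee_fin => ym; case: x => [x||] //=; last first.
  by move=> _ _; rewrite gt0_muleNy ?lte_fin// leNye.
rewrite -!EFinD -EFinM !lee_fin => xy h.
have : (1 + d) * x <= (1 + d) * (y + c) by rewrite ler_pM2l.
have : d * y <= d * m by rewrite ler_pM2l.
lra.
Qed.

(** * Gluing on shells around the limit poles *)

Section PoleNeighbourhoods.
Context {R : realType} {n : nat}.
Local Notation C := R[i].
Local Notation Cn := 'rV[C]_n.
Variables (M : nat) (L : M.-tuple Cn).

Let ball_ (r : R) w := exists j, enorm (w - tnth L j) < r.
Let far (r : R) w := forall j, r < enorm (w - tnth L j).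

Lemma ball_open r : open (ball_ r).
Proof.
apply: openP => w [j wj]; exists (r - enorm (w - tnth L j)); first by rewrite subr_gt0.
by move=> y yw; exists j; have := enorm_triangle w y (tnth L j); lra.
Qed.

Lemma far_open r : open (far r).
Proof.
apply: openP => w wr.
have [m m0 hm] := min_pos_ord (f := fun j => enorm (w - tnth L j) - r)
  (fun j => ltac:(by rewrite subr_gt0)).
exists m => // y yw j; have := enorm_triangle y w (tnth L j).
by rewrite (enorm_distC w y); have := hm j; lra.
Qed.

Lemma not_ball_far (r s : R) w : s < r -> ~ ball_ r w -> far s w.
Proof.
move=> sr nb j; apply: lt_le_trans sr _; rewrite leNgt; apply/negP => h.
by apply: nb; exists j.
Qed.

Lemma shell_compact (j : 'I_M) (r s : R) :
  compact [set w | enorm (w - tnth L j) <= s /\ forall i, r <= enorm (w - tnth L i)].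
Proof.
apply: (subclosed_compact _ (@closed_ball_compact _ _ (tnth L j) s)); last by move=> w [].
apply: closed_enormP => w nw.
have [ws|sw] := leP (enorm (w - tnth L j)) s; last first.
  exists (enorm (w - tnth L j) - s); rewrite ?subr_gt0// => y yw [ys _].
  have := enorm_triangle y w (tnth L j); rewrite (enorm_distC w y); lra.
have [i wi] : exists i, enorm (w - tnth L i) < r.
  apply: contrapT => h; apply: nw; split=> // i; rewrite leNgt; apply/negP => wi.
  by apply: h; exists i.
exists (r - enorm (w - tnth L i)); rewrite ?subr_gt0// => y yw [_ /(_ i) yr].
have := enorm_triangle w y (tnth L i); lra.
Qed.

End PoleNeighbourhoods.

(* [(1 + d) * u] is below [F k - cst] close to the poles and above it a bit
   further, hence gluing the two gives competitors for [green Om (T k)]. *)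
Lemma green_liminf {R : realType} {n : nat} (n0 : (0 < n)%N)
  (Om : set 'rV[R[i]]_n) (D : R) (rho : 'rV[R[i]]_n -> R)
  (oO : open Om) (D0 : 0 < D)
  (OD : forall z w, Om z -> Om w -> enorm (z - w) <= D)
  (rhoc : forall z (e : R), Om z -> 0 < e -> exists2 r : R, 0 < r &
     forall w, enorm (w - z) < r -> `|rho w - rho z| < e)
  (prho : psh Om (EFin \o rho)) (rho0 : forall z, Om z -> rho z < 0)
  (M : nat) (T : nat -> M.-tuple 'rV[R[i]]_n) (L : M.-tuple 'rV[R[i]]_n) (TL : icvg Om T L)
  (W : set 'rV[R[i]]_n) (F : nat -> 'rV[R[i]]_n -> \bar R) (f : 'rV[R[i]]_n -> \bar R)
  (K0 : nat) (c0 : R)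
  (oW : open W) (WO : W `<=` Om) (LW : forall j, W (tnth L j))
  (pF : forall k, (K0 <= k)%N -> psh_neg W (F k))
  (lF : forall k, (K0 <= k)%N -> forall a, a \in T k -> log_pole (F k) a)
  (Ff : forall Q, compact Q -> Q `<=` W -> (forall z, Q z -> z \notin L) ->
    exists K, forall k w, (K <= k)%N -> Q w -> (f w <= F k w + 1%:E)%E)
  (GF : forall k, (K0 <= k)%N -> forall z, W z -> (green Om (T k) z <= F k z + c0%:E)%E)
  (u : 'rV[R[i]]_n -> \bar R) (cu : R) : psh_neg Om u ->
  (forall z, W z -> z \notin L -> (u z <= f z + cu%:E)%E) ->
  forall z, Om z -> z \notin L -> forall e : R, 0 < e ->
  exists K, forall k, (K <= k)%N -> (u z <= green Om (T k) z + e%:E)%E.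
Proof.
pose ball_ (r : R) w := exists j, enorm (w - tnth L j) < r.
pose far (r : R) w := forall j, r < enorm (w - tnth L j).
move=> pu uf z Oz zL e e0.
case Euz : (u z) (pu.2 z Oz) => [x0||] // x00; last first.
  by exists 0%N => k _; rewrite leNye.
rewrite lee_fin in x00.
(* At the point [z] the factor 1 + d costs at most d |x0| <= e. *)
pose d := Num.min 1 (e / (`|x0| + 1)).
have q0 : 0 < `|x0| + 1 by rewrite ltr_wpDl.
have d0 : 0 < d by rewrite lt_min ltr01 divr_gt0.
have d1 : d <= 1 by rewrite ge_min lexx.
have d2 : d * (- x0) <= e.
  have : d <= e / (`|x0| + 1) by rewrite ge_min lexx orbT.
  rewrite ler_pdivlMr// ler0_norm// => h.
  by move: h; rewrite mulrDr mulr1; have := ltW d0; lra.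
have [TO LO TLr] := TL.
have [R0 R00 hR0] : exists2 r : R, 0 < r & forall j w, enorm (w - tnth L j) < r -> W w.
  have h j := open_near oW (LW j).
  have sp j : 0 < s2val (cid2 (h j)) by exact: s2valP (cid2 (h j)).
  have sO j := s2valP' (cid2 (h j)).
  have [m m0 sm] := min_pos_ord sp.
  by exists m => // j w wj; apply: (sO j); apply: lt_le_trans wj (sm j).
have [dz dz0 hdz] := notin_tuple_dist zL.
(* Radii r1 < s1 < r2 < s2 < dz will be used: the gluing takes place on the inner shell from r1 to
   s1 and on the outer one from r2 to s2, and [z] lies outside all the balls. *)
pose s2 := Num.min R0 dz / 2; pose r2 := s2 / 2.
have [s20 s2R s2z] : [/\ 0 < s2, s2 < R0 & s2 < dz].
  have h1 : Num.min R0 dz <= R0 by rewrite ge_min lexx.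
  have h2 : Num.min R0 dz <= dz by rewrite ge_min lexx orbT.
  have h3 : 0 < Num.min R0 dz by rewrite lt_min R00.
  by rewrite /s2; split; lra_cleared.
have r20 : 0 < r2 by rewrite divr_gt0.
have r2s2 : r2 < s2 by rewrite /r2; lra.
have [A [K1 [A0 hb]]] := barrier oO D0 OD rhoc prho rho0 TL r20.
have [m hm] : exists m : R, forall w, ball_ s2 w -> - m <= rho w.
  have bj j : exists m : R, 0 < m /\ forall w, enorm (w - tnth L j) <= s2 -> - m <= rho w.
    have cB := @closed_ball_compact _ _ (tnth L j) s2.
    have BO w : enorm (w - tnth L j) <= s2 -> Om w by move=> h; apply/WO/(hR0 j); lra.
    have [|x c xB xc|x xB xmax] := @usc_max _ _ _ (fun w => - rho w) cB.
    - by exists (tnth L j); rewrite /= subrr enorm0 ltW.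
    - have [r r0 h] := rhoc _ (c + rho x) (BO x xB) ltac:(by lra).
      apply/nbhs_enormP; exists r => // w /h; rewrite ltr_norml => /andP[H _] _; lra_cleared.
    - exists (- rho x); split; first by rewrite oppr_gt0; exact: rho0 _ (BO x xB).
      by move=> w /xmax; rewrite opprK; lra.
  pose mj j := sval (cid (bj j)); have hmj j := svalP (cid (bj j)).
  exists (\sum_j mj j) => w [j /ltW wj]; have [_ /(_ w wj)] := hmj j.
  apply: le_trans; rewrite lerN2 (bigD1 j)//= lerDl.
  by apply: sumr_ge0 => i _; have [/ltW] := hmj i.
(* On the outer shell the barrier is at least [- c2], and 1 + d <= 2, so (1 + d) times it is at
   least [- B], which bounds [F k - B] from above. *)
pose c2 := A * m; pose B := 2 * Num.max c2 0.
have B0 : 0 <= B by rewrite mulr_ge0// le_max lexx orbT.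
pose c1 := Num.max (1 + cu) c0.
(* [s1] is so small that [F k] is very negative on the inner shell *)
pose y := - (B + (1 + d) * c1) / d.
have hy : d * y + (1 + d) * c1 + B <= 0.
  by rewrite /y mulrCA divff ?gt_eqF// mulr1; lra_cleared.
pose s1 := Num.min (Num.min (r2 / 2) (R0 / 8)) (R0 / 4 * expR y / 2).
pose r1 := s1 / 2.
have ey := expR_gt0 y.
have [s10 s1r2 s1R s1y] : [/\ 0 < s1, s1 < r2, s1 <= R0 / 8 & 2 * s1 <= R0 / 4 * expR y].
  have h1 : s1 <= r2 / 2 by rewrite !ge_min lexx.
  have h2 : s1 <= R0 / 8 by rewrite !ge_min lexx orbT.
  have h3 : s1 <= R0 / 4 * expR y / 2 by rewrite !ge_min lexx !orbT.
  have h4 : 0 < R0 / 4 * expR y / 2 by apply: divr_gt0 => //; apply: mulr_gt0 => //; lra_cleared.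
  have h5 : 0 < s1 by rewrite !lt_min h4 andbT; apply/andP; split; lra_cleared.
  by split=> //; lra_cleared.
have r10 : 0 < r1 by rewrite divr_gt0.
have r1s1 : r1 < s1 by rewrite /r1; lra_cleared.
have [K2 hK2] := TLr _ s10.
have [K3 hK3] : exists K, forall k, (K <= k)%N -> forall j w,
    enorm (w - tnth L j) <= s1 -> (forall i, r1 <= enorm (w - tnth L i)) ->
    (f w <= F k w + 1%:E)%E.
  have [j|K hK] := @eventually_ord M (fun j k => forall w,
    enorm (w - tnth L j) <= s1 -> (forall i, r1 <= enorm (w - tnth L i)) ->
    (f w <= F k w + 1%:E)%E) _; last by exists K.
  have [|w [_ wr]|K hK] := Ff _ (@shell_compact _ _ _ L j r1 s1).
  - by move=> w [wj _]; apply: (hR0 j); lra_cleared.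
  - apply/negP => /tnthP[i wi]; have := wr i; rewrite wi subrr enorm0; lra_cleared.
  - by exists K => k Kk w w1 w2; apply: hK.
exists (maxn (maxn K0 K1) (maxn K2 K3)) => k; rewrite !geq_max.
move=> /andP[/andP[k0 k1] /andP[k2 k3]].
have [b [bF _ brho]] := hb k k1.
have pFk := pF _ k0.
(* The barrier is included because [u] alone may be -oo on the outer shell. On the inner shell both
   terms are at most F k + c1: [u] through [f], and [b] as a competitor for the Green function. *)
pose o w := ((1 + d)%:E * maxe (u w) (b w))%E.
pose i w := (F k w + (- B)%:E)%E.
have po : psh_neg Om o by apply: psh_neg_scale; [lra_cleared|exact: (psh_neg_max pu bF.1)].
have pi_ : psh_neg W i by apply: psh_neg_add pFk _; apply: psh_neg_cst; rewrite lee_fin oppr_le0.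
have Wball (r : R) w : r <= s2 -> ball_ r w -> W w.
  by move=> rs [j wj]; apply: (hR0 j); lra_cleared.
have in1 w : ball_ s1 w -> far r1 w -> (o w <= i w)%E.
  move=> [j wj] wf; have Ww : W w by apply: (Wball s1); [lra_cleared|exists j].
  have wL : w \notin L.
    by apply/negP => /tnthP[l wl]; have := wf l; rewrite wl subrr enorm0; lra_cleared.
  apply: (@scale_shift_le _ _ _ d c1 B y) => //.
    have Tj := hK2 k k2 j.
    have wT : enorm (w - tnth (T k) j) < 2 * s1.
      have := enorm_triangle (tnth L j) w (tnth (T k) j).
      by rewrite (enorm_distC (tnth L j)); lra_cleared.
    have R4 : 0 < R0 / 4 by rewrite divr_gt0.
    apply: (le_trans (log_pole_bound n0 oW pFk.1 pFk.2 (lF _ k0 _ (mem_tnth j _)) R4 _ _)).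
    - move=> p pT; apply: (hR0 j).
      by have := enorm_triangle (tnth (T k) j) p (tnth L j); lra_cleared.
    - by lra_cleared.
    rewrite elog_le; last by rewrite divr_ge0 ?enorm_ge0// ltW.
    by rewrite ler_pdivrMr// mulrC; lra_cleared.
  rewrite ge_max; apply/andP; split.
    apply: le_trans (uf w Ww wL) _.
    apply: le_trans (leeD2r _ (hK3 k k3 j w (ltW wj) (fun l => ltW (wf l)))) _.
    by rewrite -addeA -EFinD leeD2l// lee_fin le_max lexx.
  apply: le_trans (green_ub _ bF) _; apply: le_trans (GF _ k0 _ Ww) _.
  by rewrite leeD2l// lee_fin le_max lexx orbT.
have in2 w : ball_ s2 w -> far r2 w -> (i w <= o w)%E.
  move=> wb wf; have Ww : W w by exact: Wball wb.
  apply: (@le_trans _ _ (- B)%:E).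
    by rewrite /i geeDr//; exact: pFk.2.
  have bw : ((- Num.max c2 0)%:E <= maxe (u w) (b w))%E.
    rewrite le_max; apply/orP; right; apply: le_trans (brho w (WO _ Ww) (fun j => ltW (wf j))).
    rewrite lee_fin; apply: (@le_trans _ _ (- c2)); first by rewrite lerN2 le_max lexx.
    by rewrite /c2 -mulrN ler_wpM2l// hm.
  apply: (@le_trans _ _ ((1 + d)%:E * (- Num.max c2 0)%:E)%E).
    rewrite -EFinM lee_fin mulrN lerN2 /B ler_wpM2r ?le_max ?lexx ?orbT//; lra_cleared.
  by rewrite lee_pmul2l// lte_fin; lra_cleared.
(* Inner function near the poles, maximum in between, outer function elsewhere; [in1] and [in2] say
   that the maximum is the right function on either shell. *)
pose v w := if `[< ball_ s1 w >] then i w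
  else if `[< ball_ s2 w >] then maxe (o w) (i w) else o w.
have v0 w : Om w -> (v w <= 0)%E.
  move=> Ow; rewrite /v; case: asboolP => [wb|_].
    by apply: pi_.2; apply: Wball wb; lra_cleared.
  case: asboolP => [wb|_]; last exact: po.2.
  by rewrite ge_max po.2//= pi_.2//; exact: Wball wb.
have vF : green_family Om (T k) v.
  split; first split=> //.
    apply: psh_local => // w Ow.
    have [w1|w1] := pselect (ball_ s1 w).
      exists (ball_ s1), i; split=> //.
      - exact: (@ball_open _ _ _ L).
      - by move=> p /Wball pW; apply/WO/pW; lra_cleared.
      - by apply: psh_subset pi_.1 => p /Wball; apply; lra_cleared.
      - by move=> p p1; rewrite /v asboolT.
    have [w2|w2] := pselect (ball_ s2 w).
      exists (ball_ s2 `&` far r1), (fun w => maxe (o w) (i w)); split=> //.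
      - by apply: openI; [exact: (@ball_open _ _ _ L)|exact: (@far_open _ _ _ L)].
      - by split=> //; exact: not_ball_far w1.
      - by move=> p [/Wball pW _]; apply/WO/pW.
      - have pW : ball_ s2 `&` far r1 `<=` W by move=> p [/Wball H _]; exact: H.
        apply: (psh_neg_max _ _).1.
          split; first by apply: psh_subset po.1 => p /pW /WO.
          by move=> p /pW /WO; exact: po.2.
        split; first by apply: psh_subset pi_.1.
        by move=> p /pW; exact: pi_.2.
      - move=> p [p2 p1]; rewrite /v; case: asboolP => [pb|_].
          by apply/esym/max_idPr; exact: in1.
        by rewrite asboolT.
    exists (Om `&` far r2), o; split=> //.
    - by apply: openI => //; exact: (@far_open _ _ _ L).
    - by split=> //; exact: not_ball_far w2.
    - by apply: psh_subset po.1 => p [].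
    - move=> p [Op p2]; rewrite /v; case: asboolP => [[j pj]|_].
        by have pj2 := p2 j; exfalso; lra_cleared.
      by case: asboolP => // pb; apply/max_idPl; exact: in2.
  move=> a aT; apply: log_pole_le (lF _ k0 _ aT).
  move: (aT) => /tnthP[j aE].
  have ab : ball_ s1 a by exists j; rewrite aE; exact: hK2.
  have [r r0 hr] := open_near (ball_open (r := s1)) ab.
  apply: (near_punctured r0) => p /hr pb _.
  by rewrite /v asboolT// /i geeDl// lee_fin oppr_le0.
apply: (@le_trans _ _ ((1 + d)%:E * (u z) + e%:E)%E).
  rewrite Euz -EFinM -EFinD lee_fin; lra_cleared.
rewrite leeD2r//; apply: le_trans (green_ub z vF).
have nz r : r <= s2 -> ~ ball_ r z.
  by move=> rs [j zj]; have := hdz j; lra_cleared.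
rewrite /v !asboolF; [|exact: nz|by apply: nz; lra_cleared].
by rewrite /o lee_pmul2l ?lte_fin//; [rewrite le_max lexx|lra_cleared].
Qed.

Lemma lebesgue_measure_shift {R : realType} (c : R) (A : set (measurableTypeR R)) :
  measurable A ->
  lebesgue_measure ((fun x => x + c : measurableTypeR R) @^-1` A) = lebesgue_measure A.
Proof.
move=> mA; have mf : measurable_fun setT (fun x : measurableTypeR R => x + c : measurableTypeR R).
  exact: measurable_funD.
apply/esym; apply: (@lebesgue_measure_unique _
  (measure_function_pushforward__canonical__measure_function_Measure _ mf)) => //.
move=> _ [[a b]] _ <-; rewrite /= /pushforward.
rewrite (_ : _ @^-1` _ = `]a - c, b - c]%classic); last first.
  by apply/seteqP; split=> x /=; rewrite !in_itv/= ltrBlDr lerBrDr.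
have := @lebesgue_measure_itv R `]a, b]; rewrite /= => ->.
have := @lebesgue_measure_itv R `]a - c, b - c]; rewrite /= => ->.
rewrite !lte_fin ltrD2r; case: ifP => // _.
by rewrite -!EFinB; congr (_%:E); ring.
Qed.

(** * Lebesgue measure on R^(2n) *)

Section TupleMeasure.
Context {R : realType}.
Local Notation TR := (measurableTypeR R).
Local Notation mu n := (tuple_measure (@lebesgue_measure R) n).

Let measurable_box n (A : 'I_n -> set TR) : (forall i, measurable (A i)) ->
  measurable [set t : n.-tuple TR | forall i, A i (tnth t i)].
Proof.
move=> mA; rewrite (_ : mkset _ = \bigcap_(i in [set: 'I_n])
    (fun t : n.-tuple TR => tnth t i) @^-1` A i); last first.
  by apply/seteqP; split=> t h i => [_|]; apply: h.
apply: fin_bigcap_measurable => [|i _]; first exact: finite_finset.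
by rewrite -[X in measurable X]setTI; apply: measurable_tnth.
Qed.

Lemma tuple_measure_box n (A : 'I_n -> set TR) : (forall i, measurable (A i)) ->
  measurable [set t : n.-tuple TR | forall i, A i (tnth t i)] /\
  mu n [set t | forall i, A i (tnth t i)] = (\prod_(i < n) lebesgue_measure (A i))%E.
Proof.
move=> mA; split.
  exact: measurable_box.
elim: n => [|n IH] in A mA *.
  rewrite big_ord0 /= diracE (_ : _ \in _ = true)//.
  by apply/mem_set => -[].
rewrite big_ord_recl /= /cons_measure /pushforward.
rewrite -(IH (fun i => A (lift ord0 i)))//.
have mB := measurable_box (fun i => mA (lift ord0 i)).
apply: eq_trans (product_measure1E _ _ (mA ord0) mB); congr (product_measure1 _ _ _).
apply/seteqP; split=> [[x t]|[x t]] /=.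
  move=> h; split; first by have := h ord0.
  by move=> i; have := h (lift ord0 i); rewrite tnthS.
by move=> [h1 h2] i; case: (unliftP ord0 i) => [j ->|->] //; rewrite tnthS; exact: h2.

Qed.

(** Intended for [g] independent of the i-th coordinate; translations and plane rotations are
    products of such maps. *)
Definition shear n (i : 'I_n) (g : n.-tuple TR -> R) (t : n.-tuple TR) : n.-tuple TR :=
  [tuple (if j == i then tnth t i + g t else tnth t j) | j < n].

Lemma measurable_shear n (i : 'I_n) g : measurable_fun setT (g : _ -> TR) ->
  measurable_fun setT (shear i g).
Proof.
move=> mg; apply/measurable_fun_tnthP => j.
rewrite (_ : _ \o _ = fun t => if j == i then tnth t i + g t else tnth t j); last first.
  by apply/funext => t /=; rewrite tnth_mktuple.
case: (j == i); last exact: measurable_tnth.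
by apply: measurable_funD => //; exact: measurable_tnth.
Qed.

Local Notation tcons := (@tuple_cons _ TR _).

Lemma shear_cons_lift n (j : 'I_n) g x (s : n.-tuple TR) :
  shear (lift ord0 j) g (tcons (x, s)) = tcons (x, shear j (fun t => g (tcons (x, t))) s).
Proof.
apply: eq_from_tnth => k; rewrite tnth_mktuple; case: (unliftP ord0 k) => [l ->|->].
  by rewrite !tnthS tnth_mktuple (inj_eq (@lift_inj _ ord0)).
by rewrite (negPf (neq_lift _ _)).
Qed.

Lemma shear_cons0 n g x (s : n.-tuple TR) :
  shear ord0 g (tcons (x, s)) = tcons (x + g (tcons (x, s)) : TR, s).
Proof.
apply: eq_from_tnth => k; rewrite tnth_mktuple; case: (unliftP ord0 k) => [l ->|->].
  by rewrite eq_sym (negPf (neq_lift _ _)) !tnthS.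
by rewrite eqxx.
Qed.

(** The first coordinate is split off. If a later one is sheared, the induction hypothesis applies
    to each section; if the first one is, the other order of integration reduces the claim to
    translation invariance on the line. *)
Lemma shear_measure n (i : 'I_n) g : measurable_fun setT (g : _ -> TR) ->
  (forall s t, (forall j, j != i -> tnth s j = tnth t j) -> g s = g t) ->
  forall A, measurable A -> mu n (shear i g @^-1` A) = mu n A.
Proof.
elim: n => [|n IH] in i g *; first by case: i.
move=> mg ig A mA /=; rewrite /cons_measure /pushforward.
set B := tcons @^-1` A.
have mB : measurable B.
  by rewrite -[X in measurable X]setTI; apply: measurable_tuple_cons.
have mS : measurable (tcons @^-1` (shear i g @^-1` A)).
  rewrite -[X in measurable X]setTI; apply: measurable_tuple_cons => //.
  by rewrite -[X in measurable X]setTI; apply: measurable_shear.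
have fub X : measurable X -> (lebesgue_measure \x mu n)%E X =
    (\int[mu n]_s lebesgue_measure (ysection X s))%E.
  move=> mX; have := indic_fubini_tonelli (@lebesgue_measure R) (mu n) mX.
  under eq_integral do rewrite indic_fubini_tonelli_FE//.
  under [in RHS]eq_integral do rewrite indic_fubini_tonelli_GE//.
  by [].
case: (unliftP ord0 i) => [j|] iE.
  rewrite /product_measure1; apply: eq_integral => x _ /=.
  have mgx : measurable_fun setT (fun s : n.-tuple TR => g (tcons (x, s)) : TR).
    apply: measurableT_comp => //; apply: measurableT_comp; first exact: measurable_tuple_cons.
    exact: measurable_pair1.
  rewrite -[RHS](IH j _ mgx) //; first last.
  - exact: measurable_xsection.
  - move=> s t st; apply: ig => k ki; case: (unliftP ord0 k) => [l kE|->] //.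
    rewrite kE !tnthS; apply: st; apply: contra ki => /eqP le; apply/eqP.
    by rewrite kE iE le.
  rewrite (_ : xsection _ _ = shear j (fun t => g (tcons (x, t))) @^-1` xsection B x)//.
  by apply/seteqP; split=> s; rewrite /= !xsectionE /B /= iE shear_cons_lift.
rewrite !fub//; apply: eq_integral => s _.
rewrite -[RHS](lebesgue_measure_shift (g (tcons (0 : TR, s)))); last exact: measurable_ysection.
have gE x : g (tcons (x, s)) = g (tcons (0 : TR, s)).
  by apply: ig => k; rewrite iE; case: (unliftP ord0 k) => [l ->|->]; rewrite ?eqxx// !tnthS.
rewrite [in LHS](_ : ysection _ _ =
  (fun x => x + g (tcons (0 : TR, s)) : TR) @^-1` ysection B s)//.
by apply/seteqP; split=> x; rewrite /= !ysectionE /B /= iE shear_cons0 (gE x).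
Qed.

End TupleMeasure.

Section Coordinates.
Context {R : realType} {n : nat}.
Local Notation C := R[i].
Local Notation Cn := 'rV[C]_n.
Local Notation TR := (measurableTypeR R).
Local Notation RR := ((n + n).-tuple TR).
Local Notation oc := (@of_coords R n).
Local Notation lb := (@leb2n R n).
Implicit Types (z w : Cn) (s t : RR) (K U Om : set Cn) (u : Cn -> \bar R).

Lemma of_coords_Re t j : complex.Re (oc t 0 j) = tnth t (lshift n j).
Proof. by rewrite mxE. Qed.

Lemma of_coords_Im t j : complex.Im (oc t 0 j) = tnth t (rshift n j).
Proof. by rewrite mxE. Qed.

Definition to_coords z : RR :=
  [tuple match fintype.split i with inl j => complex.Re (z 0 j) | inr j => complex.Im (z 0 j) end | i < n + n].

Lemma to_coordsK z : oc (to_coords z) = z.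
Proof.
apply/rowP => j; apply/eqP; rewrite eq_complex of_coords_Re of_coords_Im !tnth_mktuple.
by rewrite (unsplitK (inl j)) (unsplitK (inr j)) !eqxx.
Qed.

Lemma of_coords_coord s t i : `|tnth s i - tnth t i| <= enorm (oc s - oc t).
Proof.
have [j ->|j ->] := split_ordP i.
  apply: le_trans (cabs_le_enorm (oc s - oc t) j); apply: le_trans (Re_le_cabs _).
  by rewrite !mxE.
apply: le_trans (cabs_le_enorm (oc s - oc t) j); apply: le_trans (Im_le_cabs _).
by rewrite !mxE.
Qed.

Lemma of_coords_dist s t (r : R) : 0 <= r -> (forall i, `|tnth s i - tnth t i| <= r) ->
  enorm (oc s - oc t) <= n%:R * (2 * r).
Proof.
move=> r0 h; apply: enorm_le_cabs => [|j]; first by rewrite mulr_ge0.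
apply: le_trans (cabs_le_ReIm _) _; rewrite !mxE /= mulr_natl mulr2n.
by apply: lerD; exact: h.
Qed.

Definition cbox (c : RR) (r : R) := [set t : RR | forall i, `|tnth t i - tnth c i| <= r].

Let cboxE c r : cbox c r = [set t | forall i, `[tnth c i - r, tnth c i + r]%classic (tnth t i)].
Proof.
apply/seteqP; split=> t h i; have := h i; rewrite /= in_itv/= ler_distl//.
Qed.

Let box c r (i : 'I_(n + n)) : set TR := `[tnth c i - r, tnth c i + r]%classic.

Let mbox c r i : measurable (box c r i).
Proof. exact: measurable_itv. Qed.

Lemma measurable_cbox c r : measurable (cbox c r).
Proof. by rewrite cboxE; exact: (tuple_measure_box (mbox c r)).1. Qed.

Lemma leb2n_cbox c (r : R) : 0 < r -> lb (cbox c r) = ((2 * r) ^+ (n + n))%:E.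
Proof.
move=> r0; rewrite cboxE /leb2n; apply: eq_trans (tuple_measure_box (mbox c r)).2 _.
rewrite (eq_bigr (fun=> (2 * r)%:E)); last first.
  move=> i _; have := @lebesgue_measure_itv R `[tnth c i - r, tnth c i + r]; rewrite /= => ->.
  rewrite lte_fin (_ : _ < _); last by lra.
  by rewrite -EFinB; congr (_%:E); ring.
by rewrite prodEFin prodr_const card_ord.
Qed.

(** The preimage is the union of the countably many cubes with rational centres and half-sides 1/(m
    + 1) that it contains. *)
Lemma measurable_of_coords_open U : open U -> measurable (oc @^-1` U).
Proof.
move=> oU.
pose F (p : (n + n).-tuple rat * nat) : set RR :=
  let c := [tuple ratr (tnth p.1 i) : TR | i < n + n] in
  if `[< cbox c p.2.+1%:R^-1 `<=` oc @^-1` U >] then cbox c p.2.+1%:R^-1 else set0.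
rewrite (_ : _ @^-1` _ = \bigcup_p F p).
  apply: countable_bigcupT_measurable => [|p]; first exact: countableP.
  by rewrite /F; case: asboolP => _; [exact: measurable_cbox|exact: measurable0].
apply/seteqP; split=> [t Ut|t [p _]]; last by rewrite /F; case: asboolP => // h /h.
have [e e0 he] := open_near oU Ut.
have q0 : 0 < 4 * n%:R + 1 :> R by rewrite ltr_wpDl// mulr_ge0.
have [m hm] : exists m, (m.+1%:R^-1 : R) < e / (4 * n%:R + 1).
  have [m hm] := @ltr_add_invr R 0 (e / (4 * n%:R + 1)) ltac:(by rewrite divr_gt0).
  by exists m; rewrite add0r in hm.
pose d : R := m.+1%:R^-1; have d0 : 0 < d by rewrite invr_gt0.
have hd : n%:R * (2 * (2 * d)) < e.
  by move: hm; rewrite -/d ltr_pdivlMr//; lra.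
have hq i : exists q : rat, `|tnth t i - ratr q| <= d.
  have [|q] := @rat_in_itvoo R (tnth t i - d) (tnth t i + d); first by lra.
  by rewrite in_itv/= => /andP[h1 h2]; exists q; rewrite ler_distl; apply/andP; split; lra.
pose p := ([tuple sval (cid (hq i)) | i < n + n], m).
have hp i : tnth [tuple ratr (tnth p.1 i) : TR | i < n + n] i = ratr (sval (cid (hq i))).
  by rewrite !tnth_mktuple.
exists p => //; rewrite /F asboolT.
  by move=> i; rewrite hp; exact: svalP (cid (hq i)).
move=> s hs; apply: he; apply: le_lt_trans hd; apply: of_coords_dist => [|i].
  by rewrite mulr_ge0// ltW.
have := svalP (cid (hq i)); have := hs i; rewrite hp /= -/d !ler_distl.
by move=> /andP[? ?] /andP[? ?]; apply/andP; split; lra.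
Qed.

Lemma measurable_of_coords_compact K : compact K -> measurable (oc @^-1` K).
Proof.
move=> cK; have oK : open (~` K).
  by apply: closed_openC; apply: compact_closed cK; exact: norm_hausdorff.
have := measurableC (measurable_of_coords_open oK).
by rewrite -preimage_setC setCK.
Qed.

Lemma measurable_usc_of_coords Om u (B : set RR) : open Om -> usc_on Om u ->
  measurable B -> B `<=` oc @^-1` Om -> measurable_fun B (u \o oc).
Proof.
move=> oO uu mB BO.
rewrite (_ : u \o oc = (fun t => - (- (u \o oc) t))%E); last by apply/funext => t; rewrite oppeK.
apply: measurableT_comp => //.
apply: (measurability _ (ErealGenOInfty.measurableE R)) => //.
move=> /= _ [_ [c ->]] <-.
pose U := [set w | Om w /\ (u w < (- c)%:E)%E].
rewrite (_ : _ `&` _ = B `&` oc @^-1` U).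
  apply: measurableI => //; apply: measurable_of_coords_open; apply: openP => z [Oz uz].
  have [r r0 h] := usc_on_near uu Oz uz; have [r' r0' h'] := open_near oO Oz.
  exists (Num.min r r'); first by rewrite lt_min r0.
  by move=> w; rewrite lt_min => /andP[wr /h' Ow]; split=> //; exact: h.
apply/seteqP; split=> t [Bt] /=; rewrite in_itv/= andbT lteNr -EFinN.
  by move=> h; split=> //; split=> //; exact: BO.
by move=> [].
Qed.

Lemma compact_cbox K : compact K -> exists2 r : R, 0 < r & oc @^-1` K `<=` cbox (to_coords 0) r.
Proof.
move=> cK.
have [K0|/set0P K0] := eqVneq K set0; first by exists 1 => // t; rewrite K0.
have [z c Kz zc|z Kz zm] := usc_max (f := @enorm R n) cK K0.
  apply/nbhs_enormP; exists (c - enorm z); first by rewrite subr_gt0.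
  by move=> w wz _; have := enormD (w - z) z; rewrite subrK; lra.
exists (enorm z + 1); first by rewrite ltr_wpDl ?enorm_ge0.
move=> t /= /zm tz i; apply: le_trans (of_coords_coord _ _ _) _.
by rewrite to_coordsK subr0; lra.
Qed.

Lemma leb2n_compact K : compact K -> (lb (oc @^-1` K) < +oo)%E.
Proof.
move=> cK; have [r r0 h] := compact_cbox cK.
apply: (@le_lt_trans _ _ (lb (cbox (to_coords 0) r))).
  apply: le_measure => //; rewrite inE; last exact: measurable_cbox.
  exact: measurable_of_coords_compact.
by rewrite leb2n_cbox// ltry.
Qed.

End Coordinates.

(** * Local integrability of logarithmic singularities *)

Section LogIntegrable.
Context {R : realType} {n : nat}.
Hypothesis n0 : (0 < n)%N.
Local Notation C := R[i].
Local Notation Cn := 'rV[C]_n.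
Local Notation TR := (measurableTypeR R).
Local Notation RR := ((n + n).-tuple TR).
Local Notation oc := (@of_coords R n).
Local Notation lb := (@leb2n R n).
Implicit Types (z w a : Cn) (s t : RR) (K U Om : set Cn) (u : Cn -> \bar R).

(** The number [logsum] of cubes of half-side D exp(- m) that contain a point dominates minus the
    logarithm of its distance to [a] over [D], and is integrable because the volumes of the cubes
    decrease geometrically. *)
Let lbox a (D : R) (m : nat) : set RR := cbox (to_coords a) (D * expR (- m%:R)).
Let logsum a D t : \bar R := (\sum_(m <oo) (\1_(lbox a D m) t)%:E)%E.

Let logsum_ge0 a D t : (0 <= logsum a D t)%E.
Proof. by apply: nneseries_ge0 => m _ _; rewrite lee_fin. Qed.

Let logsum_ge a (D : R) t : 0 < D -> (- elog (enorm (oc t - a) / D) <= logsum a D t)%E.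
Proof.
move=> D0; rewrite leeNl; have := logsum_ge0 a D t.
case E : (logsum a D t) => [h||] //=; rewrite ?leNye// lee_fin => h0.
rewrite leNgt; apply/negP => hx.
have x0 : 0 <= enorm (oc t - a) / D by rewrite divr_ge0 ?enorm_ge0// ltW.
have ht := truncn_le h; rewrite h0 in ht.
(* If minus the logarithm exceeded the count [h], the point would lie in all cubes with m <= floor
   h, that is, in more than [h] of them. *)
have hS : ((Num.truncn h).+1%:R%:E <= logsum a D t)%E.
  apply: le_trans (nneseries_lim_ge (Num.truncn h).+1 _); last by move=> m _ _; rewrite lee_fin.
  rewrite big_mkord (eq_bigr (fun=> 1%:E)).
    by rewrite sumEFin sumr_const card_ord.
  move=> m _; rewrite indicE (_ : _ \in _ = true)//; apply/mem_set => i.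
  apply: le_trans (of_coords_coord _ _ _) _; rewrite to_coordsK.
  rewrite mulrC -ler_pdivrMr//; apply: ltW; rewrite -elog_lt//.
  apply: lt_le_trans hx _; rewrite lee_fin lerN2; apply: le_trans ht.
  by rewrite ler_nat -ltnS.
move: hS; rewrite E lee_fin leNgt => /negP; apply; exact: truncnS_gt.
Qed.

Let measurable_lbox a D m : measurable (lbox a D m).
Proof. exact: measurable_cbox. Qed.

Let measurable_ind a D m : measurable_fun setT (fun t => (\1_(lbox a D m) t)%:E : \bar R).
Proof. by apply/measurable_EFinP; apply: measurable_indic. Qed.

Let measurable_logsum a D : measurable_fun setT (logsum a D).
Proof. by apply: ge0_emeasurable_sum => [m t _ _|m _]; rewrite ?lee_fin. Qed.

Let logsum_integrable a (D : R) : 0 < D -> lb.-integrable setT (logsum a D).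
Proof.
move=> D0; apply/integrableP; split; first exact: measurable_logsum.
under eq_integral do rewrite gee0_abs//.
rewrite integral_nneseries//.
(* The m-th volume is at most (2 D)^(2n) / 2^m, as exp(- m) <= 2^(- m) and 2n >= 1; the summation
   rule uses 2^(m+1), whence the factor 2. *)
apply: (@le_lt_trans _ _ (2 * (2 * D) ^+ (n + n))%:E); last exact: ltry.
apply: le_trans (epsilon_trick0 xpredT _); last by rewrite mulr_ge0// exprn_ge0// mulr_ge0// ltW.
apply: lee_nneseries => [m _ _|m _]; first by apply: integral_ge0 => t _; rewrite lee_fin.
have s0 : 0 < D * expR (- m%:R) by rewrite mulr_gt0// expR_gt0.
have -> : (\int[lb]_t (\1_(lbox a D m) t)%:E = ((2 * (D * expR (- m%:R))) ^+ (n + n))%:E)%E.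
  by rewrite integral_indic// setIT; exact: leb2n_cbox.
rewrite lee_fin mulrA exprMn.
have e0 : 0 <= expR (- m%:R) :> R by exact: expR_ge0.
have e1 : expR (- m%:R) <= 1 :> R by rewrite -expR0 ler_expR oppr_le0.
have e2 : expR (- m%:R) <= (2 ^+ m)^-1 :> R.
  rewrite expRN lef_pV2 ?posrE ?expR_gt0 ?exprn_gt0//.
  rewrite -[m%:R]mulr1 mulrC expRM_natr lerXn2r ?nnegrE ?expR_ge0//.
  by have := expR_ge1Dx (1 : R); lra.
have p0 : (2 ^+ m : R) != 0 by rewrite expf_neq0.
have -> (X : R) : 2 * X / (2 ^ m.+1)%:R = X * (2 ^+ m)^-1 by rewrite natrX exprS; field.
apply: ler_wpM2l; first by rewrite exprn_ge0// mulr_ge0// ltW.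
apply: le_trans e2; rewrite -[leRHS]expr1; apply: ler_wiXn2l => //.
by rewrite addn_gt0 n0.
Qed.

Lemma log_integrable Om u (D : R) M (a : M.-tuple Cn) (K : set Cn) :
  open Om -> usc_on Om u -> (forall z, Om z -> (u z <= 0)%E) -> 0 < D ->
  (forall z, Om z -> (\sum_(j < M) elog (enorm (z - tnth a j) / D) <= u z)%E) ->
  compact K -> K `<=` Om -> lb.-integrable (oc @^-1` K) (u \o oc).
Proof.
move=> oO uu u0 D0 ua cK KO; have mK := measurable_of_coords_compact cK.
apply: (le_integrable mK) (fun t => \sum_(j < M) logsum (tnth a j) D t)%E _ _ _.
- by apply: (measurable_usc_of_coords oO uu mK) => t /KO.
- move=> t /= /KO Ot; rewrite (lee0_abs (u0 _ Ot)) gee0_abs; last first.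
    by apply: sume_ge0 => j _; exact: logsum_ge0.
  rewrite leeNl; apply: le_trans (ua _ Ot).
  rewrite -sumeN; last first.
    move=> i j _ _; apply: ge0_adde_def; rewrite inE; exact: logsum_ge0.
  by apply: lee_sum => j _; rewrite leeNl; exact: logsum_ge.
- apply: (integrable_sum mK) => j _.
  exact: (integrableS measurableT mK (@subsetT _ _) (logsum_integrable _ D0)).
Qed.

End LogIntegrable.

(** * Rotations and translations of C^n preserve Lebesgue measure *)

Section Rotation.
Context {R : realType} {n : nat}.
Local Notation C := R[i].
Local Notation Cn := 'rV[C]_n.
Local Notation TR := (measurableTypeR R).
Local Notation RR := ((n + n).-tuple TR).
Local Notation oc := (@of_coords R n).
Local Notation lb := (@leb2n R n).
Implicit Types (z w a : Cn) (s t : RR) (A N : set RR).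

Definition mpres (f : RR -> RR) := measurable_fun setT f /\
  forall A, measurable A -> lb (f @^-1` A) = lb A.

Lemma mpres_id : mpres id.
Proof. by split; first exact: measurable_id. Qed.

Lemma mpres_comp f g : mpres f -> mpres g -> mpres (f \o g).
Proof.
move=> [mf hf] [mg hg]; split; first exact: measurableT_comp.
move=> A mA; rewrite comp_preimage hg ?hf//.
by rewrite -[X in measurable X]setTI; exact: mf.
Qed.

Lemma mpres_foldr (f : 'I_n -> RR -> RR) (l : seq 'I_n) : (forall j, mpres (f j)) ->
  mpres (fun t => foldr f t l).
Proof.
move=> hf; elim: l => [|j l IH]; first exact: mpres_id.
exact: (mpres_comp (hf j) IH).
Qed.

Lemma mpres_shear i g : measurable_fun setT (g : RR -> TR) ->
  (forall s t, (forall j, j != i -> tnth s j = tnth t j) -> g s = g t) -> mpres (shear i g).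
Proof.
by move=> mg ig; split; [exact: measurable_shear|exact: shear_measure].
Qed.

Let shear_scale i j (c : R) : i != j -> mpres (shear i (fun t => c * tnth t j)).
Proof.
move=> ij; apply: mpres_shear => [|s t st]; last by rewrite st// eq_sym.
apply: measurable_funM; first exact: measurable_cst.
exact: measurable_tnth.
Qed.

(** The rotation by [x] of one complex coordinate, factored into three shears; the coefficient of
    the outer ones is - tan (x / 2). *)
Let rot1 (x : R) j t :=
  let A := shear (lshift n j) (fun t => - ((1 - cos x) / sin x) * tnth t (rshift n j)) in
  let B := shear (rshift n j) (fun t => sin x * tnth t (lshift n j)) in
  A (B (A t)).

Let mpres_rot1 x j : mpres (rot1 x j).
Proof.
have hA : mpres (shear (lshift n j) (fun t => - ((1 - cos x) / sin x) * tnth t (rshift n j))).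
  by apply: shear_scale; rewrite eq_lrshift.
have hB : mpres (shear (rshift n j) (fun t => sin x * tnth t (lshift n j))).
  by apply: shear_scale; rewrite eq_rlshift.
exact: mpres_comp hA (mpres_comp hB hA).
Qed.

Let rot1E x j t k : sin x != 0 ->
  oc (rot1 x j t) 0 k = if k == j then cis x * oc t 0 k else oc t 0 k.
Proof.
move=> sx; have c2 := cos2Dsin2 x.
rewrite /rot1; set tau := (1 - cos x) / sin x.
have h1 : sin x * tau = 1 - cos x by rewrite mulrC divfK.
have h2 : tau * (1 + cos x) = sin x.
  apply: (mulfI sx); rewrite mulrA h1 -expr2; move: c2; generalize (sin x) (cos x) => a b h.
  by rewrite (_ : a ^+ 2 = 1 - b ^+ 2); [ring|lra].
apply/eqP; rewrite eq_complex; apply/andP; split; apply/eqP.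
  rewrite of_coords_Re !tnth_mktuple !eq_lshift !eqxx ?eq_lrshift ?eq_rlshift ?eqxx /=.
  case: eqP => [->|_]; last by rewrite mxE.
  rewrite !mxE /=.
  rewrite (_ : _ + _ = (1 - sin x * tau) * tnth t (lshift n j) -
    (tau * (1 + (1 - sin x * tau))) * tnth t (rshift n j)); last by ring.
  by rewrite h1 subKr h2.
rewrite of_coords_Im !tnth_mktuple ?eq_rshift ?eq_lrshift ?eq_rlshift ?eqxx /=.
case: eqP => [->|_]; last by rewrite mxE.
rewrite !mxE /=.
rewrite (_ : _ + _ = (1 - sin x * tau) * tnth t (rshift n j) + sin x * tnth t (lshift n j)); last by ring.
by rewrite h1 subKr.
Qed.

Definition rotc x z t := to_coords (z + cis x *: oc t).

Let coordsK t : to_coords (oc t) = t.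
Proof.
apply: eq_from_tnth => i; rewrite tnth_mktuple.
have [j ->|j ->] := split_ordP i.
  by rewrite mxE.
by rewrite mxE.
Qed.

Let to_coords_inj s t : oc s = oc t -> s = t.
Proof. by move=> st; rewrite -(coordsK s) st coordsK. Qed.

Let mpres_lrot x : sin x != 0 -> mpres (rotc x 0).
Proof.
move=> sx; have -> : rotc x 0 = (fun t => foldr (rot1 x) t (enum 'I_n)).
  apply/funext => t; apply: to_coords_inj; rewrite to_coordsK add0r.
  apply/rowP => k.
  have h l : uniq l -> oc (foldr (rot1 x) t l) 0 k = if k \in l then cis x * oc t 0 k else oc t 0 k.
    elim: l => // j l IH /= /andP[jl ul]; rewrite rot1E// inE IH//.
    by case: eqP => //= ->; rewrite (negPf jl).
  by rewrite h ?enum_uniq// mem_enum mxE.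
by apply: mpres_foldr => j; exact: mpres_rot1.
Qed.

Let mpres_trans z : mpres (rotc 0 z).
Proof.
pose f j t := shear (lshift n j) (fun=> complex.Re (z 0 j)) (shear (rshift n j) (fun=> complex.Im (z 0 j)) t).
have -> : rotc 0 z = (fun t => foldr f t (enum 'I_n)).
  apply/funext => t; apply: to_coords_inj; rewrite to_coordsK cis0 scale1r.
  apply/rowP => k.
  have h l : uniq l -> oc (foldr f t l) 0 k = if k \in l then z 0 k + oc t 0 k else oc t 0 k.
    elim: l => // j l IH /= /andP[jl ul].
    have fE s : oc (f j s) 0 k = if k == j then z 0 k + oc s 0 k else oc s 0 k.
      apply/eqP; rewrite eq_complex; apply/andP; split; apply/eqP.
        rewrite of_coords_Re /f !tnth_mktuple ?eq_lshift ?eq_lrshift ?eq_rlshift ?eqxx /=.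
        by case: eqP => [->|_]; rewrite mxE//=; case: (z 0 j) => zr zi /=; rewrite addrC.
      rewrite of_coords_Im /f !tnth_mktuple ?eq_rshift ?eq_lrshift ?eq_rlshift ?eqxx /=.
      by case: eqP => [->|_]; rewrite mxE//=; case: (z 0 j) => zr zi /=; rewrite addrC.
    rewrite fE inE IH//.
    by case: eqP => //= ->; rewrite (negPf jl).
  by rewrite h ?enum_uniq// mem_enum mxE.
apply: mpres_foldr => j.
apply: (mpres_comp (f := shear _ _) (g := shear _ _)); apply: mpres_shear => //; exact: measurable_cst.
Qed.

(* A rotation is the square of its half, so only half angles with a non
   vanishing sine have to be decomposed into shears. *)
Lemma mpres_rotc x z : mpres (rotc x z).
Proof.
have [s0|s0] := eqVneq (sin (x / 2)) 0.
  suff -> : rotc x z = rotc 0 z by exact: mpres_trans.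
  have c2 := cos2Dsin2 (x / 2).
  have -> : x = x / 2 + x / 2 by lra.
  apply/funext => t; rewrite /rotc cisD cis0; congr (to_coords (_ + _ *: _)).
  apply/eqP; rewrite eq_complex /= s0 !mulr0 mul0r subr0 addr0 eqxx andbT -expr2.
  by move: c2; rewrite s0 expr0n addr0 => ->.
have -> : rotc x z = rotc 0 z \o (rotc (x / 2) 0 \o rotc (x / 2) 0).
  apply/funext => t; rewrite /rotc /= !to_coordsK cis0 scale1r !add0r scalerA -cisD.
  by congr (to_coords (_ + cis _ *: _)); lra.
by apply: mpres_comp => //; apply: mpres_comp; exact: mpres_lrot.
Qed.

Lemma measurable_rotc z : measurable_fun setT (fun p : TR * RR => rotc p.1 z p.2).
Proof.
apply/measurable_fun_tnthP => i.
have mt j : measurable_fun setT (fun p : TR * RR => tnth p.2 j : TR).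
  have h := @measurable_tnth _ TR _ j.
  have h2 := @measurable_snd _ _ TR RR.
  exact: (measurableT_comp h h2).
have mc : measurable_fun setT (fun p : TR * RR => cos p.1 : TR).
  apply: (@measurableT_comp _ _ _ _ _ _ (cos : TR -> TR) _ fst); last exact: measurable_fst.
  by apply: continuous_measurable_fun; exact: continuous_cos.
have ms : measurable_fun setT (fun p : TR * RR => sin p.1 : TR).
  apply: (@measurableT_comp _ _ _ _ _ _ (sin : TR -> TR) _ fst); last exact: measurable_fst.
  by apply: continuous_measurable_fun; exact: continuous_sin.
have [j ->|j ->] := split_ordP i.
  rewrite (_ : _ \o _ = fun p => complex.Re (z 0 j) +
    (cos p.1 * tnth p.2 (lshift n j) - sin p.1 * tnth p.2 (rshift n j))); last first.
    by apply/funext => p /=; rewrite -of_coords_Re to_coordsK !mxE; case: (z 0 j).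
  have h1 := measurable_funM mc (mt (lshift n j)).
  have h2 := measurable_funM ms (mt (rshift n j)).
  exact: measurable_funD (measurable_cst _) (measurable_funB h1 h2).
rewrite (_ : _ \o _ = fun p => complex.Im (z 0 j) +
  (cos p.1 * tnth p.2 (rshift n j) + sin p.1 * tnth p.2 (lshift n j))); last first.
  by apply/funext => p /=; rewrite -of_coords_Im to_coordsK !mxE; case: (z 0 j).
have h1 := measurable_funM mc (mt (rshift n j)).
have h2 := measurable_funM ms (mt (lshift n j)).
exact: measurable_funD (measurable_cst _) (measurable_funD h1 h2).
Qed.

End Rotation.

(** * Almost everywhere equality and convergence in the mean *)

Section PshUnique.
Context {R : realType} {n : nat}.
Hypothesis n0 : (0 < n)%N.
Local Notation C := R[i].
Local Notation Cn := 'rV[C]_n.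
Local Notation TR := (measurableTypeR R).
Local Notation RR := ((n + n).-tuple TR).
Local Notation oc := (@of_coords R n).
Local Notation lb := (@leb2n R n).
Local Notation I2 := (`[0, (2 * pi)%R]%classic : set TR).
Implicit Types (z w a : Cn) (s t : RR) (A N : set RR) (Om : set Cn) (u v : Cn -> \bar R).

(** Tonelli on pairs of an angle and a vector: every rotation preserves the null set, so for almost
    every vector the circle meets [N] in a null set of angles. Such a vector exists in any cube of
    positive volume. *)
Lemma circle_avoids_null N z (r : R) : measurable N -> lb N = 0%E -> 0 < r ->
  exists2 b : Cn, 0 < enorm b < r &
  exists X : set TR, [/\ measurable X, lebesgue_measure X = 0%E &
    forall x, I2 x -> ~ X x -> ~ N (to_coords (z + cis x *: b))].
Proof.
move=> mN N0 r0.
pose E : set (TR * RR) := (fun p => rotc p.1 z p.2) @^-1` N.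
have mE : measurable E.
  by rewrite -[X in measurable X]setTI; apply: (@measurable_rotc R n z).
have E0 : (\int[lb]_t lebesgue_measure (ysection E t) = 0)%E.
  have := indic_fubini_tonelli (@lebesgue_measure R) lb mE.
  under eq_integral do rewrite indic_fubini_tonelli_FE//.
  under [in RHS]eq_integral do rewrite indic_fubini_tonelli_GE//.
  move=> <-; apply: integral0_eq => x _ /=.
  rewrite (_ : xsection E x = rotc x z @^-1` N); first by rewrite (mpres_rotc x z).2.
  by apply/seteqP; split=> t; rewrite /= xsectionE.
have mf : measurable_fun setT (fun t : RR => lebesgue_measure (ysection E t)).
  exact: measurable_fun_ysection.
have /(ae_eq_integral_abs lb measurableT mf) [X [mX X0 XE]] :
    (\int[lb]_t `|lebesgue_measure (ysection E t)| = 0)%E.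
  by under eq_integral do rewrite gee0_abs//.
pose d : R := r / (n%:R * 2 * 3 + 1).
have q0 : 0 < n%:R * 2 * 3 + 1 :> R by rewrite ltr_wpDl// !mulr_ge0.
have d0 : 0 < d by rewrite divr_gt0.
have dE : d * (n%:R * 2 * 3 + 1) = r by rewrite divfK// gt_eqF.
(* The cube of half-side [d] around this centre has all coordinates in [d, 3 d], so its points are
   nonzero and [d] makes their norm less than [r]. *)
pose c : RR := [tuple 2 * d | i < n + n].
have [t ct Xt] : exists2 t, cbox c d t & ~ X t.
  apply: contrapT => h; have : (lb (cbox c d) <= lb X)%E.
    apply: le_measure; rewrite ?inE//; first exact: measurable_cbox.
    by move=> t ct; apply: contrapT => Xt; apply: h; exists t.
  rewrite leb2n_cbox// X0 lee_fin leNgt => /negP; apply.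
  by rewrite exprn_gt0// mulr_gt0.
have ci i : d <= tnth t i <= 3 * d.
  have := ct i; rewrite tnth_mktuple ler_distl => /andP[? ?]; apply/andP; split; lra.
exists (oc t).
  apply/andP; split.
    have /andP[h _] := ci (lshift n (Ordinal n0)).
    apply: lt_le_trans (cabs_le_enorm _ (Ordinal n0)); apply: lt_le_trans (Re_le_cabs _).
    by rewrite mxE /= ger0_norm; lra.
  have -> : oc t = oc t - oc [tuple (0 : TR) | i < n + n].
    by rewrite (_ : oc [tuple _ | i < _] = 0) ?subr0//; apply/rowP => j; rewrite !mxE !tnth_mktuple.
  apply: (@le_lt_trans _ _ (n%:R * (2 * (3 * d)))).
    apply: of_coords_dist; first by rewrite mulr_ge0// ltW.
    by move=> i; rewrite tnth_mktuple subr0; have /andP[? ?] := ci i; rewrite ger0_norm//; lra.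
  by rewrite -dE; lra.
exists (ysection E t); split.
- exact: measurable_ysection.
- by apply: contrapT => h; apply: Xt; apply: XE => /= H; apply: h; exact: H.
- by move=> x _; rewrite ysectionE.
Qed.

(** On a suitable small circle the means of [u] and [v] coincide; the first is at least [u z], and
    the second at most any [c > v z] by upper semicontinuity. *)
Lemma psh_le_null Om u v N z (r : R) : open Om -> psh Om u -> psh Om v -> Om z -> 0 < r ->
  measurable N -> lb N = 0%E ->
  (forall w, w != z -> enorm (w - z) < r -> ~ N (to_coords w) -> u w = v w) ->
  (u z <= v z)%E.
Proof.
move=> oO pu pv Oz r0 mN N0 uv; apply: lee_realP => c vc.
have [r1 r10 h1] := open_near oO Oz.
have [r2 r20 h2] := usc_on_near pv.1 Oz vc.
have [|b] := circle_avoids_null z mN N0 (r := Num.min r (Num.min r1 r2)).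
  by rewrite !lt_min r0 r10.
rewrite !lt_min => /and4P[b0 br br1 br2] [X [mX X0 hX]].
have dz x : enorm (z + cis x *: b - z) = enorm b by rewrite addrAC subrr add0r enorm_cisZ.
have Ob (t : C) : cabs t <= 1 -> Om (z + t *: b).
  move=> t1; apply: h1; rewrite addrAC subrr add0r enormZ; apply: le_lt_trans br1.
  by rewrite ler_piMl// enorm_ge0.
have Oc x : Om (z + cis x *: b) by apply: Ob; rewrite cabs_cis.
apply: le_trans (psh_submean pu Ob) _.
have mu_ := usc_circle_measurable pu.1 Oc; have mv := usc_circle_measurable pv.1 Oc.
have -> : lmean u z b = lmean v z b.
  congr (_ * _)%E; apply: ae_eq_integral; [exact: measurable_I2|exact: mu_|exact: mv|].
  exists X; split=> // x /= h; apply: contrapT => Xx; apply: h => Ix.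
  apply: uv; [|by rewrite dz|exact: hX].
  by rewrite -subr_eq0 -enorm_eq0 dz gt_eqF.
rewrite -(cmean_cst c%:E); apply: cmean_le => //.
by move=> x _; apply/ltW/h2 => //; rewrite dz.
Qed.

Lemma psh_ae_unique Om u v (P : seq Cn) : open Om -> psh Om u -> psh Om v ->
  (forall K, compact K -> K `<=` Om `\` poles P ->
    {ae lb, forall t, K (oc t) -> u (oc t) = v (oc t)}) ->
  forall z, Om z -> u z = v z.
Proof.
move=> oO pu pv uv z Oz.
have [r1 r10 h1] := open_near oO Oz.
have [r2 r20 h2] : exists2 r : R, 0 < r & forall w, w \in P -> w != z -> r <= enorm (w - z).
  elim: P {uv} => [|p P [r r0 IH]]; first by exists 1.
  have [->|pz] := eqVneq p z.
    by exists r => // w; rewrite inE => /predU1P[->|/IH//]; rewrite eqxx.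
  exists (Num.min r (enorm (p - z))).
    by rewrite lt_min r0 enorm_pos subr_eq0.
  move=> w; rewrite inE ge_min => /predU1P[-> _|wP wz]; first by rewrite lexx orbT.
  by rewrite IH.
pose r := Num.min r1 r2 / 2.
have [r0 rr1 rr2] : [/\ 0 < r, r < r1 & r < r2].
  have h1' : Num.min r1 r2 <= r1 by rewrite ge_min lexx.
  have h2' : Num.min r1 r2 <= r2 by rewrite ge_min lexx orbT.
  have h3' : 0 < Num.min r1 r2 by rewrite lt_min r10.
  by rewrite /r; split; lra.
(* Closed annuli exhausting a punctured ball around [z]: compact sets that avoid [P] even when [z]
   belongs to it. *)
pose K (m : nat) := [set w | m.+1%:R^-1 <= enorm (w - z) /\ enorm (w - z) <= r].
have cK m : compact (K m).
  apply: (subclosed_compact _ (@closed_ball_compact _ _ z r)); last by move=> w [].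
  apply: closed_enormP => w nw; have [ws|sw] := leP (enorm (w - z)) r; last first.
    exists (enorm (w - z) - r); rewrite ?subr_gt0// => y yw [_ ys].
    by have := enorm_triangle y w z; rewrite (enorm_distC w y); lra.
  have ws' : enorm (w - z) < m.+1%:R^-1.
    by rewrite ltNge; apply/negP => h; apply: nw.
  exists (m.+1%:R^-1 - enorm (w - z)); rewrite ?subr_gt0// => y yw [ys _].
  by have := le_lt_trans (le_trans ys (enorm_triangle w y z)) (ltr_leD yw (lexx _)); rewrite subrK ltxx.
have KD m : K m `<=` Om `\` poles P.
  move=> w [wm wr]; split; first by apply: h1; lra.
  move=> wP; have : w != z.
    apply/eqP => wz; move: wm; rewrite wz subrr enorm0 leNgt => /negP; apply.
    by rewrite invr_gt0.
  by move=> /(h2 w wP); lra.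
have [N [mN N0 NK]] := negligible_bigcup (fun m => uv (K m) (cK m) (@KD m)).
have main w : w != z -> enorm (w - z) < r -> ~ N (to_coords w) -> u w = v w.
  move=> wz wr nN; apply: contrapT => huv; apply: nN; apply: NK.
  have [m hm] : exists m, (m.+1%:R^-1 : R) < enorm (w - z).
    have [|m hm] := @ltr_add_invr R 0 (enorm (w - z)); first by rewrite enorm_pos subr_eq0.
    by exists m; rewrite add0r in hm.
  exists m => //= h; apply: huv; rewrite -[w]to_coordsK; apply: h.
  by rewrite to_coordsK; split; exact: ltW.
apply/eqP; rewrite eq_le; apply/andP; split; first exact: (psh_le_null oO pu pv Oz r0 mN N0).
by apply: (psh_le_null oO pv pu Oz r0 mN N0) => w wz wr nN; rewrite main.
Qed.

End PshUnique.

Lemma cvg0_ereal_le {R : realType} (f : nat -> \bar R) : (forall k, (0 <= f k)%E) ->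
  f @ \oo --> 0%E <-> forall e : R, 0 < e -> exists N, forall k, (N <= k)%N -> (f k <= e%:E)%E.
Proof.
move=> f0; split=> [/fine_cvgP[ff f1] e e0|h].
  have [N1 _ h1] := ff.
  have /cvgrPdist_le/(_ e e0)[N2 _ h2] := f1.
  exists (maxn N1 N2) => k; rewrite geq_max => /andP[k1 k2].
  rewrite -(fineK (h1 k k1)) lee_fin; have := h2 k k2; rewrite /= sub0r normrN.
  by apply: le_trans; exact: ler_norm.
apply/fine_cvgP; split.
  have [N hN] := h 1 ltr01; exists N => // k /hN fk.
  by rewrite ge0_fin_numE// (le_lt_trans fk)// ltry.
apply/cvgrPdist_le => e e0; have [N hN] := h e e0; exists N => // k /hN fk.
rewrite sub0r normrN ger0_norm ?fine_ge0//=.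
have ff : f k \is a fin_num by rewrite ge0_fin_numE// (le_lt_trans fk)// ltry.
by rewrite -lee_fin fineK.
Qed.

(* True also when some values are infinite, because [+oo - +oo = -oo]. *)
Lemma lee_abs_dist {R : realType} (x y g : \bar R) : (`|x - y| <= `|g - x| + `|g - y|)%E.
Proof.
case: x y g => [x||] [y||] [g||] //; rewrite ?leey//.
rewrite -!EFinB /= -EFinD lee_fin (_ : x - y = - (g - x) + (g - y)); last by ring.
by apply: le_trans (ler_normD _ _) _; rewrite normrN.
Qed.

(** * Convergence in the mean, locally uniform convergence and pointwise convergence *)

Section L1Limit.
Context {R : realType} {n : nat}.
Hypothesis n0 : (0 < n)%N.
Local Notation C := R[i].
Local Notation Cn := 'rV[C]_n.
Local Notation TR := (measurableTypeR R).
Local Notation RR := ((n + n).-tuple TR).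
Local Notation oc := (@of_coords R n).
Local Notation lb := (@leb2n R n).
Implicit Types (u v : Cn -> \bar R) (z w a : Cn).

Let small (f : nat -> RR -> \bar R) (A : set RR) :
  (\int[lb]_(t in A) `|f k t|)%E @[k --> \oo] --> 0%E -> forall e : R, 0 < e ->
  exists N, forall k, (N <= k)%N -> (\int[lb]_(t in A) `|f k t| <= e%:E)%E.
Proof. by apply: (cvg0_ereal_le _).1 => k; apply: integral_ge0. Qed.

Lemma L1loc_limit_ae (D K : set Cn) (u : nat -> Cn -> \bar R) g h :
  cvg_L1loc D u g -> cvg_L1loc D u h -> compact K -> K `<=` D ->
  {ae lb, forall t, K (oc t) -> g (oc t) = h (oc t)}.
Proof.
move=> [iu ig cg] [_ ih ch] cK KD; have mK := measurable_of_coords_compact cK.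
have iuK k := iu k K cK KD; have igK := ig K cK KD; have ihK := ih K cK KD.
have mu_ k := measurable_int _ (iuK k).
have mg := measurable_int _ igK; have mh := measurable_int _ ihK.
have mB (f1 f2 : RR -> \bar R) : measurable_fun (oc @^-1` K) f1 -> measurable_fun (oc @^-1` K) f2 ->
    measurable_fun (oc @^-1` K) (fun t => `|f1 t - f2 t|%E).
  by move=> m1 m2; apply: measurableT_comp => //; exact: emeasurable_funB.
have h0 : (\int[lb]_(t in oc @^-1` K) `|(g \o oc) t - (h \o oc) t| = 0)%E.
  apply/eqP; rewrite eq_le integral_ge0 ?andbT//.
  apply/lee_addgt0Pr => e e0; rewrite add0e.
  have e2 : 0 < e / 2 by rewrite divr_gt0.
  have [N1 h1] := small (cg K cK KD) e2.
  have [N2 h2] := small (ch K cK KD) e2.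
  pose k := maxn N1 N2.
  have m1 := mB _ _ (mu_ k) mg; have m2 := mB _ _ (mu_ k) mh.
  have := leeD (h1 k (leq_maxl _ _)) (h2 k (leq_maxr _ _)).
  rewrite -EFinD -splitr; apply: le_trans.
  rewrite -ge0_integralD//.
  apply: ge0_le_integral => //; first exact: mB.
  - exact: emeasurable_funD m1 m2.
  - by move=> t _; exact: lee_abs_dist.
have mgh : measurable_fun (oc @^-1` K) (fun t => (g \o oc) t - (h \o oc) t)%E.
  exact: emeasurable_funB.
have [X [mX X0 hX]] := (ae_eq_integral_abs lb mK mgh).1 h0.
exists X; split=> // t /= ht; apply: hX => /= gh; apply: ht => Kt.
have /= := gh Kt.
case: (g (oc t)) (h (oc t)) => [x||] [y||] //=.
by rewrite -EFinB => -[] /eqP; rewrite subr_eq0 => /eqP ->.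
Qed.

Lemma closed_ball_pos z (q : R) : 0 < q ->
  (0 < lb (oc @^-1` [set w | (enorm (w - z) <= q)%R]))%E.
Proof.
move=> q0; pose d := q / (n%:R * 2 + 1).
have c0 : 0 < n%:R * 2 + 1 :> R by rewrite ltr_wpDl// mulr_ge0.
have d0 : 0 < d by rewrite divr_gt0.
have dE : d * (n%:R * 2 + 1) = q by rewrite divfK// gt_eqF.
apply: (@lt_le_trans _ _ (lb (cbox (to_coords z) d))).
  by rewrite leb2n_cbox// lte_fin exprn_gt0// mulr_gt0.
apply: le_measure; rewrite ?inE; first exact: measurable_cbox.
  exact: measurable_of_coords_compact (@closed_ball_compact _ _ z q).
move=> t ht /=; rewrite -[z in (_ - z)]to_coordsK.
by apply: le_trans (of_coords_dist (ltW d0) ht) _; rewrite -dE; lra.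
Qed.

Variables (Om : set Cn) (D : R) (rho : Cn -> R).
Hypotheses (oO : open Om) (D0 : 0 < D)
  (OD : forall z w, Om z -> Om w -> enorm (z - w) <= D)
  (rhoc : forall z (e : R), Om z -> 0 < e -> exists2 r : R, 0 < r &
     forall w, enorm (w - z) < r -> `|rho w - rho z| < e)
  (prho : psh Om (EFin \o rho)) (rho0 : forall z, Om z -> rho z < 0)
  (rhos : forall c : R, c < 0 -> exists2 d : R, 0 < d &
     forall z, Om z -> rho z < c -> forall h, enorm h < d -> Om (z + h)).

Variables (M : nat) (T : nat -> M.-tuple Cn) (L : M.-tuple Cn).
Hypothesis TL : icvg Om T L.
Local Notation G := (fun k => green Om (T k)).
Local Notation DL := (Om `\` poles L).

Lemma green_integrable k (K : set Cn) : compact K -> K `<=` Om ->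
  lb.-integrable (oc @^-1` K) (G k \o oc).
Proof.
have [TO _ _] := TL; move=> cK KO.
apply: (log_integrable n0 oO _ _ D0 _ cK KO (a := T k)).
- exact: (green_usc n0 oO D0 OD rhoc prho rho0 rhos (TO k)).
- by move=> z Oz; exact: green_le0.
- by move=> z Oz; exact: (green_ge_sum oO D0 OD rhoc prho rho0 (TO k)).
Qed.

Let compl K : K `<=` DL -> K `<=` Om /\ forall z, K z -> z \notin L.
Proof. by move=> KD; split=> z /KD[Oz /negP]. Qed.

(** By [glim_unif] a single [G N] minus 1 bounds the nonpositive limit from below on a compact set,
    and its integrability is inherited. *)
Lemma glim_ext_L1loc : L1loc DL (glim_ext Om T L).
Proof.
move=> K cK /compl[KO KL]; have mK := measurable_of_coords_compact cK.
have [N /(_ N _ (leqnn N)) hN] := glim_unif oO D0 OD rhoc prho rho0 rhos TL cK KO KL ltr01.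
have [TO _ _] := TL.
have i1 : lb.-integrable (oc @^-1` K) (fun t => (G N \o oc) t - 1%:E)%E.
  apply: (integrableB mK); first exact: green_integrable.
  apply/integrableP; split; first exact: measurable_cst.
  have -> : (fun=> `|1%:E|)%E = cst (1%:E : \bar R) :> (RR -> \bar R) by apply/funext => t; rewrite /= normr1.
  rewrite integral_cst// mul1e; exact: leb2n_compact.
apply: (le_integrable mK _ _ i1).
  apply: (measurable_usc_of_coords oO (glim_ext_usc n0 oO D0 OD rhoc prho rho0 rhos TL) mK).
  by move=> t /KO.
move=> t /= Kt; have Ot := KO _ Kt.
rewrite lee0_abs; last exact: glim_ext_le0.
have g0 := green_le0 (T N) Ot.
rewrite lee0_abs; last by apply: adde_le0 => //; rewrite lee_fin.
rewrite leeN2 /glim_ext (negPf (KL _ Kt)).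
by rewrite EFinN leeBlDr//; exact: hN.
Qed.

Lemma gconv_L1loc : (forall z, Om z -> z \notin L -> gconv G z) ->
  cvg_L1loc DL G (glim_ext Om T L).
Proof.
move=> hc; split=> [k K cK /compl[KO _]||K cK KD]; first exact: green_integrable.
  exact: glim_ext_L1loc.
have [KO KL] := compl KD; have mK := measurable_of_coords_compact cK.
have fK := leb2n_compact cK.
apply/cvg0_ereal_le => [k|e e0]; first by apply: integral_ge0.
pose m := fine (lb (oc @^-1` K)).
have m0 : 0 <= m by exact: fine_ge0.
have mE : lb (oc @^-1` K) = m%:E by rewrite fineK// ge0_fin_numE.
pose d := e / (m + 1).
have d0 : 0 < d by rewrite divr_gt0// ltr_wpDl.
have [N1 h1] := glim_unif oO D0 OD rhoc prho rho0 rhos TL cK KO KL d0.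
have [N2 h2] := gconv_unif oO D0 OD rhoc prho rho0 rhos TL cK KO KL
  (fun z Kz => hc z (KO z Kz) (KL z Kz)) d0.
exists (maxn N1 N2) => k; rewrite geq_max => /andP[k1 k2].
have [TO _ _] := TL.
apply: (@le_trans _ _ (\int[lb]_(t in oc @^-1` K) d%:E)%E).
  apply: ge0_le_integral => //.
  - apply: measurableT_comp => //; apply: emeasurable_funB.
      exact: measurable_int (green_integrable k cK KO).
    exact: measurable_int (glim_ext_L1loc cK KD).
  - move=> t /= Kt; have Ot := KO _ Kt; have Lt := KL _ Kt.
    have := h1 k _ k1 Kt; have := h2 k _ k2 Kt; rewrite /glim_ext (negPf Lt).
    have [x ->] := glim_fin oO D0 OD rhoc prho rho0 TL Ot Lt.
    case: (green Om (T k) (oc t)) => [y||] //; rewrite -!EFinD -?EFinB !lee_fin ler_norml.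
    by move=> *; apply/andP; split; lra.
have -> : (\int[lb]_(t in oc @^-1` K) d%:E = d%:E * m%:E)%E.
  by rewrite -mE; exact: integral_cst.
rewrite -EFinM lee_fin /d mulrAC ler_pdivrMr ?ltr_wpDl//.
by rewrite mulrDr mulr1 lerDl ltW.
Qed.

Let cauchy_gconv z : (forall e : R, 0 < e -> exists N, forall k l, (N <= k)%N -> (N <= l)%N ->
  (G k z <= G l z + e%:E)%E) -> gconv G z.
Proof.
move=> h e /h[N hN]; exists N => l Nl; apply: glim_le; exists N => k Nk; exact: hN.
Qed.

Lemma locunif_gconv g : cvg_locunif DL G g -> forall z, Om z -> z \notin L -> gconv G z.
Proof.
move=> cg z Oz zL; apply: cauchy_gconv => e e0; have e2 : 0 < e / 2 by rewrite divr_gt0.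
have Dz : DL z by split=> //; exact/negP.
have [V Vz /(_ _ e2)[N _ hN]] := cg z Dz.
exists N => k l Nk Nl; have := hN k Nk z Dz (nbhs_singleton Vz).
have := hN l Nl z Dz (nbhs_singleton Vz).
case: (green Om (T k) z) (green Om (T l) z) (g z) => [x||] [y||] [c||] //.
rewrite -!EFinB !lte_fin -EFinD lee_fin !ltr_norml => /andP[? ?] /andP[? ?]; lra.
Qed.

(** A gap [e] between two terms at [z] persists, by equicontinuity, as a gap of at least e/3 on a
    ball of positive measure, which convergence in the mean excludes for large indices. *)
Lemma L1loc_gconv g : cvg_L1loc DL G g -> forall z, Om z -> z \notin L -> gconv G z.
Proof.
move=> [iG ig cg] z Oz zL; apply: cauchy_gconv => e e0; have e3 : 0 < e / 3 by rewrite divr_gt0.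
have [r [K1 [r0 h]]] := green_equicont oO D0 OD rhoc prho rho0 rhos TL Oz zL e3.
have [s s0 hs] := open_near oO Oz; have [s' s0' hs'] := tuple_compl_open zL.
pose q := Num.min r (Num.min s s') / 2.
have m0 : 0 < Num.min r (Num.min s s') by rewrite !lt_min r0 s0.
have q0 : 0 < q by rewrite divr_gt0.
have qlt : q < Num.min r (Num.min s s') by rewrite /q; lra.
pose B := [set w : Cn | enorm (w - z) <= q].
have hB w : B w -> [/\ enorm (w - z) < r, Om w & w \notin L].
  move=> /le_lt_trans/(_ qlt); rewrite !lt_min => /and3P[w1 w2 w3].
  by split=> //; [exact: hs|exact: hs'].
have cB : compact B by exact: closed_ball_compact.
have BD : B `<=` DL by move=> w /hB[_ Ow /negP wL].
have mB := measurable_of_coords_compact cB.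
have B0 : (0 < lb (oc @^-1` B))%E by exact: closed_ball_pos.
pose m := fine (lb (oc @^-1` B)).
have mE : lb (oc @^-1` B) = m%:E by rewrite fineK// ge0_fin_numE//; exact: leb2n_compact.
have mpos : 0 < m by rewrite -lte_fin -mE.
(* Two distances of at most [d] to the limit stay strictly below the integral e/3 m of the
   persistent gap. *)
pose d := e / 3 * m / 4.
have d0 : 0 < d by rewrite divr_gt0// mulr_gt0.
have [N hN] := small (cg B cB BD) d0.
exists (maxn K1 N) => k l; rewrite !geq_max => /andP[k1 kN] /andP[l1 lN].
have z0 : enorm (z - z) < r by rewrite subrr enorm0.
rewrite leNgt; apply/negP => hkl.
have mI j : measurable_fun (oc @^-1` B) (fun t => `|(G j \o oc) t - (g \o oc) t|%E).
  apply: measurableT_comp => //; apply: emeasurable_funB.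
    exact: measurable_int (iG j B cB BD).
  exact: measurable_int (ig B cB BD).
have := leeD (hN k kN) (hN l lN); rewrite leNgt => /negP; apply.
have mk : measurable_fun (oc @^-1` B) (fun t => `|green Om (T k) (oc t) - g (oc t)|%E) := mI k.
have ml : measurable_fun (oc @^-1` B) (fun t => `|green Om (T l) (oc t) - g (oc t)|%E) := mI l.
rewrite -ge0_integralD//.
apply: (@lt_le_trans _ _ (\int[lb]_(t in oc @^-1` B) (e / 3)%:E)%E).
  have -> : (\int[lb]_(t in oc @^-1` B) (e / 3)%:E = (e / 3)%:E * m%:E)%E.
    by rewrite -mE; exact: integral_cst.
  rewrite -EFinM -EFinD lte_fin /d.
  have : 0 < e / 3 * m by rewrite mulr_gt0.
  lra.
apply: ge0_le_integral => //.
- by move=> t _; rewrite lee_fin ltW.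
- exact: emeasurable_funD mk ml.
move=> t /= Bt; have [tr Ot tL] := hB _ Bt.
have h1 := h k _ _ k1 tr z0; have h2 := h l _ _ l1 z0 tr.
have gk := green_le0 (T k) Ot; have gl := green_le0 (T l) Ot.
move: hkl h1 h2 gk gl.
case: (green Om (T k) z) (green Om (T k) (oc t)) => [a||] [b||] //;
  case: (green Om (T l) z) (green Om (T l) (oc t)) => [a'||] [b'||] //;
  case: (g (oc t)) => [c||] //; rewrite /= ?leey// -?EFinB -?EFinD ?lee_fin ?lte_fin.
all: move=> *; try by [].
have := ler_normB (b - c) (b' - c); have := ler_norm (b - c - (b' - c)).
lra.
Qed.

End L1Limit.

Lemma glim_shift {R : realType} {X : Type} (F G : nat -> X -> \bar R) z (c : R) :
  (exists K, forall k, (K <= k)%N -> (F k z <= G k z + c%:E)%E) ->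
  (glim F z <= glim G z + c%:E)%E.
Proof.
move=> [K h]; rewrite -leeBlDr//; apply: lee_realP => x gx; have [K' h'] := glim_lt gx.
rewrite leeBlDr//; apply: glim_le; exists (maxn K K') => k; rewrite geq_max => /andP[k1 k2].
by apply: le_trans (h k k1) _; rewrite leeD2r// ltW// h'.
Qed.

(** * Splitting the poles *)

Section Split.
Context {R : realType} {n : nat}.
Hypothesis n0 : (0 < n)%N.
Local Notation C := R[i].
Local Notation Cn := 'rV[C]_n.
Implicit Types (u v : Cn -> \bar R) (z w a : Cn).

Variables (Om : set Cn) (D : R) (rho : Cn -> R).
Hypotheses (oO : open Om) (D0 : 0 < D)
  (OD : forall z w, Om z -> Om w -> enorm (z - w) <= D)
  (rhoc : forall z (e : R), Om z -> 0 < e -> exists2 r : R, 0 < r &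
     forall w, enorm (w - z) < r -> `|rho w - rho z| < e)
  (prho : psh Om (EFin \o rho)) (rho0 : forall z, Om z -> rho z < 0)
  (rhos : forall c : R, c < 0 -> exists2 d : R, 0 < d &
     forall z, Om z -> rho z < c -> forall h, enorm h < d -> Om (z + h)).

Lemma green_sub (T T' : seq Cn) z : {subset T' <= T} -> (green Om T z <= green Om T' z)%E.
Proof.
move=> sT; apply: green_lub => u [pu lu]; apply: green_ub; split=> // a /sT; exact: lu.
Qed.

Section TwoTuples.
Variables (M M' M'' : nat) (T : M.-tuple Cn) (T' : M'.-tuple Cn) (T'' : M''.-tuple Cn).
Hypotheses (TO' : forall j, Om (tnth T' j)) (TO'' : forall j, Om (tnth T'' j))
  (TT : forall a, (a \in T) = (a \in T') || (a \in T'')).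

Lemma green_add z : (green Om T' z + green Om T'' z <= green Om T z)%E.
Proof.
have p' := green_psh n0 oO D0 OD rhoc prho rho0 rhos TO'.
have p'' := green_psh n0 oO D0 OD rhoc prho rho0 rhos TO''.
apply: (green_ub (u := fun w => green Om T' w + green Om T'' w)%E).
split; first exact: psh_neg_add.
move=> a; rewrite TT => /orP[aT|aT].
  have /tnthP[j aE] := aT; have := TO' j; rewrite -aE => /(open_near oO)[r r0 hr].
  apply: log_pole_le (green_log_pole n0 oO TO' aT); apply: (near_punctured r0) => w wr _.
  by rewrite geeDl// p''.2//; exact: hr.
have /tnthP[j aE] := aT; have := TO'' j; rewrite -aE => /(open_near oO)[r r0 hr].
apply: log_pole_le (green_log_pole n0 oO TO'' aT); apply: (near_punctured r0) => w wr _.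
by rewrite geeDr// p'.2//; exact: hr.
Qed.

End TwoTuples.

Let cball M (L : M.-tuple Cn) (r : R) w := exists j, enorm (w - tnth L j) <= r.

Lemma cball_closed M (L : M.-tuple Cn) r : closed (cball L r).
Proof.
apply: closed_enormP => w nw.
have [d d0 hd] := min_pos_ord (f := fun j => enorm (w - tnth L j) - r) (fun j => ltac:(
  by rewrite subr_gt0 ltNge; apply/negP => h; apply: nw; exists j)).
exists d => // y yw [j yj]; have := hd j; have := enorm_triangle y w (tnth L j).
by rewrite (enorm_distC w y); lra.
Qed.

(** The factor 3 leaves distance at least 2 d between a point in a [d]-ball around one tuple and the
    other tuple. *)
Lemma tuples_sep M M' (L : M.-tuple Cn) (L' : M'.-tuple Cn) : (forall a, a \in L -> a \notin L') ->
  exists2 d : R, 0 < d & forall i j, 3 * d <= enorm (tnth L i - tnth L' j).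
Proof.
move=> LL; have h i := notin_tuple_dist (LL _ (mem_tnth i L)).
have [d d0 hd] := min_pos_ord (fun i => s2valP (cid2 (h i))).
exists (d / 3); first by rewrite divr_gt0.
move=> i j; have := s2valP' (cid2 (h i)) j; have := hd i; lra.
Qed.

(** The bound on [rho] makes [A * rho] bounded below there, and with it the Green functions of the
    other poles. *)
Let nb M (L : M.-tuple Cn) (r m : R) w := [/\ Om w, exists j, enorm (w - tnth L j) < r & - m < rho w].

Lemma nb_open M (L : M.-tuple Cn) r m : open (nb L r m).
Proof.
apply: openP => w [Ow [j wj] wm]; have [s s0 hs] := open_near oO Ow.
have [q q0 hq] := rhoc Ow (e := rho w + m) ltac:(by lra).
exists (Num.min (Num.min s q) (r - enorm (w - tnth L j))).
  by rewrite !lt_min s0 q0 subr_gt0.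
move=> y; rewrite !lt_min => /andP[/andP[/hs Oy /hq]]; rewrite ltr_norml => /andP[h1 _] h2.
split=> //; last by lra.
by exists j; have := enorm_triangle w y (tnth L j); lra.
Qed.

Lemma nb_poles M (L : M.-tuple Cn) r : 0 < r -> (forall j, Om (tnth L j)) ->
  exists m, forall j, nb L r m (tnth L j).
Proof.
move=> r0 LO; exists (1 + \sum_j - rho (tnth L j)) => j; split=> //.
  by exists j; rewrite subrr enorm0.
rewrite (bigD1 j)//=.
have : 0 <= \sum_(i | i != j) - rho (tnth L i).
  by apply: sumr_ge0 => i _; rewrite oppr_ge0 ltW// rho0.
lra.
Qed.

Variables (M M' M'' : nat) (T : nat -> M.-tuple Cn) (L : M.-tuple Cn)
  (T' : nat -> M'.-tuple Cn) (L' : M'.-tuple Cn)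
  (T'' : nat -> M''.-tuple Cn) (L'' : M''.-tuple Cn).
Hypotheses (TL : icvg Om T L) (TL' : icvg Om T' L') (TL'' : icvg Om T'' L'')
  (TT : forall k a, (a \in T k) = (a \in T' k) || (a \in T'' k))
  (LL : forall a, (a \in L) = (a \in L') || (a \in L''))
  (disj : forall a, a \in L' -> a \notin L'').
Local Notation G := (fun k => green Om (T k)).
Local Notation G' := (fun k => green Om (T' k)).
Local Notation G'' := (fun k => green Om (T'' k)).

Lemma nb_near M1 (S : nat -> M1.-tuple Cn) P r m : icvg Om S P ->
  (forall j, nb P r m (tnth P j)) ->
  exists K, forall k, (K <= k)%N -> forall a, a \in S k -> nb P r m a.
Proof.
move=> [_ _ SP] hP.
have [d d0 hd] : exists2 d : R, 0 < d & forall j w, enorm (w - tnth P j) < d -> nb P r m w.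
  have h j := open_near (@nb_open _ P r m) (hP j).
  have [d d0 hd] := min_pos_ord (fun i => s2valP (cid2 (h i))).
  exists d => // j w wj; apply: (s2valP' (cid2 (h j))); exact: lt_le_trans wj (hd j).
have [K hK] := SP d d0; exists K => k Kk a /tnthP[j ->]; exact: hd (hK k Kk j).
Qed.

(** [green_liminf] for the poles [T'], with [F k] the full Green function: near [L'] one has G'' >=
    - A m uniformly, hence G' <= G + A m, and the competitor is the upper limit of the [G' k]
    itself. *)
Lemma gconv_part : (forall z, Om z -> z \notin L -> gconv G z) ->
  forall z, Om z -> z \notin L' -> gconv G' z.
Proof.
move=> cG z Oz zL'; have [TO _ _] := TL; have [TO' LO' _] := TL'; have [TO'' LO'' _] := TL''.
have [d d0 hd] := tuples_sep disj; have [m hm] := nb_poles d0 LO'.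
have far w : nb L' d m w -> forall j, d <= enorm (w - tnth L'' j).
  move=> [_ [i wi] _] j; have := hd i j; have := enorm_triangle w (tnth L' i) (tnth L'' j).
  by rewrite (enorm_distC _ w); lra.
have notL w : nb L' d m w -> w \notin L' -> w \notin L.
  move=> hw; rewrite LL negb_or => ->; apply/negP => /tnthP[j wj].
  by have := far w hw j; rewrite wj subrr enorm0; lra.
have [A [K1 [A0 hA]]] := green_ge oO D0 OD rhoc prho rho0 TL'' d0.
have m0 w : nb L' d m w -> A * rho w >= - (A * m).
  by move=> [_ _ wm]; rewrite -mulrN ler_wpM2l// ltW.
have GG k w : (K1 <= k)%N -> nb L' d m w -> (G' k w <= G k w + (A * m)%:E)%E.
  move=> kK hw; have [Ow _ _] := hw.
  rewrite -leeBlDr//; apply: le_trans (green_add (TO' k) (TO'' k) (TT k) w).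
  rewrite leeD2l//; apply: le_trans (hA k w kK Ow (far w hw)).
  by rewrite -EFinN lee_fin m0.
have gm := glim_ext_psh n0 oO D0 OD rhoc prho rho0 rhos TL'.
have lim := @green_liminf _ _ n0 _ _ _ oO D0 OD rhoc prho rho0 _ _ _ TL'
  (nb L' d m) G (glim G) K1 (A * m) (@nb_open _ L' d m) (fun w h => let: And3 Ow _ _ := h in Ow) hm.
move=> e e0; have [|||||K hK] := lim _ _ _ _ (glim_ext Om T' L') (A * m) gm _ z Oz zL' e e0.
- move=> k _; have p := green_psh n0 oO D0 OD rhoc prho rho0 rhos (TO k).
  by split; [apply: psh_subset p.1 => w []|move=> w [Ow _ _]; exact: p.2].
- move=> k _ a aT; apply: (green_log_pole n0 oO (TO k)); by rewrite TT aT.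
- move=> Q cQ QW QL.
  have QO : Q `<=` Om by move=> w /QW[].
  have Qn w : Q w -> w \notin L by move=> Qw; apply: notL; [exact: QW|exact: QL].
  have [K hK] := gconv_unif oO D0 OD rhoc prho rho0 rhos TL cQ QO Qn
    (fun w Qw => cG w (QO w Qw) (Qn w Qw)) ltr01.
  by exists K => k w; exact: hK.
- by move=> k kK w hw; exact: GG.
- move=> w hw wL; rewrite /glim_ext (negPf wL); apply: glim_shift.
  by exists K1 => k kK; exact: GG.
exists K => k kK; have := hK k kK; by rewrite /glim_ext (negPf zL').
Qed.

(** It is used twice: with [u] the upper limit of the [G k] it yields convergence, and with [u] a
    competitor it yields the supremum formula. *)
Lemma gconv_parts_liminf u (c : R) :
  (forall z, Om z -> z \notin L' -> gconv G' z) ->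
  (forall z, Om z -> z \notin L'' -> gconv G'' z) ->
  psh_neg Om u ->
  (forall z, Om z -> (u z <= glim_ext Om T' L' z + c%:E)%E) ->
  (forall z, Om z -> (u z <= glim_ext Om T'' L'' z + c%:E)%E) ->
  forall z, Om z -> z \notin L -> forall e : R, 0 < e ->
  exists K, forall k, (K <= k)%N -> (u z <= G k z + e%:E)%E.
Proof.
move=> c' c'' pu u' u'' z Oz zL e e0.
have [TO LO _] := TL; have [TO' LO' _] := TL'; have [TO'' LO'' _] := TL''.
have [d d0 hd] := tuples_sep disj; have [m' hm'] := nb_poles d0 LO'.
have [m'' hm''] := nb_poles d0 LO''.
have [K1 hK1] := nb_near TL' hm'; have [K2 hK2] := nb_near TL'' hm''.
set W' := nb L' d m' in hm' hK1; set W'' := nb L'' d m'' in hm'' hK2.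
have dis w : W' w -> ~ cball L'' d w.
  move=> [_ [i wi] _] [j wj]; have := hd i j.
  have := enorm_triangle w (tnth L' i) (tnth L'' j); rewrite (enorm_distC _ w); lra.
have dis2 w : W'' w -> ~ cball L' d w.
  move=> [_ [i wi] _] [j wj]; have := hd j i.
  have := enorm_triangle w (tnth L' j) (tnth L'' i); rewrite (enorm_distC _ w); lra.
have cb' w : W' w -> cball L' d w by move=> [_ [i wi] _]; exists i; exact: ltW.
have cb'' w : W'' w -> cball L'' d w by move=> [_ [i wi] _]; exists i; exact: ltW.
have W'O w : W' w -> Om w by case.
have W''O w : W'' w -> Om w by case.
(* The comparison function of [green_liminf] is [G'] around [L'] and [G''] around [L''], on disjoint
   neighbourhoods; it lies above [G], so the constant there is 0. *)
pose F k w := if `[< W' w >] then G' k w else G'' k w.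
pose f w := if `[< W' w >] then glim_ext Om T' L' w else glim_ext Om T'' L'' w.
have F' k w : W' w -> F k w = G' k w by move=> h; rewrite /F asboolT.
have F'' k w : W'' w -> F k w = G'' k w.
  by move=> h; rewrite /F asboolF// => /dis; apply; exact: cb''.
have p' k := green_psh n0 oO D0 OD rhoc prho rho0 rhos (TO' k).
have p'' k := green_psh n0 oO D0 OD rhoc prho rho0 rhos (TO'' k).
have oW' : open W' by exact: nb_open.
have oW'' : open W'' by exact: nb_open.
have oW : open (W' `|` W'') by exact: openU.
have lim := @green_liminf _ _ n0 _ _ _ oO D0 OD rhoc prho rho0 _ _ _ TL
  (W' `|` W'') F f (maxn K1 K2) 0 oW.
have [|||||||K hK] := lim _ _ _ _ _ _ u c pu _ z Oz zL e e0; last by exists K.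
- by move=> w [/W'O|/W''O].
- move=> j; have := mem_tnth j L; rewrite LL => /orP[/tnthP[i ->]|/tnthP[i ->]].
    by left; exact: hm'.
  by right; exact: hm''.
- move=> k _; have F0 w : (W' `|` W'') w -> (F k w <= 0)%E.
    by move=> [h|h]; [rewrite F'// (p' k).2//; exact: W'O|rewrite F''// (p'' k).2//; exact: W''O].
  split=> //; apply: psh_local => // w [h|h].
    exists W', (G' k); split=> //; [exact: psh_subset (p' k).1|exact: F'].
  exists W'', (G'' k); split=> //; [exact: psh_subset (p'' k).1|exact: F''].
- move=> k; rewrite geq_max => /andP[k1 k2] a; rewrite TT => /orP[aT|aT].
    have [r r0 hr] := open_near oW' (hK1 k k1 a aT).
    apply: log_pole_le (green_log_pole n0 oO (TO' k) aT).
    by apply: (near_punctured r0) => w /hr wW _; rewrite F'.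
  have [r r0 hr] := open_near oW'' (hK2 k k2 a aT).
  apply: log_pole_le (green_log_pole n0 oO (TO'' k) aT).
  by apply: (near_punctured r0) => w /hr wW _; rewrite F''.
- move=> Q cQ QW QL.
  have c1 : compact (cball L' d `&` Q).
    by apply: (subclosed_compact _ cQ) => [|w []//]; apply: closedI (@cball_closed _ _ _) (compact_closed (@norm_hausdorff _ _) cQ).
  have c2 : compact (cball L'' d `&` Q).
    by apply: (subclosed_compact _ cQ) => [|w []//]; apply: closedI (@cball_closed _ _ _) (compact_closed (@norm_hausdorff _ _) cQ).
  have QO w : Q w -> Om w by move=> /QW[/W'O|/W''O].
  have QL' w : Q w -> w \notin L' /\ w \notin L''.
    by move=> /QL; rewrite LL negb_or => /andP[].
  have [N1 h1] := gconv_unif oO D0 OD rhoc prho rho0 rhos TL' c1 (fun w h => QO w h.2)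
    (fun w h => (QL' w h.2).1) (fun w h => c' w (QO w h.2) (QL' w h.2).1) ltr01.
  have [N2 h2] := gconv_unif oO D0 OD rhoc prho rho0 rhos TL'' c2 (fun w h => QO w h.2)
    (fun w h => (QL' w h.2).2) (fun w h => c'' w (QO w h.2) (QL' w h.2).2) ltr01.
  exists (maxn N1 N2) => k w; rewrite geq_max => /andP[k1 k2] Qw.
  have [n1 n2] := QL' w Qw; rewrite /f.
  case: (QW w Qw) => hw.
    rewrite asboolT// F'// /glim_ext (negPf n1); apply: h1 => //; split=> //; exact: cb'.
  rewrite asboolF; last by move=> /dis; apply; exact: cb''.
  rewrite F''// /glim_ext (negPf n2); apply: h2 => //; split=> //; exact: cb''.
- move=> k _ w [h|h]; rewrite adde0.
    by rewrite F'//; apply: green_sub => a aT; rewrite TT aT.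
  by rewrite F''//; apply: green_sub => a aT; rewrite TT aT orbT.
move=> w [h|h] wL; rewrite /f.
  by rewrite asboolT//; apply: u'; exact: W'O.
rewrite asboolF; last by move=> /dis; apply; exact: cb''.
by apply: u''; exact: W''O.
Qed.

End Split.

(** * Assembling the equivalences and the formula for the limit *)

Lemma icvg_tnth_eq {R : realType} n (Om : set 'rV[R[i]]_n) M M'
    (T : nat -> M.-tuple 'rV[R[i]]_n) L (T' : nat -> M'.-tuple 'rV[R[i]]_n) L' j i :
  icvg Om T L -> icvg Om T' L' -> (forall k, tnth (T k) j = tnth (T' k) i) ->
  tnth L j = tnth L' i.
Proof.
move=> [_ _ hT] [_ _ hT'] TT; apply/eqP; rewrite -subr_eq0 -enorm_eq0 eq_le enorm_ge0 andbT.
rewrite leNgt; apply/negP => e0; set e := enorm _ in e0.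
have e2 : 0 < e / 2 by rewrite divr_gt0.
have [K1 h1] := hT _ e2; have [K2 h2] := hT' _ e2.
have := h1 (maxn K1 K2) (leq_maxl _ _) j; have := h2 (maxn K1 K2) (leq_maxr _ _) i.
rewrite TT; set t := tnth (T' _) i.
have := enorm_triangle t (tnth L j) (tnth L' i); rewrite -/e (enorm_distC _ t).
lra.
Qed.

(** The form in which hyperconvexity is used: relative compactness of the sublevel sets becomes a
    positive distance to the complement of [Om], which says how far points may be moved. *)
Lemma hyperconvex_data {R : realType} n (Om : set 'rV[R[i]]_n) :
  bounded_domain Om -> hyperconvex Om ->
  exists (D : R) (rho : 'rV[R[i]]_n -> R), [/\ open Om /\ 0 < D,
   forall z w, Om z -> Om w -> enorm (z - w) <= D,
   forall z (e : R), Om z -> 0 < e -> exists2 r : R, 0 < r &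
     forall w, enorm (w - z) < r -> `|rho w - rho z| < e,
   psh Om (EFin \o rho) /\ forall z, Om z -> rho z < 0 &
   forall c : R, c < 0 -> exists2 d : R, 0 < d &
     forall z, Om z -> rho z < c -> forall h, enorm h < d -> Om (z + h)].
Proof.
move=> [oO _ _ [m hm]] [rho [rc pr r0 rK]].
exists (2 * `|m| + 1), rho; split; last first.
- move=> c /rK[cK KO].
  have /compact_near_coveringP cv := cK.
  have [z Kz|k _ hk] := cv nat \oo (fun k z => forall h, enorm h < k.+1%:R^-1 -> Om (z + h)) _; last first.
    exists k.+1%:R^-1; first by rewrite invr_gt0.
    move=> z Oz zc h hh; apply: (hk k (leqnn k) z) => //.
    exact: (@subset_closure _ [set w | Om w /\ rho w < c]).
  have [r rp hr] := open_near oO (KO z Kz).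
  have r2 : 0 < r / 2 by rewrite divr_gt0.
  have nz : \forall w \near z, enorm (w - z) < r / 2 by apply/nbhs_enormP; exists (r / 2).
  near=> w k => h hh; apply: hr.
  have wz : enorm (w - z) < r / 2 by near: w.
  have kr : (k.+1%:R^-1 : R) < r / 2.
    by near: k; exact: (near_infty_natSinv_lt (PosNum r2)).
  have := enormD (w - z) h; rewrite addrAC.
  have := lt_trans hh kr; lra.
- by [].
- move=> z e Oz e0; move: rc; rewrite continuous_open_subspace// => /(_ z (mem_set Oz)).
  move=> /cvgrPdist_lt/(_ e e0)/nbhs_enormP[r rp hr]; exists r => // w /hr.
  by rewrite distrC.
- move=> z w /hm zm /hm wm; have := enormD z (- w); rewrite enormN; have := ler_norm m; lra.
- by split=> //; rewrite ltr_wpDl// mulr_ge0.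
Unshelve. all: by end_near. Qed.

Theorem proposition1p9 (R : realType) (n : nat) (hn : (0 < n)%N)
  (Om : set 'rV[R[i]]_n) (bOm : bounded_domain Om) (hOm : hyperconvex Om)
  (N N' N'' : nat) (hN : (N' + N'')%N = N)
  (S : nat -> N.-tuple 'rV[R[i]]_n) (L : N.-tuple 'rV[R[i]]_n)
  (S' : nat -> N'.-tuple 'rV[R[i]]_n) (L' : N'.-tuple 'rV[R[i]]_n)
  (S'' : nat -> N''.-tuple 'rV[R[i]]_n) (L'' : N''.-tuple 'rV[R[i]]_n)
  (cS : interior_cvg Om S L)
  (hS : forall k, S k = S' k ++ S'' k :> seq 'rV[R[i]]_n)
  (cS' : interior_cvg Om S' L') (cS'' : interior_cvg Om S'' L'')
  (disj : poles L' `&` poles L'' = set0) :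
  let G := fun k => green Om (S k) in
  let G' := fun k => green Om (S' k) in
  let G'' := fun k => green Om (S'' k) in
  let D := Om `\` poles L in
  let D' := Om `\` poles L' in
  let D'' := Om `\` poles L'' in
  [<-> exists g, cvg_L1loc D G g;
       exists g, cvg_locunif D G g;
       (exists g', cvg_L1loc D' G' g') /\ (exists g'', cvg_L1loc D'' G'' g'');
       (exists g', cvg_locunif D' G' g') /\ (exists g'', cvg_locunif D'' G'' g'')]
  /\ ((exists g, cvg_L1loc D G g) ->
      [/\ exists g, [/\ psh Om g, cvg_L1loc D G g & cvg_locunif D G g],
          exists g', [/\ psh Om g', cvg_L1loc D' G' g' & cvg_locunif D' G' g'],
          exists g'', [/\ psh Om g'', cvg_L1loc D'' G'' g'' & cvg_locunif D'' G'' g''] &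
          forall g g' g'',
            psh Om g -> cvg_L1loc D G g ->
            psh Om g' -> cvg_L1loc D' G' g' ->
            psh Om g'' -> cvg_L1loc D'' G'' g'' ->
            forall z, Om z ->
              g z = ereal_sup [set u z | u in
                [set u | [/\ psh_neg Om u, le_O1 Om u g' & le_O1 Om u g'']]]]).
Proof.
have [dm [rho [[oO D0] OD rhoc [prho rho0] rhos]]] := hyperconvex_data bOm hOm.
have TL := interior_cvg_icvg cS; have TL' := interior_cvg_icvg cS'.
have TL'' := interior_cvg_icvg cS''.
subst N; move=> G G' G'' D D' D''.
have TT k a : (a \in S k) = (a \in S' k) || (a \in S'' k).
  by rewrite -mem_cat -hS.
have E' k i : tnth (S k) (lshift N'' i) = tnth (S' k) i.
  by rewrite (tnth_nth 0) hS nth_cat size_tuple /= ltn_ord -tnth_nth.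
have E'' k i : tnth (S k) (rshift N' i) = tnth (S'' k) i.
  by rewrite (tnth_nth 0) hS nth_cat size_tuple /= ltnNge leq_addr /= addKn -tnth_nth.
have LL a : (a \in L) = (a \in L') || (a \in L'').
  apply/idP/orP => [/tnthP[j ->]|[/tnthP[i ->]|/tnthP[i ->]]].
  - have [i ->|i ->] := split_ordP j; [left|right].
      by rewrite (icvg_tnth_eq TL TL' (fun k => E' k i)) mem_tnth.
    by rewrite (icvg_tnth_eq TL TL'' (fun k => E'' k i)) mem_tnth.
  - by rewrite -(icvg_tnth_eq TL TL' (fun k => E' k i)) mem_tnth.
  - by rewrite -(icvg_tnth_eq TL TL'' (fun k => E'' k i)) mem_tnth.
have dj a : a \in L' -> a \notin L''.
  move=> a'; apply/negP => a''; have : (poles L' `&` poles L'') a by [].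
  by rewrite disj.
have dj2 a : a \in L'' -> a \notin L' by move=> a''; apply/negP => /dj; rewrite a''.
have TT2 k a : (a \in S k) = (a \in S'' k) || (a \in S' k) by rewrite orbC.
have LL2 a : (a \in L) = (a \in L'') || (a \in L') by rewrite orbC.
pose cv M (T : nat -> M.-tuple 'rV[R[i]]_n) (P : M.-tuple 'rV[R[i]]_n) :=
  forall z, Om z -> z \notin P -> gconv (fun k => green Om (T k)) z.
have L1cv M (T : nat -> M.-tuple 'rV[R[i]]_n) P : icvg Om T P ->
    cv _ T P <-> exists g, cvg_L1loc (Om `\` poles P) (fun k => green Om (T k)) g.
  move=> TP; split=> [h|[g]]; first by eexists; exact: (gconv_L1loc hn oO D0 OD rhoc prho rho0 rhos TP h).
  exact: (L1loc_gconv oO D0 OD rhoc prho rho0 rhos TP).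
have lucv M (T : nat -> M.-tuple 'rV[R[i]]_n) P : icvg Om T P ->
    cv _ T P <-> exists g, cvg_locunif (Om `\` poles P) (fun k => green Om (T k)) g.
  move=> TP; split=> [h|[g]]; first by eexists; exact: (gconv_locunif oO D0 OD rhoc prho rho0 rhos TP h).
  exact: locunif_gconv.
have lim M (T : nat -> M.-tuple 'rV[R[i]]_n) P : icvg Om T P -> cv _ T P ->
    [/\ psh Om (glim_ext Om T P),
      cvg_L1loc (Om `\` poles P) (fun k => green Om (T k)) (glim_ext Om T P) &
      cvg_locunif (Om `\` poles P) (fun k => green Om (T k)) (glim_ext Om T P)].
  move=> TP h; split; first exact: (glim_ext_psh hn oO D0 OD rhoc prho rho0 rhos TP).1.
    exact: (gconv_L1loc hn oO D0 OD rhoc prho rho0 rhos TP h).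
  exact: (gconv_locunif oO D0 OD rhoc prho rho0 rhos TP h).
(* Any plurisubharmonic limit in the mean is [glim_ext] at every point of [Om], poles included, so
   the formula need only be verified for [glim_ext]. *)
have uniq_lim M (T : nat -> M.-tuple 'rV[R[i]]_n) P g : icvg Om T P -> psh Om g ->
    cvg_L1loc (Om `\` poles P) (fun k => green Om (T k)) g ->
    cv _ T P /\ forall z, Om z -> g z = glim_ext Om T P z.
  move=> TP pg cg; have c : cv _ T P by apply/(L1cv _ _ _ TP); exists g.
  have [pG cG _] := lim _ _ _ TP c; split=> //.
  by apply: (psh_ae_unique hn oO pg pG (P := P)) => K cK KD; exact: L1loc_limit_ae cg cG cK KD.
have glim_sub M1 M2 (T1 : nat -> M1.-tuple _) (P1 : M1.-tuple _) (T2 : nat -> M2.-tuple _) (P2 : M2.-tuple _) :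
    (forall k a, a \in T2 k -> a \in T1 k) -> (forall a, a \in P2 -> a \in P1) ->
    forall z, (glim_ext Om T1 P1 z <= glim_ext Om T2 P2 z)%E.
  move=> sT sP z; rewrite /glim_ext; case: ifPn => [|z1]; first by rewrite leNye.
  rewrite ifN; last by apply: contra z1; exact: sP.
  rewrite -[leRHS]adde0; apply: glim_shift; exists 0%N => k _; rewrite adde0.
  by apply: green_sub => a; exact: sT.
have s' := glim_sub _ _ S L S' L' (fun k a aS => ltac:(by rewrite TT aS))
  (fun a aL => ltac:(by rewrite LL aL)).
have s'' := glim_sub _ _ S L S'' L'' (fun k a aS => ltac:(by rewrite TT aS orbT))
  (fun a aL => ltac:(by rewrite LL aL orbT)).
have pE := glim_ext_psh hn oO D0 OD rhoc prho rho0 rhos TL.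
have split1 : cv _ S L -> cv _ S' L' /\ cv _ S'' L''.
  move=> h; split.
    exact: (gconv_part hn oO D0 OD rhoc prho rho0 rhos TL TL' TL'' TT LL dj h).
  exact: (gconv_part hn oO D0 OD rhoc prho rho0 rhos TL TL'' TL' TT2 LL2 dj2 h).
(* The upper limit of the [G k] is itself admissible with constant 0, and the resulting bound says
   that it is at most the lower limit. *)
have split2 : cv _ S' L' -> cv _ S'' L'' -> cv _ S L.
  move=> h' h'' z Oz zL e e0.
  have [|z0 _|z0 _|K hK] := gconv_parts_liminf hn oO D0 OD rhoc prho rho0 rhos TL TL' TL'' TT LL dj
    (u := glim_ext Om S L) (c := 0) h' h'' _ _ _ Oz zL e0.
  - exact: pE.
  - by rewrite adde0.
  - by rewrite adde0.
  by exists K => k kK; have := hK k kK; rewrite /glim_ext (negPf zL).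
split.
  tfae.
  - by move=> /(L1cv _ _ _ TL) /(lucv _ _ _ TL).
  - move=> /(lucv _ _ _ TL) /split1[c' c''].
    by split; [apply/(L1cv _ _ _ TL')|apply/(L1cv _ _ _ TL'')].
  - move=> [/(L1cv _ _ _ TL') c' /(L1cv _ _ _ TL'') c''].
    by split; [apply/(lucv _ _ _ TL')|apply/(lucv _ _ _ TL'')].
  - move=> [/(lucv _ _ _ TL') c' /(lucv _ _ _ TL'') c''].
    by apply/(L1cv _ _ _ TL); exact: split2.
move=> /(L1cv _ _ _ TL) c; have [c' c''] := split1 c; split.
- by exists (glim_ext Om S L); exact: lim.
- by exists (glim_ext Om S' L'); exact: lim.
- by exists (glim_ext Om S'' L''); exact: lim.
move=> g g' g'' pg cg pg' cg' pg'' cg'' z Oz.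
have [_ gE] := uniq_lim _ _ _ _ TL pg cg.
have [_ gE'] := uniq_lim _ _ _ _ TL' pg' cg'.
have [_ gE''] := uniq_lim _ _ _ _ TL'' pg'' cg''.
apply/eqP; rewrite eq_le; apply/andP; split.
  (* The limit is one of the competitors, with constants 0, since adding poles lowers Green
     functions. *)
  rewrite gE//; apply: ereal_sup_ubound; exists (glim_ext Om S L) => //; split=> //.
    by exists 0 => w Ow; rewrite adde0 gE'.
  by exists 0 => w Ow; rewrite adde0 gE''.
apply: ge_ereal_sup => _ [u [pu [b' u'] [b'' u'']] <-]; rewrite gE//.
(* At a limit pole one of g', g'' is -oo, which forces the competitor to be -oo as well. *)
have [zL|zL] := boolP (z \in L).
  rewrite /glim_ext zL; move: zL; rewrite LL => /orP[zL|zL].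
    by have := u' z Oz; rewrite gE'// /glim_ext zL.
  by have := u'' z Oz; rewrite gE''// /glim_ext zL.
apply/lee_addgt0Pr => e e0.
have [||K hK] := gconv_parts_liminf hn oO D0 OD rhoc prho rho0 rhos TL TL' TL'' TT LL dj
  (u := u) (c := Num.max b' b'') c' c'' pu _ _ Oz zL e0.
- move=> w Ow; rewrite -gE'//; apply: le_trans (u' w Ow) _.
  by rewrite leeD2l// lee_fin le_max lexx.
- move=> w Ow; rewrite -gE''//; apply: le_trans (u'' w Ow) _.
  by rewrite leeD2l// lee_fin le_max lexx orbT.
rewrite -leeBlDr// /glim_ext (negPf zL); apply: glim_ge; exists K => k kK.
by rewrite leeBlDr//; exact: hK.
Qed.
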